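(* Let $\Gamma\subseteq\mathrm{PSL}_{2}(\mathbb{R})$ be a cocompact Fuchsian subgroup which does not contain elliptic elements, and let $M=\Gamma\backslash\mathbb{H}$. Then, for all sufficiently large integers $k$, $$\sup_{z\in M}S_{k}^{\Gamma}(z)\geq\frac{2k-1}{4\pi}.$$
   Context: $\mathbb{H}=\{z=x+iy\in\mathbb{C}: y>0\}$ is the upper half-plane, on which $\mathrm{PSL}_{2}(\mathbb{R})$ acts by fractional linear transformations. A Fuchsian subgroup is a discrete subgroup of $\mathrm{PSL}_{2}(\mathbb{R})$; it is cocompact if $M=\Gamma\backslash\mathbb{H}$ is compact. $\mu_{\mathrm{hyp}}(z)=\frac{\mathrm{d}x\wedge\mathrm{d}y}{y^{2}}$ is the hyperbolic volume form. For an integer $k\geq 1$, $\mathcal{S}_{2k}^{\Gamma}$ is the finite-dimensional complex vector space of cusp forms of weight $2k$ for $\Gamma$, i.e. holomorphic $f:\mathbb{H}\to\mathbb{C}$ with $f(\gamma z)=(cz+d)^{2k}f(z)$ for all $\gamma=\begin{pmatrix}a&b\\c&d\end{pmatrix}\in\Gamma$ that vanish at all cusps of $M$ (there are none when $\Gamma$ is cocompact). It carries the Petersson inner product $\langle f_{1},f_{2}\rangle=\int_{M}f_{1}(z)\overline{f_{2}(z)}\,y^{2k}\,\mu_{\mathrm{hyp}}(z)$. For an orthonormal basis $\{f_{1},\ldots,f_{d}\}$ of $\mathcal{S}_{2k}^{\Gamma}$, put $S_{k}^{\Gamma}(z):=\sum_{j=1}^{d}|f_{j}(z)|^{2}\,\mathrm{Im}(z)^{2k}$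 for $z\in\mathbb{H}$. This is independent of the choice of orthonormal basis and $\Gamma$-invariant, hence a function on $M$. *)

(* Defs.v *)
From HB Require Import structures.
From mathcomp Require Import all_boot all_order all_algebra.
From mathcomp Require Import all_classical all_reals all_analysis.
From mathcomp Require Import complex ring.

Set Implicit Arguments.
Unset Strict Implicit.
Unset Printing Implicit Defensive.

Import Order.TTheory GRing.Theory Num.Theory.
Import numFieldNormedType.Exports.

Local Open Scope classical_set_scope.
Local Open Scope ring_scope.
Local Open Scope complex_scope.
Local Open Scope quotient_scope.

Definition SL2 (R : realType) : Type := {A : 'M[R]_2 | \det A == 1}.

HB.instance Definition _ (R : realType) := SubType.on (SL2 R).
HB.instance Definition _ (R : realType) := [Choice of SL2 R by <:].
HB.instance Definition _ (R : realType) := Topological.copy (SL2 R)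
  (initial_topology (val : SL2 R -> 'M[R]_2)).

Section SL2Group.
Variable R : realType.
Implicit Types A B : SL2 R.

Lemma SL2_det A : \det (val A) = 1.
Proof. exact/eqP/(valP A). Qed.

Lemma SL2_unit A : val A \is a GRing.unit.
Proof. by have := unitmxE (val A); rewrite SL2_det unitr1. Qed.

Lemma SL2_one_subproof : \det (1 : 'M[R]_2) == 1.
Proof. by rewrite det1. Qed.

Lemma SL2_inv_subproof A : \det ((val A)^-1) == 1.
Proof. by rewrite det_inv SL2_det invr1. Qed.

Lemma SL2_mul_subproof A B : \det (val A * val B) == 1.
Proof. by rewrite det_mulmx !SL2_det mulr1. Qed.

Definition SL2_one : SL2 R := exist _ 1 SL2_one_subproof.
Definition SL2_inv A : SL2 R := exist _ (val A)^-1 (SL2_inv_subproof A).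
Definition SL2_mul A B : SL2 R := exist _ (val A * val B) (SL2_mul_subproof A B).

Lemma SL2_mulA : associative SL2_mul.
Proof. by move=> A B C; apply: val_inj; rewrite /= mulrA. Qed.
Lemma SL2_mul1 : left_id SL2_one SL2_mul.
Proof. by move=> A; apply: val_inj; rewrite /= mul1r. Qed.
Lemma SL2_mulr1 : right_id SL2_one SL2_mul.
Proof. by move=> A; apply: val_inj; rewrite /= mulr1. Qed.
Lemma SL2_mulV : left_inverse SL2_one SL2_inv SL2_mul.
Proof. by move=> A; apply: val_inj; rewrite /= mulVr ?SL2_unit. Qed.
Lemma SL2_mulrV : right_inverse SL2_one SL2_inv SL2_mul.
Proof. by move=> A; apply: val_inj; rewrite /= mulrV ?SL2_unit. Qed.

HB.instance Definition _ := isGroup.Build (SL2 R)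
  SL2_mulA SL2_mul1 SL2_mulr1 SL2_mulV SL2_mulrV.

Definition SL2_sign_rel A B := (val A == val B) || (val A == - val B).

Lemma SL2_sign_refl : reflexive SL2_sign_rel.
Proof. by move=> A; rewrite /SL2_sign_rel eqxx. Qed.
Lemma SL2_sign_sym : symmetric SL2_sign_rel.
Proof. 
move=> A B; rewrite /SL2_sign_rel eq_sym; congr (_ || _).
by rewrite -eqr_oppLR eq_sym. Qed.
Lemma SL2_sign_trans : transitive SL2_sign_rel.
Proof.
move=> B A C /orP[] /eqP E /orP[] /eqP E'; rewrite /SL2_sign_rel E E' ?opprK;
  by rewrite eqxx ?orbT.
Qed.

Canonical SL2_sign_equiv :=
  EquivRel SL2_sign_rel SL2_sign_refl SL2_sign_sym SL2_sign_trans.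

Definition PSL2 := {eq_quot SL2_sign_equiv}.

HB.instance Definition _ := Topological.copy PSL2 (quotient_topology PSL2).
HB.instance Definition _ := Quotient.on PSL2.

Lemma PSL2_eqP A B :
  reflect (val A = val B \/ val A = - val B) (\pi_PSL2 A == \pi_PSL2 B).
Proof.
rewrite (_ : (_ == _) = SL2_sign_rel A B); last first.
  by apply/eqP/idP => [/eqmodP//|AB]; exact/eqmodP.
by apply: (iffP orP) => -[] AB; [left|right|left|right]; apply/eqP.
Qed.

Lemma repr_PSL2 A : val (repr (\pi_PSL2 A)) = val A \/
  val (repr (\pi_PSL2 A)) = - val A.
Proof. by apply/PSL2_eqP; rewrite reprK. Qed.

Definition PSL2_one : PSL2 := \pi_PSL2 1%g.
Definition PSL2_inv (g : PSL2) : PSL2 := \pi_PSL2 (repr g)^-1%g.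
Definition PSL2_mul (g h : PSL2) : PSL2 := \pi_PSL2 (repr g * repr h)%g.

Lemma PSL2_piM A B : \pi_PSL2 (A * B)%g = PSL2_mul (\pi_PSL2 A) (\pi_PSL2 B).
Proof.
apply/eqP/PSL2_eqP => /=.
have [->|->] := repr_PSL2 A; have [->|->] := repr_PSL2 B;
  rewrite ?mulrN ?mulNr ?opprK; by [left|right].
Qed.

Lemma PSL2_piV A : \pi_PSL2 (A^-1)%g = PSL2_inv (\pi_PSL2 A).
Proof.
apply/eqP/PSL2_eqP => /=.
by have [->|->] := repr_PSL2 A; rewrite ?invrN ?opprK; [left|right].
Qed.

Lemma PSL2_mulA : associative PSL2_mul.
Proof.
move=> g h k; rewrite -(reprK g) -(reprK h) -(reprK k).
by rewrite -(PSL2_piM (repr h)) -!(PSL2_piM (repr g)) -PSL2_piM mulgA.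
Qed.
Lemma PSL2_mul1 : left_id PSL2_one PSL2_mul.
Proof. by move=> g; rewrite -(reprK g) -PSL2_piM mul1g. Qed.
Lemma PSL2_mulr1 : right_id PSL2_one PSL2_mul.
Proof. by move=> g; rewrite -(reprK g) -PSL2_piM mulg1. Qed.
Lemma PSL2_mulV : left_inverse PSL2_one PSL2_inv PSL2_mul.
Proof. by move=> g; rewrite -(reprK g) -PSL2_piV -PSL2_piM mulVg. Qed.
Lemma PSL2_mulrV : right_inverse PSL2_one PSL2_inv PSL2_mul.
Proof. by move=> g; rewrite -(reprK g) -PSL2_piV -PSL2_piM mulgV. Qed.

HB.instance Definition _ := isGroup.Build PSL2
  PSL2_mulA PSL2_mul1 PSL2_mulr1 PSL2_mulV PSL2_mulrV.

End SL2Group.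

Definition uhp (R : realType) : Type := {z : R[i] | 0 < complex.Im z}.

HB.instance Definition _ (R : realType) := SubType.on (uhp R).
HB.instance Definition _ (R : realType) := [Choice of uhp R by <:].
HB.instance Definition _ (R : realType) := Topological.copy (uhp R)
  (initial_topology (val : uhp R -> R[i]^o)).

Section Action.
Variable R : realType.
Implicit Types (A B : SL2 R) (z w : uhp R).

Definition imz z : R := complex.Im (val z).

Definition moebius_num A z : R[i] :=
  (val A ord0 ord0)%:C * val z + (val A ord0 ord_max)%:C.
Definition moebius_den A z : R[i] :=
  (val A ord_max ord0)%:C * val z + (val A ord_max ord_max)%:C.

Lemma SL2_adbc A : val A ord0 ord0 * val A ord_max ord_max
  - val A ord0 ord_max * val A ord_max ord0 = 1.
Proof.
have := SL2_det A; rewrite (expand_det_row _ ord0) !big_ord_recl big_ord0 addr0.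
rewrite /cofactor !det_mx11 !mxE /= expr0 expr1 mul1r mulN1r mulrN.
have e1 : lift ord0 (ord0 : 'I_1) = ord_max :> 'I_2 by exact: val_inj.
have e2 : lift ord_max (ord0 : 'I_1) = ord0 :> 'I_2 by exact: val_inj.
by rewrite !e1 e2.
Qed.

Lemma moebius_den_neq0 A z : moebius_den A z != 0.
Proof.
case: z => -[x y] /= y0; rewrite /moebius_den /=.
rewrite eq_complex /= !mul0r subr0 !addr0; apply/negP => /andP[/eqP cd].
rewrite mulf_eq0 (gt_eqF y0) orbF => /eqP c0.
have := SL2_adbc A; move: cd; rewrite c0 mul0r add0r => ->.
by rewrite !mulr0 subrr => /esym/eqP; rewrite oner_eq0.
Qed.

Lemma moebius_subproof A z :
  0 < complex.Im (moebius_num A z / moebius_den A z).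
Proof.
have := moebius_den_neq0 A z; have := SL2_adbc A.
case: z => -[x y] /= y0; rewrite /moebius_den /moebius_num /=.
move: (val A ord0 ord0) (val A ord0 ord_max) (val A ord_max ord0)
  (val A ord_max ord_max) => a b c d adbc.
rewrite eq_complex /= !mul0r !subr0 !addr0 => n0.
set n := _ ^+ 2 + _ ^+ 2.
have n1 : 0 < n.
  rewrite lt_neqAle addr_ge0 ?sqr_ge0// andbT eq_sym paddr_eq0 ?sqr_ge0//.
  by rewrite !sqrf_eq0.
have -> : (a * x + b) * - ((c * y) / n) + a * y * ((c * x + d) / n) =
  (a * d - b * c) * y / n by field; rewrite gt_eqF.
by rewrite adbc mul1r divr_gt0.
Qed.

Definition moebius A z : uhp R :=
  exist _ (moebius_num A z / moebius_den A z) (moebius_subproof A z).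

Lemma moebius_sign A B z : val A = val B \/ val A = - val B ->
  moebius A z = moebius B z.
Proof.
move=> AB; apply: val_inj; rewrite /= /moebius_num /moebius_den.
case: AB => ->//; rewrite !mxE !rmorphN !mulNr -!opprD.
by rewrite invrN mulrNN.
Qed.

Lemma moebius1 z : moebius 1%g z = z.
Proof.
by apply: val_inj; rewrite /= /moebius_num /moebius_den /= !mxE /= mul1r mul0r
  addr0 add0r divr1.
Qed.

Lemma moebiusM A B z : moebius (A * B)%g z = moebius A (moebius B z).
Proof.
apply: val_inj; rewrite /=.
have := moebius_den_neq0 B z; have := moebius_den_neq0 A (moebius B z).
have := moebius_den_neq0 (A * B)%g z.
rewrite /moebius_num /moebius_den /= !mxE !big_ord_recl !big_ord0 !addr0.
rewrite (_ : lift ord0 ord0 = ord_max); last exact: val_inj.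
rewrite !rmorphD !rmorphM /= /moebius_num /moebius_den.
set a := (val A ord0 ord0)%:C; set b := (val A ord0 ord_max)%:C.
set c := (val A ord_max ord0)%:C; set d := (val A ord_max ord_max)%:C.
set a' := (val B ord0 ord0)%:C; set b' := (val B ord0 ord_max)%:C.
set c' := (val B ord_max ord0)%:C; set d' := (val B ord_max ord_max)%:C.
change (sval z) with (val z).
move: (val z) a b c d a' b' c' d' => w a b c d a' b' c' d' h1 _ h3.
field; rewrite h3 /=; apply: contraNneq h1 => E.
by apply/eqP; rewrite -[RHS]E; ring.
Qed.

(* independent of the representative, see [act_pi] *)
Definition act (g : PSL2 R) z : uhp R := moebius (repr g) z.

Lemma act_pi A z : act (\pi_(PSL2 R) A) z = moebius A z.
Proof. exact/moebius_sign/repr_PSL2. Qed.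

Lemma act1 z : act 1%g z = z.
Proof. by rewrite [LHS]act_pi moebius1. Qed.

Lemma actM g h z : act (g * h)%g z = act g (act h z).
Proof. by rewrite [LHS]act_pi moebiusM. Qed.

End Action.

Section Quotient.
Variables (R : realType) (G : groupClosed (PSL2 R)).

Definition orbit_rel (z w : uhp R) := `[< exists2 g, g \in G & w = act g z >].

Lemma orbit_refl : reflexive orbit_rel.
Proof. by move=> z; apply/asboolP; exists 1%g; rewrite ?gpred1// act1. Qed.

Lemma orbit_sym : symmetric orbit_rel.
Proof.
suff H z w : orbit_rel z w -> orbit_rel w z by move=> z w; apply/idP/idP => /H.
move=> /asboolP[g gG ->]; apply/asboolP; exists g^-1%g; first exact: gpredVr.
by rewrite -actM mulVg act1.
Qed.

Lemma orbit_trans : transitive orbit_rel.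
Proof.
move=> w z v /asboolP[g gG ->] /asboolP[h hG ->]; apply/asboolP.
by exists (h * g)%g; [exact: gpredM | rewrite actM].
Qed.

Canonical orbit_equiv := EquivRel orbit_rel orbit_refl orbit_sym orbit_trans.

Definition quot_uhp := {eq_quot orbit_equiv}.

HB.instance Definition _ := Topological.copy quot_uhp (quotient_topology quot_uhp).
HB.instance Definition _ := Quotient.on quot_uhp.

End Quotient.

Section Fuchsian.
Variables (R : realType) (G : groupClosed (PSL2 R)).

(* the subspace topology that [G] inherits from PSL_2(R) is discrete *)
Definition fuchsian :=
  forall g, g \in G -> isolated [set h : PSL2 R | h \in G] g.

Definition cocompact := compact [set: quot_uhp G].

(* the trace is defined up to sign on PSL_2(R) *)
Definition elliptic (g : PSL2 R) := `|\tr (val (repr g))| < 2.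

End Fuchsian.

Section CuspForms.
Variables (R : realType) (G : groupClosed (PSL2 R)) (k : nat).
Implicit Types f : uhp R -> R[i].

(* Only the values on the open upper half-plane matter for the complex
   derivative at its points and for integrals over subsets of it. *)
Definition extend (V : nmodType) (f : uhp R -> V) : R[i] -> V :=
  fun w => oapp f 0 (insub w).

Definition holomorphic f :=
  forall z : uhp R, derivable (extend f : R[i]^o -> R[i]^o) (val z) 1.

(* The factor (cz + d)^(2k) is even in [A], so the two representatives of an
   element of [G] give the same condition. *)
Definition automorphic f := forall (A : SL2 R) (z : uhp R),
  \pi_(PSL2 R) A \in G -> f (moebius A z) = moebius_den A z ^+ (2 * k) * f z.

Definition translation_mx (h : R) : 'M[R]_2 :=
  \matrix_(i, j) if (i == ord0) && (j == ord_max) then h else (i == j)%:R.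

Lemma translation_subproof (h : R) : \det (translation_mx h) == 1.
Proof.
rewrite (expand_det_row _ ord0) !big_ord_recl big_ord0 /cofactor !det_mx11.
by rewrite !mxE /= expr0 !mul1r !mulr0 !addr0.
Qed.

Definition translation (h : R) : SL2 R :=
  exist _ (translation_mx h) (translation_subproof h).

(* [S] maps the point at infinity to a cusp of [G]: the parabolic elements of
   PSL_2(R) that fix the image of infinity under [S] are the classes of the
   conjugates by [S] of the nontrivial translations. *)
Definition to_cusp (S : SL2 R) := exists2 h : R, h != 0 &
  \pi_(PSL2 R) (S * translation h * S^-1)%g \in G.

(* the constant Fourier coefficient at each cusp is zero, stated as decay of
   the weight 2k slash of [f] by [S] at infinity *)
Definition vanishes_at_cusps f := forall S : SL2 R, to_cusp S ->
  forall e : R, 0 < e -> exists Y : R, forall z : uhp R, Y < imz z ->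
  `| f (moebius S z) / moebius_den S z ^+ (2 * k) | < e%:C.

Definition cusp_form f :=
  [/\ holomorphic f, automorphic f & vanishes_at_cusps f].

End CuspForms.

Section Petersson.
Variables (R : realType) (G : groupClosed (PSL2 R)).
Implicit Types (F : set (uhp R)) (k : nat).

Definition coords F : set (measurableTypeR R * measurableTypeR R) :=
  [set p | exists2 z, F z & val z = p.1 +i* p.2].

(* A Borel set that meets every orbit in exactly one point. Integrals over the
   quotient of functions invariant under [G] are computed on such a set. *)
Definition fundamental_domain F :=
  measurable (coords F) /\ set_bij F [set: quot_uhp G] \pi_(quot_uhp G).

(* integral over [F] with respect to dx dy / y^2 *)
Definition hyp_integral F (u : uhp R -> R) : R :=
  (\int[(@lebesgue_measure R \x @lebesgue_measure R)%E]_(p in coords F)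
     (extend u (p.1 +i* p.2) / p.2 ^+ 2))%R.

Definition petersson F k (f g : uhp R -> R[i]) : R[i] :=
  let u z := f z * (g z)^* * (imz z ^+ (2 * k))%:C in
  hyp_integral F (fun z => complex.Re (u z)) +i*
  hyp_integral F (fun z => complex.Im (u z)).

(* orthonormal and spanning, hence linearly independent *)
Definition orthonormal_basis F k d (f : 'I_d -> uhp R -> R[i]) :=
  [/\ forall j, cusp_form G k (f j),
      forall i j, petersson F k (f i) (f j) = (i == j)%:R
    & forall g, cusp_form G k g ->
        exists c : 'I_d -> R[i], forall z, g z = \sum_(j < d) c j * f j z].

Definition bergman_sum k d (f : 'I_d -> uhp R -> R[i]) (z : uhp R) : R :=
  \sum_(j < d) Normc.normc (f j z) ^+ 2 * imz z ^+ (2 * k).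

End Petersson.

(* Main.v *)
(* The Poincare series P_w(z) = \sum_(g in G) ker g z w ^ (-2k), where
   ker g z w = (c z + d) (g z - conj w), is up to a constant the reproducing
   kernel of the space of cusp forms. Unfolding the integral of |P_w|^2 y^(2k)
   over a fundamental domain turns it into Re (C P_w(w)), where an explicit
   integral over the half-plane gives |C| = 4 pi / ((2k - 1) 4^k), and
   Cauchy-Schwarz in an orthonormal basis yields
   |P_w(w)| Im(w)^(2k) <= |C| S_k(w). So it suffices to find w such that
   |P_w(w)| >= (2 Im w)^(-2k), the modulus of the term of the identity. By
   compactness the displacement of the nontrivial elements of G attains its
   minimum over the half-plane at some w. In the absence of elliptic elements,
   an element that attains it moves w along its axis, so that the quotient of
   its term by the term of the identity is positive; for large k all other terms
   together are smaller than one such term. The series converges because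
   unfolding the integral of |z - conj w|^(-4) over the half-plane gives a finite
   value. *)

From HB Require Import structures.
From mathcomp Require Import all_boot all_order all_algebra.
From mathcomp Require Import all_classical all_reals all_analysis.
From mathcomp Require Import measurable_realfun complex ring lra.
Require Import Defs.

Set Implicit Arguments.
Unset Strict Implicit.
Unset Printing Implicit Defensive.

Import Order.TTheory GRing.Theory Num.Theory.
Import numFieldNormedType.Exports.

Local Open Scope classical_set_scope.
Local Open Scope ring_scope.

(** * Invariance of the hyperbolic measure *)

(** Uniformity in the group element rests on one fact: [ker g z w] is affine in [z] with its zero in
    the lower half-plane, so moving [z] by [h] enlarges every kernel by a factor of at most
    [1 + |h| / Im z]. These Harnack inequalities yield the semicontinuity of the displacement, the
    convergence of the series from that of one integral, and its termwise differentiation. The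
    integral behind [|C|] is evaluated without residues: partial fractions and integration by parts
    in [x] leave a binomial coefficient, which a beta integral in [y] cancels. Sums over the group
    are integrals against counting measure on the naturals, so that every exchange of sum and
    integral is an instance of Fubini or Tonelli. Elements of PSL_2 are matrices up to sign, so only
    even powers of kernels are intrinsic. The same evenness makes the terms along an axis positive:
    there the kernels are purely imaginary, and their quotients real. Poincare series satisfy the
    cusp condition because a parabolic element would have displacements tending to 1, while the
    minimal displacement is attained and exceeds 1. *)

Section MeasureWithDensity.
Local Open Scope ereal_scope.
Context d (T : measurableType d) (R : realType).
Variables (mu : {measure set T -> \bar R}) (w : T -> R).
Hypotheses (mw : measurable_fun setT w) (w0 : forall x, (0 <= w x)%R).

(** The proofs of measurability and nonnegativity are carried as arguments so that the measure
    structure can be inferred from the term itself. *)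
Definition dens of measurable_fun setT w & (forall x, (0 <= w x)%R) :=
  fun A => \int[mu]_(x in A) (w x)%:E.

Let dens0 : dens mw w0 set0 = 0. Proof. exact: integral_set0. Qed.

Let dens_ge0 A : 0 <= dens mw w0 A.
Proof. by apply: integral_ge0 => x _; rewrite lee_fin. Qed.

Let dens_sigma_additive : semi_sigma_additive (dens mw w0).
Proof.
move=> F mF tF mUF; rewrite /dens ge0_integral_bigcup//=; last 2 first.
- exact/measurable_EFinP/measurable_funTS.
- by move=> x _; rewrite lee_fin.
by apply: is_cvg_nneseries => n _ _; exact: dens_ge0.
Qed.

HB.instance Definition _ := isMeasure.Build _ _ _ (dens mw w0)
  dens0 dens_ge0 dens_sigma_additive.

Lemma dens_indic (A D : set T) : measurable A -> measurable D ->
  \int[dens mw w0]_(x in D) (\1_A x)%:E = \int[mu]_(x in D) ((\1_A x)%:E * (w x)%:E).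
Proof.
move=> mA mD; rewrite integral_indic// /dens.
rewrite [RHS](eq_integral (fun x => ((fun y => (w y)%:E) \_ A) x)); last first.
  move=> x _; rewrite patchE indicE; case: ifPn => xA; first by rewrite mul1e.
  by rewrite mul0e.
by rewrite -integral_mkcondr setIC.
Qed.

Import HBNNSimple.

(** Both sides are additive in [f] and agree on indicators by [dens_indic]; approximation by simple
    functions from below and monotone convergence do the rest. *)
Lemma ge0_integral_dens (f : T -> \bar R) : measurable_fun setT f ->
  (forall x, 0 <= f x) -> \int[dens mw w0]_x f x = \int[mu]_x (f x * (w x)%:E).
Proof.
move=> mf f0; pose f_ := nnsfun_approx measurableT mf.
transitivity (limn (fun n => \int[dens mw w0]_x (f_ n x)%:E)).
  rewrite -monotone_convergence//.
  - apply: eq_integral => y _; apply/esym/cvg_lim => //.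
    by apply: cvg_nnsfun_approx.
  - by move=> n; exact/measurable_EFinP.
  - by move=> n y _; rewrite lee_fin.
  - by move=> y _ m n mn; rewrite lee_fin; exact/lefP/nd_nnsfun_approx.
rewrite (_ : (fun n => _) = fun n => \int[mu]_x ((f_ n x)%:E * (w x)%:E)).
  rewrite -monotone_convergence//.
  - apply: eq_integral => y _; apply/cvg_lim => //.
    by apply: cvgeZr => //; apply: cvg_nnsfun_approx.
  - by move=> n; apply/measurable_EFinP; exact: measurable_funM.
  - by move=> n y _; rewrite -EFinM lee_fin mulr_ge0.
  - move=> y _ m n mn; rewrite -!EFinM lee_fin ler_wpM2r//.
    exact/lefP/nd_nnsfun_approx.
apply/funext => n.
transitivity (\sum_(k \in range (f_ n))
    \int[dens mw w0]_x (k * \1_(f_ n @^-1` [set k]) x)%:E).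
  under eq_integral do rewrite fimfunE -fsumEFin//.
  rewrite ge0_integral_fsum//.
  - by move=> y; exact/measurable_EFinP/measurable_funM.
  - by move=> y x _; rewrite nnfun_muleindic_ge0.
transitivity (\sum_(k \in range (f_ n))
    \int[mu]_x ((k * \1_(f_ n @^-1` [set k]) x)%:E * (w x)%:E)).
  apply: eq_fsbigr => k _.
  (* A nonnegative simple function has an empty fibre over a negative value, so both sides
     vanish. *)
  have [k0|k0] := ltP k 0%R.
    by rewrite preimage_nnfun0// !integral0_eq// => x _; rewrite indic0 mulr0 ?mul0e.
  transitivity (\int[dens mw w0]_x (k%:E * (\1_(f_ n @^-1` [set k]) x)%:E)) => //.
  transitivity (\int[mu]_x (k%:E * ((\1_(f_ n @^-1` [set k]) x)%:E * (w x)%:E))).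
    2: by apply: eq_integral => x _; rewrite EFinM muleA.
  rewrite [RHS]ge0_integralZl//; last 2 first.
  - by apply/measurable_EFinP; exact: measurable_funM.
  - by move=> x _; rewrite -EFinM lee_fin mulr_ge0.
  rewrite ge0_integralZl//; last exact/measurable_EFinP.
  by rewrite dens_indic.
rewrite -ge0_integral_fsum//.
- apply: eq_integral => x _; rewrite [in RHS]fimfunE -fsumEFin//.
  rewrite ge0_mule_fsuml// => r.
  by rewrite nnfun_muleindic_ge0.
- by move=> r; apply/measurable_EFinP; apply: measurable_funM => //; exact: measurable_funM.
- move=> r x _; rewrite mule_ge0// ?lee_fin//.
  by have := nnfun_muleindic_ge0 (f_ n) r x; rewrite lee_fin.
Qed.

End MeasureWithDensity.

Section ImageMeasure.
Local Open Scope ereal_scope.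
Context d1 d2 (X : measurableType d1) (Y : measurableType d2) (R : realType).
Variables (phi : X -> Y) (mphi : measurable_fun setT phi).
Variables (mu : {measure set X -> \bar R}) (nu : {measure set Y -> \bar R}).

(* [pushforward] only becomes a measure once a proof of measurability is
   supplied; carrying the proof as an argument lets inference find it. *)
Definition image_measure of measurable_fun setT phi := pushforward mu phi.

HB.instance Definition _ := Measure.copy (image_measure mphi)
  (measure_function_pushforward__canonical__measure_function_Measure mu mphi).

Lemma ge0_integral_scaled_image (c : {nonneg R}) (f : Y -> \bar R) :
  (forall A, measurable A -> nu A = (c%:num)%:E * mu (phi @^-1` A)) ->
  measurable_fun setT f -> (forall y, 0 <= f y) ->
  \int[nu]_y f y = (c%:num)%:E * \int[mu]_x f (phi x).
Proof.
move=> nuE mf f0.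
transitivity (\int[mscale c (image_measure mphi)]_y f y).
  by apply: eq_measure_integral => A mA _; rewrite /mscale/= nuE.
rewrite ge0_integral_mscale//; congr (_ * _).
by rewrite ge0_integral_pushforward.
Qed.

End ImageMeasure.

(** * Substitutions on the real line *)

Section LineSubstitution.
Local Open Scope ereal_scope.
Variable R : realType.
Local Notation mu := (@lebesgue_measure R).
Implicit Types f : measurableTypeR R -> \bar R.

Lemma measurable_affine (p q : R) :
  measurable_fun setT (fun x : measurableTypeR R => p * x + q : measurableTypeR R)%R.
Proof. by apply: measurable_funD => //; exact: measurable_funM. Qed.

(** The scaled image of Lebesgue measure under the affine map gives []a, b]] the mass [b - a], and
    uniqueness of Lebesgue measure identifies the two. *)
Lemma ge0_integral_affine (p q : R) f : (0 < p)%R -> measurable_fun setT f ->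
  (forall x, 0 <= f x) -> \int[mu]_x f x = p%:E * \int[mu]_x f (p * x + q)%R.
Proof.
move=> p0 mf f0.
pose phi (x : measurableTypeR R) : measurableTypeR R := (p * x + q)%R.
have mphi : measurable_fun setT phi by exact: measurable_affine.
pose m := mscale (NngNum (ltW p0)) (image_measure mu mphi).
apply: (ge0_integral_scaled_image mphi (c := NngNum (ltW p0))) => // A mA.
apply: (lebesgue_measure_unique (mu := m)) => //.
move=> _ [[a b]] _ <-.
rewrite /m /= /mscale /= /image_measure /pushforward.
have -> : phi @^-1` `]a, b]%classic = `]((a - q) / p)%R, ((b - q) / p)%R]%classic.
  apply/seteqP; split=> x /=; rewrite !in_itv/= ltr_pdivrMr// ler_pdivlMr//;
    by rewrite /phi ltrBlDr lerBrDr mulrC.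
rewrite !lebesgue_measure_itv/= !lte_fin ltr_pM2r ?invr_gt0// ltrD2r.
case: ifPn => _; last by rewrite mule0.
by rewrite -!EFinD -EFinM; congr EFin; field; rewrite gt_eqF.
Qed.

Lemma ge0_integral_opp f : measurable_fun setT f ->
  (forall x, 0 <= f x) -> \int[mu]_x f x = \int[mu]_x f (- x)%R.
Proof.
move=> mf f0.
have mN : measurable_fun setT (fun x : measurableTypeR R => - x : measurableTypeR R)%R.
  exact: measurable_funN.
rewrite (ge0_integral_scaled_image mN (mu := mu) (c := (1%:nng)%R)) ?mul1e// => A mA.
by rewrite /= mul1e; apply/esym/lebesgue_measureN.
Qed.

Lemma measurable_invr (D : set R) : measurable_fun D (fun x : R => x^-1)%R.
Proof.
apply: measurable_funTS.
rewrite -(setUv [set (0:R)%R]); apply/measurable_funU => //.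
  exact: measurableC.
split.
  exact: measurable_fun_set1.
apply: open_continuous_measurable_fun.
  by apply: closed_openC; exact: closed_eq.
by move=> x; rewrite inE/= => /eqP x0; exact: inv_continuous.
Qed.

Lemma measurable_funV d (T : measurableType d) (D : set T) (h : T -> R) :
  measurable_fun D h -> measurable_fun D (fun x => (h x)^-1)%R.
Proof.
move=> mh; apply: (@measurableT_comp _ _ _ _ R R) mh.
exact: measurable_invr.
Qed.

(** The primitive is [- c / y]. This is the mass that the density [c / y ^+ 2] gives to the preimage
    of []0, b]] under the inversion [y |-> c / y]. *)
Lemma integral_c_div_sqr (c b : R) : (0 < c)%R -> (0 < b)%R ->
  \int[mu]_(y in `[(c / b)%R, +oo[) (c / y ^+ 2)%:E = b%:E.
Proof.
move=> c0 b0.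
have cb0 : (0 < c / b)%R by rewrite divr_gt0.
have dF (x : R) : (0 < x)%R ->
    is_derive x (1:R)%R (fun y : R => (- c) *: y^-1)%R (c / x ^+ 2)%R.
  move=> x0.
  have x1 : x != 0%R by rewrite gt_eqF.
  have H := is_deriveV x1 (is_derive_id x (1:R)%R).
  apply: (is_derive_eq (is_deriveZ (- c)%R H)).
  by rewrite /GRing.scale/=; field.
rewrite (@ge0_continuous_FTC2y R (fun y => c / y ^+ 2)%R (fun y => (- c) *: y^-1)%R _ 0%R).
- by rewrite -EFinB /GRing.scale/=; congr EFin; field; rewrite !gt_eqF.
- move=> x xb; rewrite divr_ge0 ?ltW// exprn_gt0// (lt_le_trans cb0)//.
- apply: derivable_within_continuous => x; rewrite in_itv/= andbT => xb.
  have x0 : (0 < x)%R by exact: lt_le_trans xb.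
  have x1 : (x ^+ 2 != 0)%R by rewrite gt_eqF// exprn_gt0.
  by apply: derivableM => //; apply: derivableV.
- rewrite -(scaler0 _ (- c)%R); apply: cvgZr.
  by apply/gtr0_cvgV0 => //; exact: nbhs_pinfty_gt.
- by move=> x xb; exact: (@ex_derive _ _ _ _ _ _ _ (dF x (lt_trans cb0 xb))).
- apply: cvg_at_right_filter; apply: cvgZr; apply: cvgV => //; first by rewrite gt_eqF.
- move=> x; rewrite in_itv/= andbT => xb.
  by rewrite derive1E; apply: derive_val; apply: dF; exact: lt_trans xb.
Qed.


(** The image of the density [c / y ^+ 2] under [y |-> c / y] is Lebesgue measure on the positive
    half-line, as a check on half-open intervals shows. *)
Lemma ge0_integral_inversion (c : R) f : (0 < c)%R -> measurable_fun setT f ->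
  (forall x, 0 <= f x) ->
  \int[mu]_(y in `]0%R, +oo[) f y =
  \int[mu]_(y in `]0%R, +oo[) (f (c / y)%R * (c / y ^+ 2)%:E).
Proof.
move=> c0 mf f0.
pose w : measurableTypeR R -> R := (fun y => c / y ^+ 2)%R \_ `]0%R, +oo[%classic.
pose phi (y : measurableTypeR R) : measurableTypeR R := (c / y)%R.
have mphi : measurable_fun setT phi.
  by apply: measurable_funM => //; exact: measurable_invr.
have mw0 : measurable_fun setT (fun y : measurableTypeR R => c / y ^+ 2)%R.
  apply: measurable_funM => //.
  exact/measurable_funV/measurable_funX.
have mw : measurable_fun setT w by apply/measurable_restrict => //; exact: measurable_funTS.
have w0 x : (0 <= w x)%R.
  rewrite /w patchE; case: ifPn => //; rewrite inE/= in_itv/= andbT => x0.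
  by rewrite divr_ge0 ?ltW// exprn_gt0.
pose nu := image_measure (dens mu mw w0) mphi.
have nuE A : nu A = \int[mu]_(y in phi @^-1` A `&` `]0%R, +oo[) (c / y ^+ 2)%:E.
  rewrite /nu /image_measure /pushforward/= /dens [RHS]integral_mkcondr.
  apply: eq_integral => y _; rewrite /w !patchE; by case: ifPn.
have mN : measurable_fun setT (\1_(`]-oo, 0%R]%classic) : measurableTypeR R -> R).
  exact: measurable_indic.
have N0 (x : measurableTypeR R) : (0 <= \1_(`]-oo, 0%R]%classic) x :> R)%R by [].
(* The image measure [nu] charges only the positive half-line. Adding Lebesgue measure on the
   nonpositive one gives a measure on the whole line, to which uniqueness of Lebesgue measure
   applies. *)
pose m := measure_add nu (dens mu mN N0).
have mE B : measurable B -> m B = nu B + mu (B `&` `]-oo, 0%R]%classic).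
  move=> mB; rewrite /m measure_addE; congr (_ + _).
  transitivity (\int[mu]_(x in B) (\1_(`]-oo, 0%R]%classic) x)%:E) => //.
  by rewrite integral_indic// setIC.
have nu0 a b : (0 <= a)%R -> (a < b)%R -> nu `]a, b]%classic = (b - a)%:E.
  move=> a0 ab; rewrite nuE.
  have b0 : (0 < b)%R := le_lt_trans a0 ab.
  (* For [a = 0] the preimage of the interval is an infinite tail, for [a > 0] the difference of two
     such tails. *)
  have [a1|a1] := eqVneq a 0%R.
    rewrite a1 subr0 -(integral_c_div_sqr c0 b0); congr (integral _ _ _).
    apply/seteqP; split => y /=; rewrite !in_itv/= !andbT.
      by move=> [/andP[_ yb] y0]; move: yb; rewrite /phi !ler_pdivrMr// mulrC.
    move=> cy; have y0 : (0 < y)%R by rewrite (lt_le_trans _ cy)// divr_gt0.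
    by rewrite /phi divr_gt0//= ler_pdivrMr// mulrC -ler_pdivrMr.
  have {a0 a1}a0 : (0 < a)%R by rewrite lt_neqAle eq_sym a1.
  have -> : phi @^-1` `]a, b]%classic `&` `]0%R, +oo[%classic =
      `[(c / b)%R, (c / a)%R[%classic.
    apply/seteqP; split => y /=; rewrite !in_itv/= !andbT.
      move=> [/andP[ya yb] y0]; move: ya yb; rewrite /phi.
      rewrite !ler_pdivrMr// ltr_pdivlMr// => ya yb.
      by apply/andP; split; [rewrite mulrC | rewrite ltr_pdivlMr// mulrC].
    move=> /andP[cy ya]; have y0 : (0 < y)%R by rewrite (lt_le_trans _ cy)// divr_gt0.
    move: cy ya; rewrite /phi ler_pdivrMr// ltr_pdivlMr// => cy ya.
    split=> //; rewrite ler_pdivrMr// ltr_pdivlMr//.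
    by apply/andP; split; rewrite mulrC.
  have := integral_c_div_sqr c0 b0; have := integral_c_div_sqr c0 a0.
  have ba : (c / b < c / a)%R by rewrite ltr_pM2l// ltf_pV2.
  have -> : `[(c / b)%R, +oo[%classic =
      `[(c / b)%R, (c / a)%R[%classic `|` `[(c / a)%R, +oo[%classic :> set R.
    by rewrite -itv_bndbnd_setU//= !bnd_simp ?ltW.
  rewrite ge0_integral_setU//=; last 3 first.
  - exact/measurable_EFinP/measurable_funTS.
  - move=> x xb; by rewrite lee_fin divr_ge0 ?sqr_ge0 ?(ltW c0).
  - apply/disj_setPS => x /=; rewrite !in_itv/= !andbT => -[/andP[_]].
    by rewrite ltNge => /negbTE ->.
  move=> ->; set X := (integral _ _ _).
  case: X => [r| |]//=; rewrite -EFinD => -[] <-; by rewrite addrK.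
have nuN a b : (b <= 0)%R -> nu `]a, b]%classic = 0.
  move=> b0; rewrite nuE (_ : _ `&` _ = set0) ?integral_set0//.
  rewrite -subset0 => y /=; rewrite !in_itv/= andbT /phi => -[/andP[_ yb] y0].
  by move: (le_trans yb b0); rewrite leNgt divr_gt0.
have lm A : measurable A -> mu A = m A.
  apply: (lebesgue_measure_unique (mu := m)) => _ [[a b]] _ <-.
  transitivity (nu `]a, b]%classic + mu (`]a, b]%classic `&` `]-oo, 0%R]%classic));
    last by apply/esym/mE.
  rewrite [LHS]/=.
  have [ba|ab] := leP b a.
    by rewrite set_itv_ge ?bnd_simp -?leNgt// set0I !measure0 adde0.
  have [a0|a0] := leP 0%R a.
    rewrite nu0// (_ : _ `&` _ = set0).
      by rewrite measure0 adde0 lebesgue_measure_itv/= lte_fin ab.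
    rewrite -subset0 => y /=; rewrite !in_itv/= => -[/andP[ay _] y0].
    by move: (le_lt_trans a0 ay); rewrite ltNge y0.
  have [b0|b0] := leP b 0%R.
    rewrite nuN// add0e (_ : _ `&` _ = `]a, b]%classic)//.
    apply/setIidPl => y /=; rewrite !in_itv/= => /andP[_ yb]; exact: le_trans yb b0.
  have -> : `]a, b]%classic `&` `]-oo, 0%R]%classic = `]a, 0%R]%classic :> set R.
    apply/seteqP; split => y /=; rewrite !in_itv/=.
      by move=> [/andP[-> _] ->].
    move=> /andP[-> y0]; rewrite (le_trans y0 (ltW b0))//.
  have -> : nu `]a, b]%classic = nu `]0%R, b]%classic.
    rewrite !nuE; congr (integral _ _ _); apply/seteqP; split => y /=.
      rewrite !in_itv/= !andbT /phi => -[/andP[_ ->] y0]; by rewrite divr_gt0.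
    rewrite !in_itv/= !andbT /phi => -[/andP[_ ->] y0].
    by rewrite (lt_trans a0)// divr_gt0.
  rewrite nu0// !lebesgue_measure_itv/= !lte_fin a0 ab -!EFinD.
  by congr EFin; rewrite subr0 add0r.
(* Extended by zero, [f] does not see the summand added on the nonpositive half-line. *)
pose f1 : measurableTypeR R -> \bar R := f \_ `]0%R, +oo[%classic.
transitivity (\int[mu]_y f1 y); first exact: integral_mkcond.
have mf1 : measurable_fun setT f1.
  by apply/measurable_restrict => //; exact: measurable_funTS.
have f1_ge0 y : 0 <= f1 y by rewrite /f1 patchE; case: ifPn.
transitivity (\int[nu]_y f1 y).
  rewrite (eq_measure_integral m); last by move=> A mA _; exact: lm.
  rewrite ge0_integral_measure_add//.
  rewrite [X in _ + X](_ : _ = 0) ?adde0//.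
  rewrite ge0_integral_dens//; apply: integral0_eq => y _.
  rewrite /f1 patchE indicE !mem_setE !in_itv/= andbT.
  by case: (ltP 0%R y) => _; rewrite ?mul0e ?mule0.
transitivity (\int[dens mu mw w0]_y f1 (phi y)).
  by rewrite ge0_integral_pushforward.
rewrite ge0_integral_dens//; last exact: (measurableT_comp mf1).
rewrite [RHS]integral_mkcond; apply: eq_integral => y _.
rewrite /= /w /f1 !patchE !mem_setE !in_itv/= !andbT.
have [y0|y0] := ltP 0%R y; last by rewrite mule0.
by rewrite divr_gt0.
Qed.

End LineSubstitution.

(** * Invariance of dx dy / y^2 under Moebius maps *)

Section HyperbolicInvariance.
Local Open Scope ereal_scope.
Variable R : realType.
Local Notation mu := (@lebesgue_measure R).
Local Notation T1 := (measurableTypeR R).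
Local Notation T2 := (T1 * T1)%type.
Implicit Types f : T2 -> \bar R.

(** The hyperbolic density, cut off outside the upper half-plane so that all integrals can run over
    the full plane. *)
Definition hyp_weight (y : T1) : R := if (0 < y)%R then (y ^- 2)%R else 0%R.

Lemma hyp_weight_ge0 y : (0 <= hyp_weight y)%R.
Proof. by rewrite /hyp_weight; case: ifPn => // y0; rewrite invr_ge0 sqr_ge0. Qed.

Lemma measurable_hyp_weight : measurable_fun setT hyp_weight.
Proof.
apply: measurable_fun_ifT => //; first exact: measurable_fun_ltr.
by apply: measurable_funV; exact: measurable_funX.
Qed.

Definition hyp_int f := \int[mu \x mu]_p (f p * (hyp_weight p.2)%:E).

Lemma measurable_hyp_weight2 : measurable_fun setT (fun p : T2 => (hyp_weight p.2)%:E).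
Proof.
apply/measurable_EFinP; apply: (measurableT_comp measurable_hyp_weight).
exact: measurable_snd.
Qed.

Lemma measurable_mul_hyp_weight f : measurable_fun setT f ->
  measurable_fun setT (fun p => f p * (hyp_weight p.2)%:E).
Proof. by move=> mf; apply: emeasurable_funM => //; exact: measurable_hyp_weight2. Qed.

Lemma eq_hyp_int f g : (forall p, (0 < p.2)%R -> f p = g p) -> hyp_int f = hyp_int g.
Proof.
move=> fg; apply: eq_integral => p _; rewrite /hyp_weight.
by case: ifPn => [p0|]; [rewrite fg | rewrite !mule0].
Qed.

Lemma measurable_pair (h1 h2 : T2 -> T1) : measurable_fun setT h1 ->
  measurable_fun setT h2 -> measurable_fun setT (fun p => (h1 p, h2 p) : T2).
Proof. by move=> *; exact: measurable_fun_pair. Qed.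

Lemma hyp_int_homothety (s t : R) f : (0 < s)%R -> measurable_fun setT f ->
  (forall p, 0 <= f p) ->
  hyp_int (fun p => f (s * p.1 + t, s * p.2)%R) = hyp_int f.
Proof.
move=> s0 mf f0.
have mst : measurable_fun setT (fun p : T2 => (s * p.1 + t, s * p.2)%R : T2).
  apply: measurable_pair.
    apply: measurable_funD => //; apply: measurable_funM => //.
  by apply: measurable_funM => //.
rewrite /hyp_int (fubini_tonelli2 (fun p => _ * _)); last 2 first.
- by apply: measurable_mul_hyp_weight; exact: (measurableT_comp mf mst).
- by move=> p; rewrite mule_ge0// lee_fin hyp_weight_ge0.
rewrite (fubini_tonelli2 (fun p => _ * _)); last 2 first.
- exact: measurable_mul_hyp_weight.
- by move=> p; rewrite mule_ge0// lee_fin hyp_weight_ge0.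
have mG : measurable_fun setT (fubini_G mu (fun p : T2 => f p * (hyp_weight p.2)%:E)).
  apply: measurable_fun_fubini_tonelli_G.
    exact: measurable_mul_hyp_weight.
  by move=> p; rewrite mule_ge0// lee_fin hyp_weight_ge0.
have G0 y : 0 <= fubini_G mu (fun p : T2 => f p * (hyp_weight p.2)%:E) y.
  by apply: integral_ge0 => x _; rewrite mule_ge0// lee_fin hyp_weight_ge0.
rewrite [RHS](ge0_integral_affine 0 s0)// -ge0_integralZl//; last 2 first.
- apply: (measurableT_comp mG); exact: measurable_affine.
- by rewrite lee_fin ltW.
apply: eq_integral => y _; rewrite addr0 /fubini_G/=.
have mfy (z : T1) : measurable_fun setT (fun x : T1 => f (x, z)).
  exact: (measurableT_comp mf).
(* The Jacobian [s * s] of the homothety cancels against the weight, which is homogeneous of degree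
   -2. *)
have sw : (s * s)%:E * (hyp_weight (s * y))%:E = (hyp_weight y)%:E.
  rewrite -EFinM; congr EFin; rewrite /hyp_weight pmulr_rgt0//.
  case: ifPn => y0; last by rewrite mulr0.
  by field; rewrite !gt_eqF.
rewrite ge0_integralZr ?lee_fin ?hyp_weight_ge0//; last first.
  by apply: (measurableT_comp (mfy _)); exact: measurable_affine.
rewrite ge0_integralZr ?lee_fin ?hyp_weight_ge0//.
rewrite [in RHS](ge0_integral_affine t s0)// -sw EFinM.
by rewrite -!muleA muleC -!muleA; congr (_ * _); congr (_ * _); rewrite muleC.
Qed.

(** Slope coordinates [(s, y)] with [x = s * y], in which [dx dy / y^2] becomes [ds dy / y]. *)
Definition slope_integrand f (q : T2) := f (q.1 * q.2, q.2)%R *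
  (if (0 < q.2)%R then q.2^-1 else 0%R)%:E.

Lemma measurable_slope_integrand f : measurable_fun setT f ->
  measurable_fun setT (slope_integrand f).
Proof.
move=> mf; apply: emeasurable_funM.
  apply: (measurableT_comp mf); apply: measurable_pair => //.
  exact: measurable_funM.
apply/measurable_EFinP; apply: (@measurableT_comp _ _ _ _ _ _
  (fun y : T1 => if (0 < y)%R then y^-1 else 0%R)%R) => //.
apply: measurable_fun_ifT => //; first exact: measurable_fun_ltr.
exact: measurable_funV.
Qed.

Lemma slope_integrand_ge0 f : (forall p, 0 <= f p) -> forall p, 0 <= slope_integrand f p.
Proof.
move=> f0 p; rewrite mule_ge0// lee_fin; case: ifPn => // /ltW.
by rewrite invr_ge0.
Qed.

Lemma slope_integrandE f s :
  \int[mu]_(y in `]0%R, +oo[) (f (s * y, y)%R * (y^-1)%:E) =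
  \int[mu]_y slope_integrand f (s, y).
Proof.
rewrite [LHS]integral_mkcond; apply: eq_integral => y _.
rewrite patchE mem_setE in_itv/= andbT /slope_integrand/=.
by case: ifPn => // _; rewrite mule0.
Qed.

Lemma hyp_int_slope f : measurable_fun setT f -> (forall p, 0 <= f p) ->
  hyp_int f = \int[mu]_s \int[mu]_(y in `]0%R, +oo[) (f (s * y, y)%R * (y^-1)%:E).
Proof.
move=> mf f0; under [RHS]eq_integral do rewrite slope_integrandE.
have mh := measurable_slope_integrand mf.
have h0 := slope_integrand_ge0 f0.
rewrite fubini_tonelli// /hyp_int (fubini_tonelli2 (fun p => _ * _)); last 2 first.
- exact: measurable_mul_hyp_weight.
- by move=> p; rewrite mule_ge0// lee_fin hyp_weight_ge0.
apply: eq_integral => y _; rewrite /fubini_G/= /slope_integrand/= /hyp_weight.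
case: ifPn => y0; last by rewrite !integral0_eq// => x _; rewrite mule0.
have mfy (z : T1) : measurable_fun setT (fun x : T1 => f (x, z)).
  exact: (measurableT_comp mf).
have y1 : (0 <= y^-1)%R by rewrite invr_ge0 ltW.
have y2 : (0 <= y ^- 2)%R by rewrite invr_ge0 sqr_ge0.
rewrite ge0_integralZr ?lee_fin//.
rewrite ge0_integralZr ?lee_fin//; last first.
  apply: (measurableT_comp (mfy _)); exact: measurable_funM.
rewrite (ge0_integral_affine 0%R y0)//.
have -> : \int[mu]_x f (y * x + 0, y)%R = \int[mu]_x f (x * y, y)%R.
  by apply: eq_integral => x _; rewrite addr0 mulrC.
rewrite muleAC muleC; congr (_ * _); rewrite -EFinM; congr EFin.
by field; rewrite gt_eqF.
Qed.

(** The map [z |-> -1 / z]. *)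
Definition inversion (p : T2) : T2 :=
  (- (p.1 / (p.1 ^+ 2 + p.2 ^+ 2)), p.2 / (p.1 ^+ 2 + p.2 ^+ 2))%R.

Lemma measurable_inversion : measurable_fun setT inversion.
Proof.
have m1 : measurable_fun setT (fun p : T2 => (p.1 ^+ 2 + p.2 ^+ 2)^-1)%R.
  apply: measurable_funV; apply: measurable_funD; apply: measurable_funX => //.
apply: measurable_pair; last exact: measurable_funM.
by apply: measurable_funN; exact: measurable_funM.
Qed.

(** In slope coordinates the map sends [(s, y)] to [(- s, c / y)] with [c = 1 / (1 + s ^+ 2)]: a
    reflection of the outer variable and, for each [s], a one-dimensional inversion of the inner
    one. *)
Lemma hyp_int_inversion f : measurable_fun setT f -> (forall p, 0 <= f p) ->
  hyp_int (f \o inversion) = hyp_int f.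
Proof.
move=> mf f0.
have mfi : measurable_fun setT (f \o inversion).
  by apply: measurableT_comp => //; exact: measurable_inversion.
rewrite (hyp_int_slope mfi (fun p => f0 _)) (hyp_int_slope mf f0).
have mh : measurable_fun setT (fun s : T1 =>
    \int[mu]_(y in `]0%R, +oo[) (f (s * y, y)%R * (y^-1)%:E)).
  rewrite (_ : (fun s : T1 => _) = fubini_F mu (slope_integrand f)).
    apply: measurable_fun_fubini_tonelli_F.
      exact: measurable_slope_integrand.
    exact: slope_integrand_ge0.
  by apply/funext => s; exact: slope_integrandE.
rewrite [RHS](ge0_integral_opp mh); last first.
  move=> s; apply: integral_ge0 => y; rewrite /= in_itv/= andbT => y0.
  by rewrite mule_ge0// lee_fin invr_ge0 ltW.
apply: eq_integral => s _.
pose c := (1 + s ^+ 2)^-1%R.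
have s1 : (0 < 1 + s ^+ 2)%R by rewrite ltr_wpDr ?sqr_ge0.
have c0 : (0 < c)%R by rewrite invr_gt0.
(* The absolute value makes [G] nonnegative on the whole line, as the substitution lemma requires,
   and changes nothing for [y > 0]. *)
pose G (y : T1) := f (- s * y, y)%R * `|y^-1|%R%:E.
have mG : measurable_fun setT G.
  apply: emeasurable_funM.
    by apply: (measurableT_comp mf); apply: measurable_fun_pair.
  apply/measurable_EFinP; apply: measurableT_comp => //; exact: measurable_funV.
transitivity (\int[mu]_(y in `]0%R, +oo[) G y); last first.
  apply: eq_integral => y; rewrite mem_setE in_itv/= andbT => y0.
  by rewrite /G ger0_norm// invr_ge0 ltW.
rewrite (ge0_integral_inversion c0 mG); last by move=> y; rewrite mule_ge0.
apply: eq_integral => y; rewrite mem_setE in_itv/= andbT => y0.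
rewrite /G -muleA -EFinM; congr (f _ * _%:E); last first.
  by rewrite ger0_norm ?invr_ge0 ?divr_ge0 ?ltW//; field; rewrite !gt_eqF.
have n0 : ((s * y) ^+ 2 + y ^+ 2 != 0)%R.
  by rewrite gt_eqF// ltr_wpDl ?sqr_ge0// exprn_gt0.
rewrite /inversion/=; congr pair; rewrite /c; field; rewrite n0 !gt_eqF//.
Qed.

(** Real and imaginary part of [(a z + b) / (c z + d)], the latter simplified by [a d - b c = 1]. *)
Definition moebius_pair (a b c d : R) (p : T2) : T2 :=
  let n := ((c * p.1 + d) ^+ 2 + (c * p.2) ^+ 2)%R in
  (((a * p.1 + b) * (c * p.1 + d) + a * c * p.2 ^+ 2) / n, p.2 / n)%R.

Lemma measurable_moebius_pair a b c d : measurable_fun setT (moebius_pair a b c d).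
Proof.
have ma (u v : R) : measurable_fun setT (fun p : T2 => (u * p.1 + v)%R : T1).
  by apply: measurable_funD => //; exact: measurable_funM.
have mn : measurable_fun setT
    (fun p : T2 => ((c * p.1 + d) ^+ 2 + (c * p.2) ^+ 2)^-1%R : T1).
  apply: measurable_funV; apply: measurable_funD; apply: measurable_funX.
    exact: ma.
  exact: measurable_funM.
apply: measurable_pair; last exact: measurable_funM.
apply: measurable_funM => //; apply: measurable_funD.
  by apply: measurable_funM; exact: ma.
by apply: measurable_funM => //; exact: measurable_funX.
Qed.

(** Bruhat decomposition: for [c = 0] the map is [z |-> a^2 z + a b]; otherwise it is
    [z |-> c^2 z + c d], followed by [-1 / z] and by the translation by [a / c]. *)
Lemma hyp_int_moebius a b c d f : (a * d - b * c = 1)%R ->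
  measurable_fun setT f -> (forall p, 0 <= f p) ->
  hyp_int (f \o moebius_pair a b c d) = hyp_int f.
Proof.
move=> det mf f0; have [c0|c0] := eqVneq c 0%R.
  have d0 : d != 0%R.
    by apply/eqP => d0; move: det; rewrite c0 d0 !mulr0 subrr => /esym/eqP; rewrite oner_eq0.
  have ad : (a * d = 1)%R by rewrite -det c0 mulr0 subr0.
  have a0 : a != 0%R by apply: contra_eq_neq ad => ->; rewrite mul0r eq_sym oner_eq0.
  have aE : a = (d^-1)%R by rewrite -[LHS](mulfK d0) ad mul1r.
  have a2 : (0 < a ^+ 2)%R by rewrite exprn_even_gt0.
  rewrite -(hyp_int_homothety (a * b) a2 mf f0).
  apply: eq_hyp_int => -[x y]/= y0; rewrite /moebius_pair/= c0 aE; congr (f (_, _)).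
    by field.
  by field.
have c2 : (0 < c ^+ 2)%R by rewrite exprn_even_gt0.
pose f1 p := f (1 * p.1 + a / c, 1 * p.2)%R.
have mf1 : measurable_fun setT f1.
  apply: (measurableT_comp mf); apply: measurable_pair.
    by apply: measurable_funD => //; exact: measurable_funM.
  exact: measurable_funM.
have mfi : measurable_fun setT (f1 \o inversion).
  by apply: measurableT_comp => //; exact: measurable_inversion.
rewrite -(hyp_int_homothety (a / c) ltr01 mf f0).
rewrite -[RHS](hyp_int_inversion mf1 (fun p => f0 _)).
rewrite -[RHS](hyp_int_homothety (c * d) c2 mfi (fun p => f0 _)).
apply: eq_hyp_int => -[x y]/= y0; rewrite /f1/= /moebius_pair/= !mul1r.
have n0 : ((c * x + d) ^+ 2 + (c * y) ^+ 2 != 0)%R.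
  by rewrite gt_eqF// ltr_wpDl ?sqr_ge0// exprn_even_gt0//= mulf_neq0// gt_eqF.
have n1 : ((c ^+ 2 * x + c * d) ^+ 2 + (c ^+ 2 * y) ^+ 2)%R =
    (c ^+ 2 * ((c * x + d) ^+ 2 + (c * y) ^+ 2))%R by ring.
rewrite n1; congr (f (_, _)); last by field; rewrite n0.
have bE : b = ((a * d - 1) / c)%R by rewrite -det; field.
by rewrite bE; field; rewrite c0.
Qed.

End HyperbolicInvariance.

Local Open Scope complex_scope.
Local Open Scope quotient_scope.

(** * The kernel and the displacement function *)

Section ComplexModulus.
Variable R : realType.
Local Notation normc := Normc.normc.
Implicit Types z w : R[i].

Lemma normc_ge0 z : 0 <= normc z.
Proof. by case: z => x y; exact: sqrtr_ge0. Qed.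

Lemma normc_eq0 z : (normc z == 0) = (z == 0).
Proof. by apply/eqP/eqP => [/Normc.eq0_normc//|->]; exact: Normc.normc0. Qed.

Lemma normc_gt0 z : (0 < normc z) = (z != 0).
Proof. by rewrite lt_neqAle normc_ge0 andbT eq_sym normc_eq0. Qed.

Lemma normc_sqr z : normc z ^+ 2 = complex.Re z ^+ 2 + complex.Im z ^+ 2.
Proof. by case: z => x y; rewrite /= sqr_sqrtr// addr_ge0 ?sqr_ge0. Qed.

Lemma normcX z n : normc (z ^+ n) = normc z ^+ n.
Proof.
elim: n => [|n IH]; first by rewrite !expr0 Normc.normc1.
by rewrite !exprS Normc.normcM IH.
Qed.

Lemma normc_ge_absRe z : `|complex.Re z| <= normc z.
Proof.
rewrite -(ler_pXn2r (n := 2)) ?nnegrE ?normc_ge0// normc_sqr real_normK ?num_real//.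
by rewrite lerDl sqr_ge0.
Qed.

Lemma normc_ge_absIm z : `|complex.Im z| <= normc z.
Proof.
rewrite -(ler_pXn2r (n := 2)) ?nnegrE ?normc_ge0// normc_sqr real_normK ?num_real//.
by rewrite lerDr sqr_ge0.
Qed.

Lemma normc_conj z : normc (conjc z) = normc z.
Proof. by case: z => x y; rewrite /= sqrrN. Qed.

Lemma normc_real (x : R) : normc x%:C = `|x|.
Proof. by rewrite /= expr0n addr0 sqrtr_sqr. Qed.

Lemma normc_sum (I : Type) (r : seq I) (F : I -> R[i]) :
  normc (\sum_(i <- r) F i) <= \sum_(i <- r) normc (F i).
Proof.
elim/big_ind2: _ => [|x1 x2 y1 y2 H1 H2|//]; first by rewrite Normc.normc0.
by apply: le_trans (le_normcD _ _) _; exact: lerD.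
Qed.

Lemma le_normcB z w : normc (z - w) <= normc z + normc w.
Proof. by rewrite -[normc w]normcN; exact: le_normcD. Qed.

Lemma normcE z : `|z| = (normc z)%:C.
Proof. by case: z. Qed.

Lemma conjc_affine (a b : R) z : conjc (a%:C * z + b%:C) = a%:C * conjc z + b%:C.
Proof.
case: z => x y; apply/eqP; rewrite eq_complex /=.
by apply/andP; split; apply/eqP; ring.
Qed.

Lemma mul_conjc z : z * conjc z = (normc z ^+ 2)%:C.
Proof.
rewrite normc_sqr; case: z => x y; apply/eqP; rewrite eq_complex /=.
by apply/andP; split; apply/eqP; ring.
Qed.

End ComplexModulus.

(** * Covariance and Harnack inequalities of the kernel *)

Section Kernel.
Variable R : realType.
Local Notation normc := Normc.normc.
Implicit Types (A B : SL2 R) (z w : uhp R).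

Lemma imz_gt0 z : 0 < imz z. Proof. exact: valP z. Qed.

Lemma moebius_numM A B z :
  moebius_num (A * B)%g z = moebius_num A (moebius B z) * moebius_den B z.
Proof.
have h3 := moebius_den_neq0 B z.
rewrite /moebius_num /= !mxE !big_ord_recl !big_ord0 !addr0.
rewrite (_ : lift ord0 ord0 = ord_max); last exact: val_inj.
rewrite !rmorphD !rmorphM /= [RHS]mulrDl -[_ * (_ / _) * _]mulrA divfK//.
rewrite /moebius_num /moebius_den.
by change (sval z) with (val z); change (sval A) with (val A); change (sval B) with (val B); ring.
Qed.

Lemma moebius_denM A B z :
  moebius_den (A * B)%g z = moebius_den A (moebius B z) * moebius_den B z.
Proof.
have h3 := moebius_den_neq0 B z.
rewrite {1 2}/moebius_den /= !mxE !big_ord_recl !big_ord0 !addr0.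
rewrite (_ : lift ord0 ord0 = ord_max); last exact: val_inj.
rewrite !rmorphD !rmorphM /= [RHS]mulrDl -[_ * (_ / _) * _]mulrA divfK//.
rewrite /moebius_num /moebius_den.
by change (sval z) with (val z); change (sval A) with (val A); change (sval B) with (val B); ring.
Qed.

Lemma moebius_den1 z : moebius_den 1%g z = 1.
Proof. by rewrite /moebius_den !mxE /= mul0r add0r. Qed.

Lemma moebius_num1 z : moebius_num 1%g z = val z.
Proof. by rewrite /moebius_num !mxE /= mul1r addr0. Qed.

Lemma moebius_num_den A z : val (moebius A z) * moebius_den A z = moebius_num A z.
Proof. by rewrite /= divfK// moebius_den_neq0. Qed.

Lemma imz_moebius A z : imz (moebius A z) = imz z / normc (moebius_den A z) ^+ 2.
Proof.
have := moebius_den_neq0 A z; have := SL2_adbc A.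
rewrite normc_sqr /imz /= /moebius_num /moebius_den.
case: z => -[x y] /= y0.
move: (val A ord0 ord0) (val A ord0 ord_max) (val A ord_max ord0)
  (val A ord_max ord_max) => a b c d adbc.
rewrite eq_complex /= !mul0r !subr0 !addr0 => n0.
set n := _ ^+ 2 + _ ^+ 2.
have n1 : n != 0.
  rewrite paddr_eq0 ?sqr_ge0//.
  by rewrite !sqrf_eq0.
rewrite -[in RHS](mul1r y) -adbc; field.
exact: n1.
Qed.

(* The kernel of weight one: [ker A z w = (c z + d) (A z - conj w)]. *)
Definition ker A z w : R[i] := moebius_num A z - conjc (val w) * moebius_den A z.

Lemma kerE A z w : ker A z w = moebius_den A z * (val (moebius A z) - conjc (val w)).
Proof. by rewrite /ker -moebius_num_den; ring. Qed.

Lemma ker1 z w : ker 1%g z w = val z - conjc (val w).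
Proof. by rewrite /ker moebius_num1 moebius_den1 mulr1. Qed.

Lemma kerMr A B z w : ker (A * B)%g z w = ker A (moebius B z) w * moebius_den B z.
Proof. by rewrite /ker moebius_numM moebius_denM; ring. Qed.

Lemma moebius_num_sign A B z : val A = - val B ->
  moebius_num A z = - moebius_num B z /\ moebius_den A z = - moebius_den B z.
Proof.
by move=> AB; rewrite /moebius_num /moebius_den AB !mxE !rmorphN !mulNr -!opprD.
Qed.

Lemma ker_sign A B z w : val A = - val B -> ker A z w = - ker B z w.
Proof. by move=> /(moebius_num_sign z)[An Ad]; rewrite /ker An Ad; ring. Qed.

(** Moving both arguments by [A] multiplies [B z - conj w] by the determinant [a d - b c = 1], up to
    the two denominators. *)
Lemma kerMl A B z w :
  ker (A * B)%g z (moebius A w) * conjc (moebius_den A w) = ker B z w.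
Proof.
rewrite /ker mulrBl mulrAC -rmorphM/= moebius_num_den.
rewrite /moebius_num /moebius_den /= !mxE !big_ord_recl !big_ord0 !addr0.
rewrite (_ : lift ord0 ord0 = ord_max); last exact: val_inj.
change (sval z) with (val z); change (sval w) with (val w).
change (sval A) with (val A); change (sval B) with (val B).
have /(congr1 (real_complex R)) := SL2_adbc A.
rewrite !conjc_affine !(rmorphB, rmorphD, rmorphM) rmorph1/=.
move: ((val A ord0 ord0)%:C) ((val A ord0 ord_max)%:C) ((val A ord_max ord0)%:C)
  ((val A ord_max ord_max)%:C) => a b c d.
move: ((val B ord0 ord0)%:C) ((val B ord0 ord_max)%:C) ((val B ord_max ord0)%:C)
  ((val B ord_max ord_max)%:C) => a' b' c' d'.
move: (val z) (conjc (val w)) => u v adbc.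
transitivity ((a * d - b * c) * (a' * u + b' - v * (c' * u + d'))); first by ring.
by rewrite adbc mul1r.
Qed.

Lemma normc_val_sub_conj z w : imz z + imz w <= normc (val z - conjc (val w)).
Proof.
apply: le_trans (normc_ge_absIm _).
by case: z w => -[x y] /= y0 [[x' y'] /= y0']; rewrite /imz/= opprK ler_norm.
Qed.

Lemma den_le_ker A z w : normc (moebius_den A z) * imz w <= normc (ker A z w).
Proof.
rewrite kerE Normc.normcM ler_wpM2l ?normc_ge0//.
by apply: le_trans (normc_val_sub_conj _ _); rewrite lerDr ltW// imz_gt0.
Qed.

(** With [t] the height of [A z], the left side is [4 t Im w |c z + d|^2], the right side at least
    [(t + Im w)^2 |c z + d|^2]; the inequality of arithmetic and geometric means compares them. *)
Lemma ker_ge A z w : 4 * (imz z * imz w) <= normc (ker A z w) ^+ 2.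
Proof.
rewrite kerE Normc.normcM exprMn.
have := imz_moebius A z; have := imz_gt0 (moebius A z); have := imz_gt0 w.
have := normc_val_sub_conj (moebius A z) w.
have : 0 < normc (moebius_den A z) by rewrite normc_gt0 moebius_den_neq0.
move: (normc (moebius_den A z)) (normc (_ - _)) (imz (moebius A z)) => n m t n0.
move=> tm w0 t0 tE.
have -> : imz z = t * n ^+ 2 by rewrite tE; field; rewrite gt_eqF.
rewrite [X in X <= _](_ : _ = n ^+ 2 * (4 * (t * imz w))); last by ring.
rewrite ler_wpM2l ?sqr_ge0//.
apply: (@le_trans _ _ ((t + imz w) ^+ 2)).
  rewrite -subr_ge0 [X in 0 <= X](_ : _ = (t - imz w) ^+ 2) ?sqr_ge0//; by ring.
have tw : 0 <= t + imz w by rewrite addr_ge0 ?ltW.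
by rewrite ler_pXn2r// nnegrE// (le_trans tw tm).
Qed.

Lemma ker_neq0 A z w : ker A z w != 0.
Proof.
rewrite -normc_gt0 -(ltr_pXn2r (n := 2)) ?nnegrE ?normc_ge0//.
rewrite expr0n/= (lt_le_trans _ (ker_ge A z w))//.
by rewrite !mulr_gt0// imz_gt0.
Qed.

(** The leading coefficient of [ker A z w] as an affine function of [z]. *)
Definition ker_slope A w : R[i] :=
  (val A ord0 ord0)%:C - conjc (val w) * (val A ord_max ord0)%:C.

Lemma ker_subl A z z' w : ker A z' w - ker A z w = ker_slope A w * (val z' - val z).
Proof. by rewrite /ker /ker_slope /moebius_num /moebius_den; ring. Qed.

Lemma ker_subr A z w w' :
  ker A z w' - ker A z w = conjc (val w - val w') * moebius_den A z.
Proof. by rewrite /ker rmorphB/=; ring. Qed.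

(** Divided by the squared modulus of the slope, this locates the zero of [z |-> ker A z w]: it is
    the image of [conj w] under the inverse of [A], hence in the lower half-plane, at depth
    [imz w / |slope|^2]. *)
Lemma Im_ker_mul_conj_slope A z w :
  complex.Im (ker A z w * conjc (ker_slope A w)) = imz z * normc (ker_slope A w) ^+ 2 + imz w.
Proof.
have adbc := SL2_adbc A; rewrite normc_sqr /imz.
rewrite /ker /ker_slope /moebius_num /moebius_den.
case: z w => -[x y] /= y0 [[x' y'] /= y0'].
move: adbc; move: (val A ord0 ord0) (val A ord0 ord_max) (val A ord_max ord0)
  (val A ord_max ord_max) => a b c d adbc.
rewrite -[X in _ = _ + X]mul1r -adbc; ring.
Qed.

(** A zero below the real axis has distance at least [imz z] from [z]. *)
Lemma slope_le_ker A z w : imz z * normc (ker_slope A w) <= normc (ker A z w).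
Proof.
have := Im_ker_mul_conj_slope A z w; have := normc_ge_absIm (ker A z w * conjc (ker_slope A w)).
rewrite Normc.normcM normc_conj.
have [->|s0 + imE] := eqVneq (ker_slope A w) 0; first by move=> _ _; rewrite Normc.normc0 mulr0 normc_ge0.
have n0 : 0 < normc (ker_slope A w) by rewrite normc_gt0.
rewrite imE => /(le_trans (ler_norm _)) le1.
rewrite -(ler_pM2r n0); apply: le_trans le1.
by rewrite -mulrA -expr2 lerDl ltW// imz_gt0.
Qed.

(** The kernel changes by [slope * (z' - z)], and [slope_le_ker] bounds the slope by the kernel
    itself. The resulting factor does not involve [A], so it applies to all terms of a sum over the
    group at once. *)
Lemma ker_harnackl A z z' w :
  normc (ker A z' w) * imz z <= normc (ker A z w) * (imz z + normc (val z' - val z)).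
Proof.
have -> : ker A z' w = ker A z w + ker_slope A w * (val z' - val z).
  by rewrite -ker_subl; ring.
rewrite [X in _ <= X]mulrDr -lerBlDl.
apply: (@le_trans _ _ (normc (ker_slope A w * (val z' - val z)) * imz z)).
  rewrite lerBlDl -mulrDl.
  by apply: ler_wpM2r; [exact/ltW/imz_gt0 | exact: le_normcD].
rewrite Normc.normcM mulrAC ler_wpM2r ?normc_ge0// mulrC.
exact: slope_le_ker.
Qed.

(** The kernel is affine in the conjugate of [w] with coefficient [- moebius_den A z], which
    [den_le_ker] bounds. *)
Lemma ker_harnackr A z w w' :
  normc (ker A z w') * imz w <= normc (ker A z w) * (imz w + normc (val w' - val w)).
Proof.
have -> : ker A z w' = ker A z w + conjc (val w - val w') * moebius_den A z.
  by rewrite -ker_subr; ring.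
rewrite [X in _ <= X]mulrDr -lerBlDl.
apply: (@le_trans _ _ (normc (conjc (val w - val w') * moebius_den A z) * imz w)).
  rewrite lerBlDl -mulrDl.
  by apply: ler_wpM2r; [exact/ltW/imz_gt0 | exact: le_normcD].
rewrite Normc.normcM normc_conj -normcN opprB -mulrA mulrC ler_wpM2r ?normc_ge0//.
exact: den_le_ker.
Qed.

End Kernel.

(** * Displacement, trace and axis of a matrix *)

Section Displacement.
Variable R : realType.
Local Notation normc := Normc.normc.
Implicit Types (A B : SL2 R) (z w : uhp R).

(* [disp A z = cosh (d(z, A z) / 2)] for the hyperbolic distance [d]. *)
Definition disp A z : R := normc (ker A z z) / (2 * imz z).

Definition trace2 A : R := val A ord0 ord0 + val A ord_max ord_max.

Lemma trace2E A : \tr (val A) = trace2 A.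
Proof.
rewrite /mxtrace !big_ord_recl big_ord0 addr0 /trace2.
by rewrite (_ : lift ord0 ord0 = ord_max)//; exact: val_inj.
Qed.

Lemma Im_ker_diag A z : complex.Im (ker A z z) = imz z * trace2 A.
Proof.
rewrite /imz /trace2 /ker /moebius_num /moebius_den.
by case: z => -[x y] /= y0; ring.
Qed.

(** For hyperbolic [A] its zero set is the axis, the geodesic that joins the two fixed points. *)
Definition axis_form A z : R :=
  let x := complex.Re (val z) in
  (val A ord0 ord0 - val A ord_max ord_max) * x + val A ord0 ord_max
  - val A ord_max ord0 * (x ^+ 2 + imz z ^+ 2).

Lemma Re_ker_diag A z : complex.Re (ker A z z) = axis_form A z.
Proof.
rewrite /axis_form /imz /ker /moebius_num /moebius_den.
by case: z => -[x y] /= y0; ring.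
Qed.

Lemma disp_ge0 A z : 0 <= disp A z.
Proof. by rewrite divr_ge0 ?normc_ge0// mulr_ge0// ltW// imz_gt0. Qed.

(** The imaginary part of the diagonal kernel is [imz z] times the trace, so only the axis form
    makes the displacement vary with [z]. *)
Lemma disp_sqr A z : 4 * disp A z ^+ 2 = trace2 A ^+ 2 + (axis_form A z / imz z) ^+ 2.
Proof.
rewrite /disp expr_div_n normc_sqr Im_ker_diag Re_ker_diag.
by field; rewrite gt_eqF// imz_gt0.
Qed.

Lemma disp_ge1 A z : 1 <= disp A z.
Proof.
rewrite -(ler_pXn2r (n := 2)) ?nnegrE ?disp_ge0// expr1n /disp expr_div_n.
have z0 := imz_gt0 z.
rewrite ler_pdivlMr ?exprn_gt0 ?mulr_gt0// mul1r.
by apply: le_trans (ker_ge A z z); rewrite le_eqVlt; apply/orP; left; apply/eqP; ring.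
Qed.

Lemma disp_sign A B z : val A = val B \/ val A = - val B -> disp A z = disp B z.
Proof.
case=> [/val_inj ->//|AB].
by rewrite /disp (ker_sign _ _ AB) normcN.
Qed.

Lemma trace2_sign A B : val A = val B \/ val A = - val B -> trace2 A ^+ 2 = trace2 B ^+ 2.
Proof.
case=> [/val_inj ->//|AB]; rewrite /trace2 AB !mxE; ring.
Qed.

Lemma disp_conj A B z : disp (B * A * B^-1)%g (moebius B z) = disp A z.
Proof.
rewrite /disp; have b0 := moebius_den_neq0 B z.
have n0 : normc (moebius_den B z) != 0 by rewrite normc_eq0.
have H : ker (B * A * B^-1)%g (moebius B z) (moebius B z) *
    (moebius_den B z * conjc (moebius_den B z)) = ker A z z.
  rewrite -(kerMl B A z z) mulrA -kerMr.
  by rewrite -!mulgA mulVg mulg1.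
rewrite -H imz_moebius Normc.normcM mul_conjc normc_real.
rewrite ger0_norm ?sqr_ge0//; field.
by rewrite n0 gt_eqF// imz_gt0.
Qed.

Lemma mx2P (M N : 'M[R]_2) : M ord0 ord0 = N ord0 ord0 ->
  M ord0 ord_max = N ord0 ord_max -> M ord_max ord0 = N ord_max ord0 ->
  M ord_max ord_max = N ord_max ord_max -> M = N.
Proof.
have ordP (i : 'I_2) : i = ord0 \/ i = ord_max.
  by case: i => -[|[|//]] ?; [left|right]; exact: val_inj.
move=> H1 H2 H3 H4; apply/matrixP => i j.
by case: (ordP i) => ->; case: (ordP j) => ->.
Qed.

Lemma parabolic_axis_id A z : axis_form A z = 0 -> trace2 A ^+ 2 = 4 ->
  val A = 1 \/ val A = - 1.
Proof.
have adbc := SL2_adbc A; have y0 := imz_gt0 z.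
rewrite /axis_form /trace2; move: (complex.Re _) (imz z) y0 adbc => x y y0.
set a := val A ord0 ord0; set b := val A ord0 ord_max.
set c := val A ord_max ord0; set d := val A ord_max ord_max => adbc h tr.
have adE : a * d = 1 + b * c by rewrite -adbc; ring.
have disc : (a - d) ^+ 2 = - 4 * (b * c).
  have -> : (a - d) ^+ 2 = (a + d) ^+ 2 - 4 * (a * d) by ring.
  by rewrite tr adE; ring.
(* For trace 2 or -2 the axis form has discriminant zero; multiplied by [- c] it becomes this sum of
   two squares. *)
have : (c * y) ^+ 2 + (c * x - (a - d) / 2) ^+ 2 = 0.
  have -> : (c * y) ^+ 2 + (c * x - (a - d) / 2) ^+ 2 =
    - c * ((a - d) * x + b - c * (x ^+ 2 + y ^+ 2)) + b * c + (a - d) ^+ 2 / 4.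
    by field.
  by rewrite h disc; field.
move=> /eqP; rewrite paddr_eq0 ?sqr_ge0// !sqrf_eq0 mulf_eq0 (gt_eqF y0) orbF.
move=> /andP[/eqP c0]; rewrite c0 mul0r sub0r oppr_eq0 mulf_eq0 invr_eq0 pnatr_eq0 orbF.
rewrite subr_eq0 => /eqP ad.
have b0 : b = 0 by move: h; rewrite ad c0 subrr !mul0r add0r subr0.
have : (d - 1) * (d + 1) = 0.
  have d2 : d * d = 1 by rewrite -{1}ad adE b0 mul0r addr0.
  by transitivity (d * d - 1); [ring | rewrite d2 subrr].
move=> /eqP; rewrite mulf_eq0 subr_eq0 addr_eq0 => /orP[] /eqP d1; [left|right];
  apply: mx2P; rewrite !mxE/= -/a -/b -/c -/d ?c0 ?b0 ?ad ?d1 ?oppr0//.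
Qed.

(** By [disp_sqr] it suffices to lower the modulus of [axis_form A z / imz z]. An explicit point
    does so: one on the axis for hyperbolic [A], one close enough to the fixed point for parabolic
    [A]. *)
Lemma disp_decrease A z : 4 <= trace2 A ^+ 2 -> axis_form A z != 0 ->
  exists z', disp A z' < disp A z.
Proof.
move=> tr4 h0; have y0 := imz_gt0 z.
pose g z' := axis_form A z' / imz z'.
have gz0 : 0 < `|g z| by rewrite normr_gt0 mulf_neq0// invr_eq0 gt_eqF.
suff [z' gz'] : exists z', `|g z'| < `|g z|.
  exists z'; rewrite -(ltr_pXn2r (n := 2)) ?nnegrE ?disp_ge0//.
  rewrite -(ltr_pM2l (_ : 0 < 4))// !disp_sqr ltrD2l.
  by rewrite -[X in X < _]real_normK ?num_real// -[X in _ < X]real_normK ?num_real// ltr_pXn2r.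
have adbc := SL2_adbc A.
pose pt x (y : R) (y0 : 0 < y) : uhp R := exist _ (x +i* y) y0.
have gE x y (y1 : 0 < y) : g (pt x y y1) =
    ((val A ord0 ord0 - val A ord_max ord_max) * x + val A ord0 ord_max
      - val A ord_max ord0 * (x ^+ 2 + y ^+ 2)) / y by [].
move: tr4 adbc gE; rewrite /trace2.
move: (val A ord0 ord0) (val A ord0 ord_max) (val A ord_max ord0)
  (val A ord_max ord_max) => a b c d tr4 adbc gE.
have [c0|c0] := eqVneq c 0.
  (* If [a = d], then [A] is a translation up to sign, and [b / y] decreases as the point rises.
     Otherwise the axis is the vertical line over the finite fixed point [- b / (a - d)]. *)
  have [ad|ad] := eqVneq a d.
    have Y0 : 0 < (`|b| + 1) / `|g z| by rewrite divr_gt0// ltr_wpDl.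
    exists (pt 0 _ Y0); rewrite gE c0 ad subrr !mul0r add0r subr0.
    rewrite normrM normfV (gtr0_norm Y0) invf_div mulrCA gtr_pMr//.
    by rewrite ltr_pdivrMr ?mul1r ?ltrDl// ltr_wpDl.
  exists (pt (- b / (a - d)) 1 ltr01); rewrite gE c0 mul0r subr0.
  by rewrite mulrCA divff ?subr_eq0// mulr1 addNr mul0r normr0.
(* The midpoint of the two fixed points, which are the roots of a quadratic equation with
   discriminant [D]. *)
pose x0 := (a - d) / (2 * c).
pose D := (a + d) ^+ 2 - 4.
have DE : D = (a - d) ^+ 2 + 4 * (b * c).
  have adE : a * d = 1 + b * c by rewrite -adbc; ring.
  have -> : b * c = a * d - 1 by rewrite adE; ring.
  by rewrite /D; ring.
have D0 : 0 <= D by rewrite subr_ge0.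
have gx y (y1 : 0 < y) : g (pt x0 y y1) = D / (4 * c * y) - c * y.
  rewrite gE DE /x0; field.
  by rewrite c0 gt_eqF.
(* In the parabolic case [x0] is the fixed point, and the value at height [y] above it is [- c * y];
   the height chosen makes its modulus half of that of [g z]. *)
have [D1|D1] := eqVneq D 0.
  have Y0 : 0 < `|g z| / (2 * `|c|) by rewrite divr_gt0// mulr_gt0// normr_gt0.
  exists (pt x0 _ Y0); rewrite gx D1 mul0r sub0r normrN normrM (gtr0_norm Y0).
  rewrite mulrC invfM mulrA mulfVK ?normr_eq0//.
  by rewrite ltr_pdivrMr// ltr_pMr// ltrDl.
have D2 : 0 < D by rewrite lt_neqAle eq_sym D1.
(* This height is the radius of the semicircular axis: the point is its top, where the form
   vanishes. *)
have Y0 : 0 < Num.sqrt D / (2 * `|c|).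
  by rewrite divr_gt0 ?sqrtr_gt0// mulr_gt0// normr_gt0.
exists (pt x0 _ Y0); rewrite gx.
have -> : D / (4 * c * (Num.sqrt D / (2 * `|c|))) - c * (Num.sqrt D / (2 * `|c|)) = 0.
  have s0 : Num.sqrt D != 0 by rewrite gt_eqF// sqrtr_gt0.
  have c1 : `|c| != 0 by rewrite normr_eq0.
  have sE := sqr_sqrtr D0; move: (Num.sqrt D) sE s0 => s <- s0.
  transitivity (s / (2 * c * `|c|) * (`|c| ^+ 2 - c ^+ 2)).
    by field; rewrite s0 c0 c1.
  by rewrite real_normK ?num_real// subrr mulr0.
by rewrite normr0.
Qed.

(** A fixed point has displacement one, so [disp_sqr] reads [4 = trace^2 + form^2]. With [trace^2]
    at least 4 the form vanishes, and [parabolic_axis_id] concludes. *)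
Lemma fixed_point_id A z : 4 <= trace2 A ^+ 2 -> moebius A z = z ->
  val A = 1 \/ val A = - 1.
Proof.
move=> tr4 fixz; have y0 := imz_gt0 z.
have n1 : normc (moebius_den A z) ^+ 2 = 1.
  have := imz_moebius A z; rewrite fixz => yE.
  have n0 : normc (moebius_den A z) ^+ 2 != 0.
    by rewrite expf_neq0// normc_eq0 moebius_den_neq0.
  by apply: (mulfI (lt0r_neq0 y0)); rewrite {1}yE divfK ?mulr1.
have d1 : 4 * disp A z ^+ 2 = 4.
  rewrite /disp kerE fixz Normc.normcM expr_div_n exprMn n1 mul1r.
  rewrite normc_sqr /imz; case: z y0 {fixz n1} => -[x y]/= y1 _.
  by rewrite subrr opprK; field; rewrite gt_eqF.
move: (disp_sqr A z); rewrite d1 => E.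
have t4 : trace2 A ^+ 2 = 4.
  apply/eqP; rewrite eq_le tr4 andbT E lerDl sqr_ge0//.
apply: (parabolic_axis_id (z := z)) => //.
move: E; rewrite t4 => /eqP; rewrite addrC -subr_eq subrr eq_sym sqrf_eq0.
by rewrite mulf_eq0 invr_eq0 (gt_eqF y0) orbF => /eqP.
Qed.

End Displacement.

(** * Finiteness from discreteness *)

Section Discreteness.
Variables (R : realType) (G : groupClosed (PSL2 R)).
Local Notation normc := Normc.normc.
Implicit Types (A B : SL2 R) (z w : uhp R) (g h : PSL2 R).

(** The neighbourhood that isolates the identity is pulled back along the continuous projection to
    matrices, where it contains a ball for the maximum of the entries. *)
Lemma fuchsian_gap : fuchsian G -> exists2 e : R, 0 < e &
  forall A, \pi_(PSL2 R) A \in G ->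
    (forall i j, `|val A i j - (i == j)%:R| < e) -> \pi_(PSL2 R) A = 1%g.
Proof.
have G1 : (1%g : PSL2 R) \in G by exact: gpred1.
move=> /(_ 1%g G1)[_ [V V1 VG]].
have : nbhs (1%g : SL2 R) (\pi_(PSL2 R) @^-1` V).
  exact: (@pi_continuous (SL2 R) (PSL2 R) 1%g).
move=> [_ [[B oB <-] B1 BV]].
have : nbhs (val (1%g : SL2 R)) B by apply: open_nbhs_nbhs.
move=> /nbhs_ballP[e /= e0 eB]; exists e => // A AG Ae.
have : (V `&` [set h | h \in G]) (\pi_(PSL2 R) A).
  split=> //; apply: BV; apply: eB; split => // i j.
  by rewrite -ball_normE /= distrC; have := Ae i j; rewrite !mxE.
by rewrite VG.
Qed.

Lemma SL2_invE A : val (A^-1)%g = \matrix_(i, j)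
  if i == j then (if i == ord0 then val A ord_max ord_max else val A ord0 ord0)
  else - val A i j.
Proof.
have adbc := SL2_adbc A; rewrite /= in adbc.
set N := \matrix_(i, j) _.
have NA : N * val A = 1.
  apply: mx2P; rewrite !mxE !big_ord_recl !big_ord0 !mxE/=
    (_ : lift ord0 ord0 = ord_max) ?addr0/=; try exact: val_inj; last 3 first.
  - by ring.
  - by ring.
  - by apply: etrans adbc; ring.
  - by apply: etrans adbc; ring.
by rewrite /= -[LHS]mul1r -NA -mulrA divrr ?mulr1// SL2_unit.
Qed.

(** Pigeonhole: the entries are sorted into boxes of side [1 / K], and two elements in the same box
    have a quotient so close to the identity that [fuchsian_gap] applies. *)
Lemma bounded_finite (M : R) : fuchsian G ->
  finite_set [set g | g \in G /\ forall i j, `|val (repr g) i j| <= M].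
Proof.
move=> /fuchsian_gap[e e0 eG].
have [M0|M0] := ltP M 0.
  rewrite (_ : mkset _ = set0)//; apply/seteqP; split=> // g [_ /(_ ord0 ord0)].
  by rewrite leNgt (lt_le_trans M0).
(* The entries of [g^-1 h - 1 = g^-1 (h - g)] are at most [2 M / K], which this choice makes smaller
   than [e]. *)
pose K := (2 * M + 1) / e.
have K0 : 0 < K by rewrite divr_gt0// ltr_wpDl// mulr_ge0.
pose N := Num.truncn (2 * M * K).
pose f g : {ffun 'I_2 * 'I_2 -> 'I_N.+1} :=
  [ffun ij => inord (Num.truncn ((val (repr g) ij.1 ij.2 + M) * K))].
set S := mkset _.
suff injf : {in S &, injective f}.
  by rewrite -(eq_finite_set (inj_card_eq injf)); exact: finite_finset.
move=> g h /[!inE] -[gG gM] [hG hM] fgh.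
have close i j : `|val (repr h) i j - val (repr g) i j| * K < 1.
  have := congr1 (fun F : {ffun 'I_2 * 'I_2 -> 'I_N.+1} => nat_of_ord (F (i, j))) fgh; rewrite !ffunE /=.
  have rng g' : S g' -> 0 <= (val (repr g') i j + M) * K /\
      (Num.truncn ((val (repr g') i j + M) * K) < N.+1)%N.
    move=> [_ /(_ i j)]; rewrite ler_norml => /andP[l1 l2].
    have l3 : 0 <= (val (repr g') i j + M) * K by apply: mulr_ge0; [rewrite -lerBlDr sub0r | exact: ltW].
    split=> //; rewrite ltnS; apply: le_truncn.
    by rewrite ler_pM2r// mulr_natl mulr2n lerD2r.
  have [g1 g2] := rng _ (conj gG gM); have [h1 h2] := rng _ (conj hG hM).
  rewrite !inordK// => E.
  have := truncn_itv g1; have := truncn_itv h1; rewrite E.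
  move=> /andP[a1 a2] /andP[b1 b2].
  have -> : `|val (repr h) i j - val (repr g) i j| * K =
      `|(val (repr h) i j + M) * K - (val (repr g) i j + M) * K|.
    by rewrite -mulrBl normrM (gtr0_norm K0); congr (`| _ | * _); ring.
  move: a1 a2 b1 b2; rewrite -[X in _ < X]natr1; move: (_ * K) (_ * K) => u v a1 a2 b1 b2.
  by rewrite ltr_norml; apply/andP; split; lra.
have : \pi_(PSL2 R) ((repr g)^-1 * repr h)%g = 1%g.
  apply: eG.
    rewrite PSL2_piM PSL2_piV !reprK.
    by apply: gpredM => //; exact: gpredVr.
  move=> i j.
  have -> : val ((repr g)^-1 * repr h)%g i j - (i == j)%:R =
      \sum_l val (repr g)^-1%g i l * (val (repr h) l j - val (repr g) l j).
    under eq_bigr do rewrite mulrBr; rewrite sumrB; congr (_ - _).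
      by rewrite /= mxE.
    have : val ((repr g)^-1 * repr g)%g i j = (1%:M : 'M[R]_2) i j by rewrite mulVg.
    by rewrite /= !mxE => ->.
  apply: le_lt_trans (ler_norm_sum _ _ _) _.
  have ginv l : `|val (repr g)^-1%g i l| <= M.
    by rewrite SL2_invE mxE; case: ifP => _; [case: ifP => _|rewrite normrN].
  apply: (@le_lt_trans _ _ (\sum_(l : 'I_2) M * K^-1)).
    apply: ler_sum => l _; rewrite normrM; apply: ler_pM => //.
    by rewrite -div1r ler_pdivlMr// ltW.
  rewrite sumr_const card_ord /K invf_div.
  have -> : M * (e / (2 * M + 1)) *+ 2 = (2 * M * e) / (2 * M + 1) by ring.
  rewrite ltr_pdivrMr; last by rewrite ltr_wpDl// mulr_ge0.
  by rewrite mulrDr mulr1 [e * _]mulrC ltrDl.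
rewrite PSL2_piM PSL2_piV !reprK => ghE.
by rewrite -[h]mul1g -(mulgV g) -mulgA [X in (_ * X)%g]ghE mulg1.
Qed.

Lemma fuchsian_countable : fuchsian G -> countable [set g | g \in G].
Proof.
move=> fG; have -> : [set g | g \in G] = \bigcup_(n in [set: nat])
    [set g | g \in G /\ forall i j, `|val (repr g) i j| <= n%:R].
  apply/seteqP; split=> [g gG|g [n _ []]//].
  pose M : R := \sum_i \sum_j `|val (repr g) i j|.
  exists (Num.truncn M).+1 => //; split => // i j.
  apply: (@le_trans _ _ M).
    rewrite /M (bigD1 i)//= (bigD1 j)//= -addrA lerDl.
    by rewrite addr_ge0// sumr_ge0// => l _; rewrite sumr_ge0.
  by apply/ltW/truncnS_gt.
by apply: bigcup_countable => // n _; apply: finite_set_countable; exact: bounded_finite.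
Qed.

(** The kernel bounds the denominator by [den_le_ker], hence the numerator. A real affine form
    [a z + b] bounds [a] through its imaginary part [a * imz z], and then [b]. *)
Lemma ker_entries z w : exists2 C : R, 0 <= C & forall A, forall i j,
  `|val A i j| <= C * normc (ker A z w).
Proof.
have y0 := imz_gt0 z; have v0 := imz_gt0 w.
pose D := 1 / imz w; pose N := 1 + normc (val w) * D; pose L := 1 + normc (val z) / imz z.
have D0 : 0 <= D by rewrite divr_ge0// ltW.
have N0 : 0 <= N by rewrite addr_ge0// mulr_ge0// normc_ge0.
have L0 : 0 <= L by rewrite addr_ge0// divr_ge0 ?normc_ge0// ltW.
have row (a b : R) : `|a| <= normc (a%:C * val z + b%:C) / imz z /\
    `|b| <= L * normc (a%:C * val z + b%:C).
  have aP : `|a| <= normc (a%:C * val z + b%:C) / imz z.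
    rewrite ler_pdivlMr// -[X in _ * X](gtr0_norm y0) -normrM.
    apply: le_trans (normc_ge_absIm _); rewrite /imz.
    by case: (val z) => x y /=; rewrite mul0r !addr0.
  split=> //; rewrite -(normc_real b).
  have {1}-> : b%:C = (a%:C * val z + b%:C) - a%:C * val z by ring.
  apply: le_trans (le_normcB _ _) _; rewrite mulrDl mul1r lerD2l.
  rewrite Normc.normcM normc_real mulrC -mulrA ler_wpM2l ?normc_ge0//.
  by rewrite mulrC.
have den (B : SL2 R) : normc (moebius_den B z) <= D * normc (ker B z w).
  by rewrite /D mul1r mulrC ler_pdivlMr// den_le_ker.
have num (B : SL2 R) : normc (moebius_num B z) <= N * normc (ker B z w).
  have -> : moebius_num B z = ker B z w + conjc (val w) * moebius_den B z by rewrite /ker; ring.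
  apply: le_trans (le_normcD _ _) _.
  rewrite Normc.normcM normc_conj mulrDl mul1r lerD2l -mulrA.
  by rewrite ler_wpM2l ?normc_ge0.
pose C := (N + D) * ((imz z)^-1 + L).
have y1 : 0 <= (imz z)^-1 by rewrite invr_ge0 ltW.
exists C; first by apply: mulr_ge0; apply: addr_ge0.
move=> B i j.
have k0 := normc_ge0 (ker B z w).
have [n1 n2] := row (val B ord0 ord0) (val B ord0 ord_max).
have [d1 d2] := row (val B ord_max ord0) (val B ord_max ord_max).
have Nk : 0 <= N * normc (ker B z w) by rewrite mulr_ge0.
have Dk : 0 <= D * normc (ker B z w) by rewrite mulr_ge0.
have le1 (X a : R) : 0 <= X -> `|a| <= X / imz z -> X <= (N + D) * normc (ker B z w) ->
    `|a| <= C * normc (ker B z w).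
  move=> X0 aX XC; apply: le_trans aX _; rewrite /C mulrAC ler_pM//.
  by rewrite lerDl.
have le2 (X a : R) : 0 <= X -> `|a| <= L * X -> X <= (N + D) * normc (ker B z w) ->
    `|a| <= C * normc (ker B z w).
  move=> X0 aX XC; apply: le_trans aX _; rewrite /C mulrAC mulrC ler_pM//.
  by rewrite lerDr.
have numC : normc (moebius_num B z) <= (N + D) * normc (ker B z w).
  by rewrite mulrDl; apply: le_trans (num B) _; rewrite lerDl.
have denC : normc (moebius_den B z) <= (N + D) * normc (ker B z w).
  by rewrite mulrDl; apply: le_trans (den B) _; rewrite lerDr.
have ordP (l : 'I_2) : l = ord0 \/ l = ord_max.
  by case: l => -[|[|//]] ?; [left|right]; exact: val_inj.
case: (ordP i) => ->; case: (ordP j) => ->.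
- by apply: le1 n1 numC; exact: normc_ge0.
- by apply: le2 n2 numC; exact: normc_ge0.
- by apply: le1 d1 denC; exact: normc_ge0.
- by apply: le2 d2 denC; exact: normc_ge0.
Qed.

Lemma ker_finite z w (X : R) : fuchsian G ->
  finite_set [set g | g \in G /\ normc (ker (repr g) z w) <= X].
Proof.
move=> fG; have [C C0 kC] := ker_entries z w.
apply: sub_finite_set (bounded_finite (C * X) fG) => g [gG gX]; split=> // i j.
by apply: le_trans (kC _ i j) _; rewrite ler_wpM2l.
Qed.

End Discreteness.

(** * The shortest displacement *)

Section Systole.
Variables (R : realType) (G : groupClosed (PSL2 R)).
Local Notation normc := Normc.normc.
Implicit Types (A B : SL2 R) (z w : uhp R) (g h : PSL2 R).

Definition gdisp g z : R := disp (repr g) z.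

Lemma gdisp_pi A z : gdisp (\pi_(PSL2 R) A) z = disp A z.
Proof. exact/disp_sign/repr_PSL2. Qed.

Lemma gdisp_conj g h z : gdisp (h * g * h^-1)%g (act h z) = gdisp g z.
Proof.
have -> : (h * g * h^-1)%g = \pi_(PSL2 R) (repr h * repr g * (repr h)^-1)%g.
  by rewrite !PSL2_piM PSL2_piV !reprK.
by rewrite gdisp_pi disp_conj.
Qed.

Lemma conj_eq1 g h : ((h * g * h^-1)%g == 1%g) = (g == 1%g).
Proof.
apply/eqP/eqP => [E|->]; last by rewrite mulg1 mulgV.
have : (h^-1 * (h * g * h^-1) * h)%g = 1%g by rewrite E mulg1 mulVg.
by rewrite -!mulgA mulVg mulg1 mulgA mulVg mul1g.
Qed.

Lemma ball_normc (u v : R[i]) (e : R) :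
  ball (u : R[i]^o) e%:C (v : R[i]^o) <-> normc (v - u) < e.
Proof. by rewrite -ball_normE /= distrC normcE ltcR. Qed.

Lemma uhp_nbhs z (e : R) : 0 < e ->
  nbhs z [set z' : uhp R | normc (val z' - val z) < e].
Proof.
move=> e0; have e0' : 0 < e%:C by rewrite ltcR.
have : nbhs z [set z' : uhp R | ball (val z : R[i]^o) e%:C (val z' : R[i]^o)].
  rewrite nbhsE; exists (val @^-1` (ball (val z : R[i]^o) e%:C)); last by [].
  split; last exact: ballxx.
  exists (ball (val z : R[i]^o) e%:C) => //; exact: ball_open.
by apply: filterS => z' /=; rewrite ball_normc.
Qed.

(** One Harnack inequality for each argument of the diagonal kernel. The factor tends to 1 as the
    points approach each other, uniformly in [A]. *)
Lemma disp_harnack A z z' :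
  disp A z <= disp A z' * ((imz z' + normc (val z - val z')) ^+ 2 / (imz z' * imz z)).
Proof.
have y0 := imz_gt0 z; have y0' := imz_gt0 z'.
have d0 := normc_ge0 (val z - val z').
rewrite /disp ler_pdivrMr ?mulr_gt0//.
have l := ker_harnackl A z' z z'; have r := ker_harnackr A z z' z.
have y2 : 0 < imz z' ^+ 2 by rewrite exprn_gt0.
rewrite -(ler_pM2r y2).
apply: le_trans (_ : normc (ker A z z') * (imz z' + normc (val z - val z')) * imz z' <= _).
  by rewrite expr2 mulrA ler_pM2r.
rewrite mulrAC.
apply: le_trans (_ : normc (ker A z' z') * (imz z' + normc (val z - val z')) *
  (imz z' + normc (val z - val z')) <= _).
  by rewrite ler_wpM2r// addr_ge0// ltW.
rewrite le_eqVlt; apply/orP; left; apply/eqP; field.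
by rewrite !gt_eqF.
Qed.

Lemma seq_min (T : eqType) (f : T -> R) (s : seq T) : s != [::] ->
  exists2 x, x \in s & forall y, y \in s -> f x <= f y.
Proof.
elim: s => // a s IH _; have [->|/IH[x xs xP]] := eqVneq s [::].
  by exists a; rewrite ?mem_head// => y /[!inE] /eqP ->.
have [ax|xa] := leP (f a) (f x).
  exists a; rewrite ?mem_head// => y /[!inE] /orP[/eqP->//|/xP]; exact: le_trans.
exists x; first by rewrite inE xs orbT.
by move=> y /[!inE] /orP[/eqP->|/xP//]; exact: ltW.
Qed.

Hypotheses (fuchsianG : fuchsian G) (cocompactG : cocompact G).

(** The competitors of any [g0] have a kernel no larger than that of [g0], and by [ker_finite] they
    form a finite list. *)
Lemma gdisp_min z : (exists2 g, g \in G & g != 1%g) ->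
  exists g, [/\ g \in G, g != 1%g &
    forall h, h \in G -> h != 1%g -> gdisp g z <= gdisp h z].
Proof.
move=> [g0 g0G g01].
have /finite_seqP[s sE] := ker_finite z z (normc (ker (repr g0) z z)) fuchsianG.
have inS h : h \in s = (h \in G) && (normc (ker (repr h) z z) <= normc (ker (repr g0) z z)).
  have : (h \in s) <-> h \in G /\ normc (ker (repr h) z z) <= normc (ker (repr g0) z z).
    by have := f_equal (fun S => S h) sE => /= ->.
  by move=> [H1 H2]; apply/idP/andP.
have s0 : [seq h <- s | h != 1%g] != [::].
  apply/eqP => E; have : g0 \in [seq h <- s | h != 1%g] by rewrite mem_filter g01 inS g0G lexx.
  by rewrite E.
have [g] := seq_min (fun h => gdisp h z) s0.
rewrite mem_filter inS => /and3P[g1 gG gg0] gP; exists g; split=> // h hG h1.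
have [hg|gh] := leP (normc (ker (repr h) z z)) (normc (ker (repr g0) z z)).
  by apply: gP; rewrite mem_filter h1 inS hG hg.
rewrite /gdisp /disp ler_pM2r ?invr_gt0 ?mulr_gt0 ?imz_gt0//.
exact/ltW/(le_lt_trans gg0).
Qed.

(** The smallest displacement at [z] is [t * (1 + q)] with [q > 0], and on a small disc
    [disp_harnack] costs every group element a factor below [1 + q]. *)
Lemma gdisp_gt_nbhs z (t : R) : 0 < t ->
  (forall g, g \in G -> g != 1%g -> t < gdisp g z) ->
  nbhs z [set z' | forall g, g \in G -> g != 1%g -> t < gdisp g z'].
Proof.
move=> t0 tz.
have [nontriv|triv] := pselect (exists2 g, g \in G & g != 1%g); last first.
  by apply: filterS (uhp_nbhs z ltr01) => z' _ g gG g1; case: triv; exists g.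
have [g [gG g1 gmin]] := gdisp_min z nontriv.
have tg := tz _ gG g1; have y0 := imz_gt0 z.
pose q := gdisp g z / t - 1.
have q0 : 0 < q by rewrite subr_gt0 ltr_pdivlMr// mul1r.
(* Within distance [eta * imz z] of [z] the Harnack factor is at most [1 + 10 * eta], and
   [10 * eta < q]. *)
pose eta := Num.min (1 / 2) (q / 20).
have eta0 : 0 < eta by rewrite lt_min divr_gt0//= divr_gt0.
have eta2 : eta <= 1 / 2 by rewrite ge_min lexx.
have etaq : 10 * eta < q.
  have : eta <= q / 20 by rewrite ge_min lexx orbT.
  by move=> ?; lra.
have := uhp_nbhs z (mulr_gt0 eta0 y0); apply: filterS => z' /= zz' h hG h1.
have y0' := imz_gt0 z'.
pose D := normc (val z - val z').
have DE : D = normc (val z' - val z) by rewrite /D -normcN opprB.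
have dy : `|imz z' - imz z| <= D.
  rewrite DE (_ : imz z' - imz z = complex.Im (val z' - val z)).
    exact: normc_ge_absIm.
  by rewrite /imz; case: (val z') => ? ?; case: (val z).
have y1 : imz z' <= (1 + eta) * imz z.
  by move: dy; rewrite ler_norml => /andP[_]; rewrite DE in zz' *; lra.
have y2 : (1 - eta) * imz z <= imz z'.
  by move: dy; rewrite ler_norml => /andP[]; rewrite DE in zz' *; lra.
have hr : (imz z' + D) ^+ 2 / (imz z' * imz z) <= 1 + 10 * eta.
  rewrite ler_pdivrMr ?mulr_gt0//.
  apply: (@le_trans _ _ ((imz z' + eta * imz z) ^+ 2)).
    rewrite ler_pXn2r ?nnegrE ?addr_ge0 ?normc_ge0 ?(ltW y0')//.
      by rewrite lerD2l DE ltW.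
    by rewrite mulr_ge0 ?(ltW y0) ?(ltW eta0).
  have P1 : 0 <= (imz z' - (1 - eta) * imz z) * ((1 + eta) * imz z - imz z').
    by rewrite mulr_ge0// subr_ge0.
  have P2 : imz z' * imz z <= (1 + eta) * imz z * imz z by rewrite ler_pM2r.
  have P3 : 8 * eta * ((1 - eta) * imz z * imz z) <= 8 * eta * (imz z' * imz z).
    by rewrite ler_pM2l ?mulr_gt0// ler_pM2r.
  have P4 : 0 <= imz z ^+ 2 * eta * (7 - 10 * eta).
    by rewrite mulr_ge0 ?mulr_ge0 ?sqr_ge0 ?(ltW eta0)//; lra.
  move: P1 P2 P3 P4; move: (imz z) (imz z') => y y'.
  by move=> P1 P2 P3 P4; nra.
have : gdisp g z <= gdisp h z' * (1 + 10 * eta).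
  apply: le_trans (gmin _ hG h1) _; apply: le_trans (disp_harnack _ z z') _.
  by rewrite ler_wpM2l// disp_ge0.
have h0 : 1 <= gdisp h z' by exact: disp_ge1.
have -> : gdisp g z = t * (1 + q) by rewrite /q; field; rewrite gt_eqF.
move=> le1; rewrite ltNge; apply/negP => le2.
have : gdisp h z' * (1 + 10 * eta) < t * (1 + q).
  apply: (@le_lt_trans _ _ (t * (1 + 10 * eta))).
    by rewrite ler_pM2r//; lra.
  by rewrite ltr_pM2l// ltrD2l.
by rewrite ltNge le1.
Qed.

Lemma quot_nbhs (x : quot_uhp G) (V : set (uhp R)) : open V ->
  (forall z h, h \in G -> V z -> V (act h z)) -> V (repr x) ->
  nbhs x [set x' : quot_uhp G | V (repr x')].
Proof.
move=> oV Vinv Vx.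
have piE : \pi_(quot_uhp G) @^-1` [set x' : quot_uhp G | V (repr x')] = V.
  apply/seteqP; split => z /=.
    have /eqmodP/asboolP[h hG {2}->] : \pi_(quot_uhp G) (repr (\pi_(quot_uhp G) z)) = \pi_(quot_uhp G) z.
      by rewrite reprK.
    exact: Vinv.
  have /eqmodP/asboolP[h hG ->] : \pi_(quot_uhp G) z = \pi_(quot_uhp G) (repr (\pi_(quot_uhp G) z)).
    by rewrite reprK.
  exact: Vinv.
apply: open_nbhs_nbhs; split => //.
by rewrite /open/= /quotient_open piE.
Qed.

(** If the infimum were not attained, then by [gdisp_min] and [gdisp_gt_nbhs] every point would have
    a neighbourhood on which all displacements exceed it by some [1 / (n + 1)]; compactness of the
    quotient makes [n] uniform, against the definition of the infimum. *)
Lemma systole : (exists2 g, g \in G & g != 1%g) ->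
  exists g z, [/\ g \in G, g != 1%g &
    forall h w, h \in G -> h != 1%g -> gdisp g z <= gdisp h w].
Proof.
move=> nontriv; apply: contrapT => nomin.
have [g1 g1G g11] := nontriv.
pose S := [set gdisp g z | g in [set g | g \in G /\ g != 1%g] & z in [set: uhp R]].
have z1 : uhp R by exists (0 +i* 1); rewrite /= ltr01.
have S0 : S !=set0 by exists (gdisp g1 z1); exists g1 => //; exists z1.
have Sl : lbound S 1 by move=> _ [g _ [z _ <-]]; exact: disp_ge1.
have iS g z : g \in G -> g != 1%g -> inf S <= gdisp g z.
  move=> gG g1'; apply: ge_inf; first by exists 1.
  by exists g => //; exists z.
have inf1 : 1 <= inf S by exact: lb_le_inf.
have ltinf z : exists2 t, inf S < t & forall g, g \in G -> g != 1%g -> t < gdisp g z.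
  have [g [gG g1' gP]] := gdisp_min z nontriv.
  have lt1 : inf S < gdisp g z.
    rewrite lt_neqAle iS// andbT; apply/eqP => E; apply: nomin.
    by exists g, z; split => // h w hG h1; rewrite -E; exact: iS.
  exists ((inf S + gdisp g z) / 2); first by rewrite midf_lt.
  by move=> h hG h1; apply: lt_le_trans (gP _ hG h1); rewrite midf_lt.
pose P (n : nat) (x : quot_uhp G) :=
  forall g, g \in G -> g != 1%g -> inf S + n.+1%:R^-1 < gdisp g (repr x).
have := (compact_near_coveringP _).1 cocompactG nat \oo P _.
case.
  move=> x _; have [t t0 tP] := ltinf (repr x).
  have [n nt] : exists n, inf S + n.+1%:R^-1 < t.
    have e0 : 0 < t - inf S by rewrite subr_gt0.
    exists (Num.truncn (t - inf S)^-1).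
    rewrite -ltrBrDl -[X in _ < X]invrK ltf_pV2 ?posrE ?invr_gt0//.
    exact: truncnS_gt.
  pose V := [set z | forall g, g \in G -> g != 1%g -> inf S + n.+1%:R^-1 < gdisp g z].
  exists ([set x' : quot_uhp G | V (repr x')], [set m | (n <= m)%N]).
    split; last by exists n.
    apply: quot_nbhs => /=.
    - rewrite openE => z Vz; apply: gdisp_gt_nbhs => //.
      by rewrite addr_gt0// (lt_le_trans _ inf1).
    - move=> z h hG Vz g gG g1'.
      rewrite -(gdisp_conj g h^-1%g) -actM mulVg act1.
      apply: Vz; last by rewrite conj_eq1.
      by rewrite !gpredM// ?invgK// gpredVr.
    - by move=> g gG g1'; apply: lt_trans nt _; exact: tP.
  move=> [x' m] /= [Vx' nm] g gG g1'; apply: le_lt_trans (Vx' g gG g1').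
  by rewrite lerD2l lef_pV2 ?posrE// ler_nat ltnS.
move=> n _ /(_ n (leqnn n)) nP.
have : inf S + n.+1%:R^-1 <= inf S.
  apply: lb_le_inf => // _ [g [gG g1'] [z _ <-]].
  have /eqmodP/asboolP[h hG zE] : \pi_(quot_uhp G) (repr (\pi_(quot_uhp G) z)) = \pi_(quot_uhp G) z.
    by rewrite reprK.
  rewrite zE -(gdisp_conj _ h^-1%g) -actM mulVg act1; apply/ltW/nP => //.
    by rewrite !gpredM// ?invgK// gpredVr.
  by rewrite conj_eq1.
by rewrite gerDl leNgt invr_gt0 ltr0n.
Qed.

Hypothesis no_ellipticG : forall g : PSL2 R, g \in G -> ~ elliptic g.

Lemma trace2_ge4 A : \pi_(PSL2 R) A \in G -> 4 <= trace2 A ^+ 2.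
Proof.
move=> AG; have /negP := no_ellipticG AG; rewrite -leNgt trace2E => tr2.
rewrite -(trace2_sign (repr_PSL2 A)) -[X in _ <= X]real_normK ?num_real//.
rewrite (_ : 4 = 2 ^+ 2); last by rewrite expr2; ring.
by rewrite ler_pXn2r// nnegrE.
Qed.

(** Freeness of the action; it is what makes distinct translates of a fundamental domain
    disjoint. *)
Lemma act_free g z : g \in G -> act g z = z -> g = 1%g.
Proof.
rewrite -[g]reprK => gG; rewrite act_pi => /(fixed_point_id (trace2_ge4 gG)) g1.
by apply/eqP/PSL2_eqP; case: g1 => ->; [left|right].
Qed.

Lemma axis_at_systole g z :
  g \in G -> (forall w, gdisp g z <= gdisp g w) -> axis_form (repr g) z = 0.
Proof.
move=> gG gmin; apply/eqP/negPn/negP => a0.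
have tr4 : 4 <= trace2 (repr g) ^+ 2 by apply: trace2_ge4; rewrite reprK.
have [w] := disp_decrease tr4 a0.
by rewrite ltNge; have := gmin w; rewrite /gdisp => ->.
Qed.

(** At a minimum the axis form vanishes; displacement one would leave [trace^2 = 4], hence the
    identity. *)
Lemma systole_gt1 g z : g \in G -> g != 1%g ->
  (forall w, gdisp g z <= gdisp g w) -> 1 < gdisp g z.
Proof.
move=> gG g1 gmin; rewrite lt_neqAle disp_ge1 andbT; apply/eqP => d1.
have a0 := axis_at_systole gG gmin.
have := disp_sqr (repr g) z; rewrite -[disp _ _]/(gdisp g z) -d1 a0 mul0r expr0n/= addr0.
rewrite expr1n mulr1 => /esym /(parabolic_axis_id a0) E.
move/eqP: g1; apply; rewrite -[g]reprK; apply/eqP/PSL2_eqP.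
by case: E => ->; [left|right].
Qed.

Lemma translation_disp (u : R) z : disp (translation u) z ^+ 2 = 1 + (u / imz z) ^+ 2 / 4.
Proof.
apply: (mulfI (_ : 4 != 0 :> R)); first by rewrite pnatr_eq0.
rewrite disp_sqr /trace2 /axis_form /= !mxE/= subrr !mul0r add0r subr0.
by field; rewrite gt_eqF// imz_gt0.
Qed.

(** A conjugated translation has displacements tending to 1 towards its cusp, whereas the minimal
    displacement of [G] is attained and exceeds 1. *)
Lemma no_cusp S : ~ to_cusp G S.
Proof.
move=> [u u0 uG].
set A := (S * translation u * S^-1)%g in uG.
have dA z : gdisp (\pi_(PSL2 R) A) (moebius S z) = disp (translation u) z.
  by rewrite gdisp_pi disp_conj.
have A1 : \pi_(PSL2 R) A != 1%g.
  apply/eqP => A1.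
  have z1 : uhp R by exists (0 +i* 1); rewrite /= ltr01.
  have := dA z1; rewrite A1 gdisp_pi => d1.
  have := translation_disp u z1; rewrite -d1.
  have -> : disp 1%g (moebius S z1) = 1.
    have v0 := imz_gt0 (moebius S z1).
    rewrite /disp ker1; case: (moebius S z1) v0 => -[x y] /= y0 v0; rewrite /imz/=.
    have y2 : 0 < 2 * y by rewrite mulr_gt0.
    rewrite (_ : (x - x) ^+ 2 + (y - - y) ^+ 2 = (2 * y) ^+ 2); last by ring.
    by rewrite sqrtr_sqr gtr0_norm// divff// gt_eqF.
  rewrite expr1n => /eqP; rewrite addrC -subr_eq subrr eq_sym.
  rewrite mulf_eq0 sqrf_eq0 mulf_eq0 (negbTE u0)/= invr_eq0 gt_eqF ?imz_gt0//=.
  by rewrite invr_eq0 pnatr_eq0.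
have [|g [z [gG g1 gmin]]] := systole; first by exists (\pi_(PSL2 R) A).
have lt1 := systole_gt1 gG g1 (fun w => gmin g w gG g1).
have e0 : 0 < gdisp g z ^+ 2 - 1 by rewrite subr_gt0 expr_gt1// ltW// (lt_trans ltr01).
(* At this height [|u / y|] is below both 1 and [gdisp g z ^+ 2 - 1], so [(u / y) ^+ 2 / 4] is below
   the latter too. *)
pose y := (`|u| + 1) / Num.min 1 (gdisp g z ^+ 2 - 1).
have m0 : 0 < Num.min 1 (gdisp g z ^+ 2 - 1) by rewrite lt_min ltr01.
have y0 : 0 < y by rewrite divr_gt0// ltr_wpDl.
pose w : uhp R := exist _ (0 +i* y) y0.
have := gmin _ (moebius S w) uG A1; rewrite dA leNgt => /negP; apply.
rewrite -(ltr_pXn2r (n := 2)) ?nnegrE ?disp_ge0// translation_disp /imz/=.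
rewrite -ltrBrDl; set m := Num.min _ _ in y y0 m0 w *.
have uy : `|u / y| < m.
  rewrite normrM normfV (gtr0_norm y0) /y invf_div mulrCA gtr_pMr//.
  by rewrite ltr_pdivrMr ?mul1r ?ltrDl// ltr_wpDl.
have m1 : m <= 1 by rewrite ge_min lexx.
apply: (@lt_le_trans _ _ m); last by rewrite ge_min lexx orbT.
rewrite -real_normK ?num_real// ltr_pdivrMr//.
apply: (@le_lt_trans _ _ (`|u / y|)).
  by rewrite expr2 ler_piMl// (le_trans (ltW uy) m1).
by rewrite (lt_trans uy)// ltr_pMr// ltr1n.
Qed.

End Systole.

(** * Integration of complex-valued functions *)

Section ComplexMeasurable.
Context d (T : measurableType d) (R : realType).
Local Notation normc := Normc.normc.
Implicit Types f g : T -> R[i].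

Definition cmeasurable f :=
  measurable_fun setT (fun x => complex.Re (f x)) /\
  measurable_fun setT (fun x => complex.Im (f x)).

Lemma eq_cmeasurable f g : f =1 g -> cmeasurable f -> cmeasurable g.
Proof. by move=> /funext ->. Qed.

Lemma cmeasurable_cst (c : R[i]) : cmeasurable (fun=> c).
Proof. by split; exact: measurable_cst. Qed.

Lemma cmeasurable_pair (f1 f2 : T -> R) : measurable_fun setT f1 ->
  measurable_fun setT f2 -> cmeasurable (fun x => f1 x +i* f2 x).
Proof. by []. Qed.

Lemma cmeasurable_real (h : T -> R) : measurable_fun setT h ->
  cmeasurable (fun x => (h x)%:C).
Proof. by move=> mh; split => //; exact: measurable_cst. Qed.

Lemma cmeasurableD f g : cmeasurable f -> cmeasurable g ->
  cmeasurable (fun x => f x + g x).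
Proof.
move=> [f1 f2] [g1 g2]; split.
  apply: (eq_measurable_fun (fun x => complex.Re (f x) + complex.Re (g x))).
    by move=> x _; case: (f x) => ? ?; case: (g x).
  exact: measurable_funD.
apply: (eq_measurable_fun (fun x => complex.Im (f x) + complex.Im (g x))).
  by move=> x _; case: (f x) => ? ?; case: (g x).
exact: measurable_funD.
Qed.

Lemma cmeasurableM f g : cmeasurable f -> cmeasurable g ->
  cmeasurable (fun x => f x * g x).
Proof.
move=> [f1 f2] [g1 g2]; split.
  apply: (eq_measurable_fun (fun x => complex.Re (f x) * complex.Re (g x) -
      complex.Im (f x) * complex.Im (g x))).
    by move=> x _; case: (f x) => ? ?; case: (g x).
  by apply: measurable_funB; exact: measurable_funM.
apply: (eq_measurable_fun (fun x => complex.Re (f x) * complex.Im (g x) +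
    complex.Im (f x) * complex.Re (g x))).
  by move=> x _; case: (f x) => ? ?; case: (g x).
by apply: measurable_funD; exact: measurable_funM.
Qed.

Lemma cmeasurableX f n : cmeasurable f -> cmeasurable (fun x => f x ^+ n).
Proof.
move=> mf; elim: n => [|n IH]; first exact: cmeasurable_cst.
apply: (eq_cmeasurable (fun x => esym (exprS (f x) n))).
exact: cmeasurableM.
Qed.

Lemma cmeasurableV f : cmeasurable f -> cmeasurable (fun x => (f x)^-1).
Proof.
move=> [f1 f2].
have mn : measurable_fun setT
    (fun x => (complex.Re (f x) ^+ 2 + complex.Im (f x) ^+ 2)^-1).
  by apply: measurable_funV; apply: measurable_funD; exact: measurable_funX.
split.
  apply: (eq_measurable_fun (fun x => complex.Re (f x) *
      (complex.Re (f x) ^+ 2 + complex.Im (f x) ^+ 2)^-1)).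
    by move=> x _; case: (f x) => ? ?.
  exact: measurable_funM.
apply: (eq_measurable_fun (fun x => - (complex.Im (f x) *
    (complex.Re (f x) ^+ 2 + complex.Im (f x) ^+ 2)^-1))).
  by move=> x _; case: (f x) => ? ?.
by apply: measurable_funN; exact: measurable_funM.
Qed.

Lemma cmeasurable_conj f : cmeasurable f -> cmeasurable (fun x => conjc (f x)).
Proof.
move=> [f1 f2]; split.
  by apply: eq_measurable_fun f1 => x _; case: (f x).
apply: (eq_measurable_fun (fun x => - complex.Im (f x))).
  by move=> x _; case: (f x).
exact: measurable_funN.
Qed.

Lemma measurable_normc f : cmeasurable f -> measurable_fun setT (fun x => normc (f x)).
Proof.
move=> [f1 f2].
apply: (eq_measurable_fun (fun x => Num.sqrt (complex.Re (f x) ^+ 2 + complex.Im (f x) ^+ 2))).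
  by move=> x _; case: (f x).
apply: (measurableT_comp (f := @Num.sqrt R)).
  by apply: continuous_measurable_fun => ?; exact: sqrt_continuous.
by apply: measurable_funD; exact: measurable_funX.
Qed.

Lemma cmeasurable_if (b : T -> bool) f g : measurable_fun setT b ->
  cmeasurable f -> cmeasurable g ->
  cmeasurable (fun x => if b x then f x else g x).
Proof.
move=> mb [f1 f2] [g1 g2]; split.
  apply: (eq_measurable_fun (fun x => if b x then complex.Re (f x) else complex.Re (g x))).
    by move=> x _; case: (b x).
  exact: measurable_fun_ifT.
apply: (eq_measurable_fun (fun x => if b x then complex.Im (f x) else complex.Im (g x))).
  by move=> x _; case: (b x).
exact: measurable_fun_ifT.
Qed.

End ComplexMeasurable.

Section ComplexIntegral.
Context d (T : measurableType d) (R : realType).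
Variable mu : {measure set T -> \bar R}.
Local Notation normc := Normc.normc.
Implicit Types f g : T -> R[i].

Definition cintegrable f :=
  mu.-integrable setT (fun x => (complex.Re (f x))%:E) /\
  mu.-integrable setT (fun x => (complex.Im (f x))%:E).

Definition cint f : R[i] :=
  (\int[mu]_x complex.Re (f x)) +i* (\int[mu]_x complex.Im (f x)).

Lemma eq_cint f g : f =1 g -> cint f = cint g.
Proof. by move=> /funext ->. Qed.

Lemma cintegrable_cmeasurable f : cintegrable f -> cmeasurable f.
Proof.
move=> [/integrableP[f1 _] /integrableP[f2 _]]; split.
  exact/measurable_EFinP.
exact/measurable_EFinP.
Qed.

Lemma le_cintegrable f (g : T -> R) : cmeasurable f ->
  mu.-integrable setT (fun x => (g x)%:E) -> (forall x, normc (f x) <= g x) ->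
  cintegrable f.
Proof.
move=> [f1 f2] ig fg; split.
  apply: le_integrable ig => //; first exact/measurable_EFinP.
  move=> x _; rewrite lee_fin; apply: le_trans (normc_ge_absRe _) _.
  by apply: le_trans (fg x) (ler_norm _).
apply: le_integrable ig => //; first exact/measurable_EFinP.
move=> x _; rewrite lee_fin; apply: le_trans (normc_ge_absIm _) _.
by apply: le_trans (fg x) (ler_norm _).
Qed.

Lemma normc_le_absD (z : R[i]) : normc z <= `|complex.Re z| + `|complex.Im z|.
Proof.
rewrite -(ler_pXn2r (n := 2)) ?nnegrE ?normc_ge0 ?addr_ge0//.
rewrite normc_sqr sqrrD !real_normK ?num_real// addrAC lerDl.
by rewrite mulrn_wge0// mulr_ge0.
Qed.

Lemma integrable_normc f : cintegrable f ->
  mu.-integrable setT (fun x => (normc (f x))%:E).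
Proof.
move=> If; have [f1 f2] := If.
apply: (@le_integrable _ _ _ _ _ _ _
  (fun x => (`|(complex.Re (f x))%:E| + `|(complex.Im (f x))%:E|)%E)) => //.
- by apply/measurable_EFinP; apply: measurable_normc; exact: cintegrable_cmeasurable.
- move=> x _; rewrite -EFinD lee_fin ger0_norm ?normc_ge0//.
  by apply: le_trans (normc_le_absD _) _; rewrite ler_norm.
- by apply: integrableD => //; apply: integrable_abse.
Qed.

Lemma cintegrable_normcP f : cmeasurable f ->
  mu.-integrable setT (fun x => (normc (f x))%:E) -> cintegrable f.
Proof. by move=> mf If; apply: le_cintegrable If _. Qed.

Lemma cintegrableD f g : cintegrable f -> cintegrable g ->
  cintegrable (fun x => f x + g x).
Proof.
move=> [f1 f2] [g1 g2]; split.
  apply: (eq_integrable measurableT (fun x => (complex.Re (f x))%:E + (complex.Re (g x))%:E)%E).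
    by move=> x _; case: (f x) => ? ?; case: (g x).
  exact: integrableD.
apply: (eq_integrable measurableT (fun x => (complex.Im (f x))%:E + (complex.Im (g x))%:E)%E).
  by move=> x _; case: (f x) => ? ?; case: (g x).
exact: integrableD.
Qed.

Lemma cintD f g : cintegrable f -> cintegrable g ->
  cint (fun x => f x + g x) = cint f + cint g.
Proof.
move=> [f1 f2] [g1 g2]; rewrite /cint.
have -> : (fun x => complex.Re (f x + g x)) = (fun x => complex.Re (f x) + complex.Re (g x)).
  by apply/funext => x; case: (f x) => ? ?; case: (g x).
have -> : (fun x => complex.Im (f x + g x)) = (fun x => complex.Im (f x) + complex.Im (g x)).
  by apply/funext => x; case: (f x) => ? ?; case: (g x).
by rewrite !RintegralD.
Qed.

Lemma cintegrableZ c f : cintegrable f -> cintegrable (fun x => c * f x).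
Proof.
move=> If; have := integrable_normc If => /(@integrableZl _ _ _ _ _ measurableT (normc c)) Ig.
apply: (@le_cintegrable _ (fun x => normc c * normc (f x))) => //.
  apply: cmeasurableM; first exact: cmeasurable_cst.
  exact: cintegrable_cmeasurable.
by move=> x; rewrite Normc.normcM.
Qed.

Lemma cintZ c f : cintegrable f -> cint (fun x => c * f x) = c * cint f.
Proof.
move=> [f1 f2]; rewrite /cint; case: c => a b.
have -> : (fun x => complex.Re ((a +i* b) * f x)) =
    (fun x => a * complex.Re (f x) - b * complex.Im (f x)).
  by apply/funext => x; case: (f x) => ? ?.
have -> : (fun x => complex.Im ((a +i* b) * f x)) =
    (fun x => a * complex.Im (f x) + b * complex.Re (f x)).
  by apply/funext => x; case: (f x) => ? ? /=.
have Z (r : R) (h : T -> R) : mu.-integrable setT (fun x => (h x)%:E) ->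
    mu.-integrable setT (fun x => (r * h x)%:E).
  by move=> /(@integrableZl _ _ _ _ _ measurableT r).
rewrite RintegralB ?RintegralD//; try exact: Z.
by rewrite !RintegralZl.
Qed.

Lemma Re_cint f : complex.Re (cint f) = \int[mu]_x complex.Re (f x).
Proof. by []. Qed.

(** Real and imaginary part are bounded separately, whence the factor 2. *)
Lemma normc_cint_le f : cintegrable f ->
  normc (cint f) <= 2 * \int[mu]_x normc (f x).
Proof.
move=> If; have [f1 f2] := If; apply: le_trans (normc_le_absD _) _ => /=.
have In := integrable_normc If.
have bound (h : T -> R) : mu.-integrable setT (fun x => (h x)%:E) ->
    (forall x, `|h x| <= normc (f x)) ->
    `|\int[mu]_x h x| <= \int[mu]_x normc (f x).
  move=> Ih hf; apply: le_trans (le_normr_Rintegral measurableT Ih) _.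
  by apply: le_Rintegral => //; exact: integrable_norm.
rewrite mulr_natl mulr2n; apply: lerD; apply: bound => // x.
  exact: normc_ge_absRe.
exact: normc_ge_absIm.
Qed.

End ComplexIntegral.

(** * Fubini for complex-valued functions *)

Section ComplexFubini.
Context d1 d2 (T1 : measurableType d1) (T2 : measurableType d2) (R : realType).
Variables (m1 : {sigma_finite_measure set T1 -> \bar R}).
Variables (m2 : {sigma_finite_measure set T2 -> \bar R}).

(* [fine] changes the inner integral only where the section is not integrable,
   which is a null set. *)
Lemma Rintegral_fubini (f : T1 * T2 -> R) :
  (m1 \x m2)%E.-integrable setT (fun p => (f p)%:E) ->
  \int[m1]_x \int[m2]_y f (x, y) = \int[m2]_y \int[m1]_x f (x, y).
Proof.
move=> If; rewrite /Rintegral; congr fine.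
transitivity (\int[m1]_x \int[m2]_y (f (x, y))%:E)%E.
  apply: ae_eq_integral => //.
  - apply/measurable_EFinP; apply: (measurableT_comp (f := fine)) => //.
    exact: measurable_fubini_F If.
  - exact: measurable_fubini_F If.
  - have := ae_integrable1 If; apply: filterS => x /= Ix _.
    by rewrite fineK//; exact: integrable_fin_num.
rewrite (Fubini If); apply: ae_eq_integral => //.
- exact: measurable_fubini_G If.
- apply/measurable_EFinP; apply: (measurableT_comp (f := fine)) => //.
  exact: measurable_fubini_G If.
- have := ae_integrable2 If; apply: filterS => y /= Iy _.
  by rewrite fineK//; exact: integrable_fin_num.
Qed.

Lemma cint_fubini (f : T1 * T2 -> R[i]) : cintegrable (m1 \x m2)%E f ->
  cint m1 (fun x => cint m2 (fun y => f (x, y))) =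
  cint m2 (fun y => cint m1 (fun x => f (x, y))).
Proof.
move=> [f1 f2]; rewrite /cint/=.
by rewrite (Rintegral_fubini f1) (Rintegral_fubini f2).
Qed.

Lemma integrable_prod_lty (f : T1 * T2 -> R) : measurable_fun setT f ->
  (\int[m1]_x \int[m2]_y (`|f (x, y)|)%:E < +oo)%E ->
  (m1 \x m2)%E.-integrable setT (fun p => (f p)%:E).
Proof.
move=> mf fy; apply/integrable12ltyP; first exact/measurable_EFinP.
exact: fy.
Qed.

End ComplexFubini.

(** * Complex-valued functions of a real variable *)

Section ComplexDerivative.
Variable R : realType.
Local Notation normc := Normc.normc.
Implicit Types (F G : R -> R[i]) (x : R) (l m : R[i]).

Lemma ReD (z w : R[i]) : complex.Re (z + w) = complex.Re z + complex.Re w.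
Proof. by case: z => ? ?; case: w. Qed.

Lemma ImD (z w : R[i]) : complex.Im (z + w) = complex.Im z + complex.Im w.
Proof. by case: z => ? ?; case: w. Qed.

Lemma ReM (z w : R[i]) : complex.Re (z * w) =
  complex.Re z * complex.Re w - complex.Im z * complex.Im w.
Proof. by case: z => ? ?; case: w. Qed.

Lemma ImM (z w : R[i]) : complex.Im (z * w) =
  complex.Re z * complex.Im w + complex.Im z * complex.Re w.
Proof. by case: z => ? ?; case: w. Qed.

Lemma ReV (z : R[i]) : complex.Re z^-1 =
  complex.Re z * (complex.Re z ^+ 2 + complex.Im z ^+ 2)^-1.
Proof. by case: z. Qed.

Lemma ImV (z : R[i]) : complex.Im z^-1 =
  - (complex.Im z * (complex.Re z ^+ 2 + complex.Im z ^+ 2)^-1).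
Proof. by case: z. Qed.

Definition is_cderive F x l :=
  is_derive x (1 : R) (fun t => complex.Re (F t)) (complex.Re l) /\
  is_derive x (1 : R) (fun t => complex.Im (F t)) (complex.Im l).

Lemma is_cderive_eq F x l m : is_cderive F x l -> l = m -> is_cderive F x m.
Proof. by move=> + <-. Qed.

Lemma eq_is_cderive F G x l : F =1 G -> is_cderive F x l -> is_cderive G x l.
Proof. by move=> /funext ->. Qed.

Lemma is_cderive_cst (c : R[i]) x : is_cderive (fun=> c) x 0.
Proof. by split; exact: is_derive_cst. Qed.

Lemma is_cderiveD F G x l m : is_cderive F x l -> is_cderive G x m ->
  is_cderive (fun t => F t + G t) x (l + m).
Proof.
case: l m => a b [a' b'] [F1 F2] [G1 G2]; split.
  rewrite (_ : (fun t => _) = (fun t => complex.Re (F t)) + (fun t => complex.Re (G t))).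
    exact: is_deriveD.
  by apply/funext => t; exact: ReD.
rewrite (_ : (fun t => _) = (fun t => complex.Im (F t)) + (fun t => complex.Im (G t))).
  exact: is_deriveD.
by apply/funext => t; exact: ImD.
Qed.

Lemma is_cderiveM F G x l m : is_cderive F x l -> is_cderive G x m ->
  is_cderive (fun t => F t * G t) x (F x * m + l * G x).
Proof.
case: l m => a b [a' b'] [F1 F2] [G1 G2]; split.
  rewrite (_ : (fun t => _) = (fun t => complex.Re (F t)) * (fun t => complex.Re (G t))
      - (fun t => complex.Im (F t)) * (fun t => complex.Im (G t))).
    apply: (is_derive_eq (is_deriveB (is_deriveM F1 G1) (is_deriveM F2 G2))).
    by rewrite /GRing.scale/=; case: (F x) => ? ?; case: (G x) => ? ? /=; ring.
  by apply/funext => t; exact: ReM.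
rewrite (_ : (fun t => _) = (fun t => complex.Re (F t)) * (fun t => complex.Im (G t))
    + (fun t => complex.Im (F t)) * (fun t => complex.Re (G t))).
  apply: (is_derive_eq (is_deriveD (is_deriveM F1 G2) (is_deriveM F2 G1))).
  by rewrite /GRing.scale/=; case: (F x) => ? ?; case: (G x) => ? ? /=; ring.
by apply/funext => t; exact: ImM.
Qed.

Lemma is_cderiveX F n x l : is_cderive F x l ->
  is_cderive (fun t => F t ^+ n) x (n%:R * F x ^+ n.-1 * l).
Proof.
move=> Fl; elim: n => [|n IH].
  by apply: is_cderive_eq (is_cderive_cst _ _) _; rewrite !mul0r.
apply: (eq_is_cderive (fun t => esym (exprS (F t) n))).
apply: is_cderive_eq (is_cderiveM Fl IH) _ => /=.
case: n {IH} => [|n] /=; first by rewrite expr0; ring.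
by rewrite exprS -[n.+2%:R]natr1; ring.
Qed.

Lemma is_cderiveV F x l : F x != 0 -> is_cderive F x l ->
  is_cderive (fun t => (F t)^-1) x (- (F x) ^- 2 * l).
Proof.
case: l => a b F0 [F1 F2].
pose N t := complex.Re (F t) ^+ 2 + complex.Im (F t) ^+ 2.
have N0 : N x != 0.
  by rewrite /N -normc_sqr expf_neq0// normc_eq0.
have NE : N = (fun t => complex.Re (F t)) * (fun t => complex.Re (F t)) +
    (fun t => complex.Im (F t)) * (fun t => complex.Im (F t)).
  by apply/funext => t; rewrite /N !expr2.
have dN : is_derive x (1 : R) N (2 * (complex.Re (F x) * a + complex.Im (F x) * b)).
  rewrite NE; apply: (is_derive_eq (is_deriveD (is_deriveM F1 F1) (is_deriveM F2 F2))).
  by rewrite /GRing.scale/=; ring.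
have dV := is_deriveV N0 dN.
have V2 : (F x) ^- 2 = ((complex.Re (F x) ^+ 2 - complex.Im (F x) ^+ 2) / N x ^+ 2) +i*
   (- (2 * complex.Re (F x) * complex.Im (F x)) / N x ^+ 2).
  apply: (mulfI (_ : F x ^+ 2 != 0)); first by rewrite expf_neq0.
  rewrite divff ?expf_neq0//; move: N0; rewrite /N; case: (F x) => u v /= N0.
  by apply/eqP; rewrite eq_complex/=; apply/andP; split; apply/eqP; field.
rewrite V2; split.
  rewrite (_ : (fun t => _) = (fun t => complex.Re (F t)) * (fun t => (N t)^-1)).
    apply: (is_derive_eq (is_deriveM F1 dV)); rewrite /GRing.scale/=.
    by move: N0; rewrite /N; case: (F x) => u v /= N0; field.
  by apply/funext => t; exact: ReV.
rewrite (_ : (fun t => _) = - ((fun t => complex.Im (F t)) * (fun t => (N t)^-1))).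
  apply: (is_derive_eq (is_deriveN (is_deriveM F2 dV))); rewrite /GRing.scale/=.
  by move: N0; rewrite /N; case: (F x) => u v /= N0; field.
by apply/funext => t; exact: ImV.
Qed.

Lemma is_cderive_affine (c e : R[i]) x : is_cderive (fun t : R => c * t%:C + e) x c.
Proof.
case: c e => a b [a' b']; split.
  rewrite (_ : (fun t => _) = a *: id + cst a').
    by apply: is_derive_eq; rewrite /GRing.scale/= addr0 mulr1.
  by apply/funext => t /=; rewrite /GRing.scale/= mulr0 subr0.
rewrite (_ : (fun t => _) = b *: id + cst b').
  by apply: is_derive_eq; rewrite /GRing.scale/= addr0 mulr1.
by apply/funext => t /=; rewrite /GRing.scale/= mulr0 add0r.
Qed.

Lemma is_cderive_continuous F x l : is_cderive F x l ->
  {for x, continuous (fun t => complex.Re (F t))} /\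
  {for x, continuous (fun t => complex.Im (F t))}.
Proof.
move=> [[F1 _] [F2 _]]; split.
  exact: (differentiable_continuous ((derivable1_diffP _ _).1 F1)).
exact: (differentiable_continuous ((derivable1_diffP _ _).1 F2)).
Qed.

End ComplexDerivative.

(** * Improper integrals from primitives *)

Section FundamentalTheorem.
Variable R : realType.
Local Notation mu := (@lebesgue_measure R).
Local Notation normc := Normc.normc.

(** The fundamental theorem applies on each [[u n, v n]], and dominated convergence with majorant
    [|f|] passes to [D]. Exhaustions cover the line and the open half-line alike. *)
Lemma Rintegral_FTC_exhaust (D : set R) (f F : R -> R) (u v : nat -> R) (l : R) :
  measurable D -> mu.-integrable setT (fun x => ((f \_ D) x)%:E) ->
  (forall n, u n < v n) -> (forall n x, x \in `[u n, v n] -> D x) ->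
  (forall x, D x -> \forall n \near \oo, x \in `[u n, v n]) ->
  (forall x, D x -> is_derive x (1 : R) F (f x)) ->
  (forall x, D x -> {for x, continuous f}) ->
  (fun n => F (v n) - F (u n)) @ \oo --> l ->
  \int[mu]_x (f \_ D) x = l.
Proof.
move=> mD If uv uvD Duv dF cf Fl.
have fin n : (\int[mu]_x (((f \_ D) \_ `[u n, v n]) x)%:E = (F (v n) - F (u n))%:E)%E.
  transitivity (\int[mu]_(x in `[u n, v n]) ((f \_ D) x)%:E)%E.
    rewrite [RHS]integral_mkcond; apply: eq_integral => x _.
    by rewrite [in RHS]patchE [in LHS]patchE; case: ifPn.
  transitivity (\int[mu]_(x in `[u n, v n]) (f x)%:E)%E.
    by apply: eq_integral => x; rewrite inE => /uvD Dx; rewrite patchE mem_set.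
  rewrite (@continuous_FTC2 _ _ F)//.
  - apply: continuous_in_subspaceT => x /[!inE] xuv; exact/cf/(uvD n).
  - have cF x : x \in `[u n, v n] -> {for x, continuous F}.
      move=> /uvD Dx; apply: differentiable_continuous; apply/derivable1_diffP.
      exact: (@ex_derive _ _ _ _ _ _ _ (dF _ Dx)).
    split.
    + move=> x /subset_itv_oo_cc /uvD Dx; exact: (@ex_derive _ _ _ _ _ _ _ (dF _ Dx)).
    + by apply: cvg_at_right_filter; apply: cF; rewrite in_itv/= lexx/= ltW.
    + by apply: cvg_at_left_filter; apply: cF; rewrite in_itv/= lexx/= ltW.
  - move=> x /subset_itv_oo_cc /uvD Dx; rewrite derive1E.
    exact: (@derive_val _ _ _ _ _ _ _ (dF _ Dx)).
have mfD : measurable_fun setT (f \_ D).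
  by have /integrableP[/measurable_EFinP] := If.
have [] := @dominated_convergence _ _ _ mu setT measurableT
  (fun n x => ((f \_ D \_ `[u n, v n]) x)%:E) (fun x => ((f \_ D) x)%:E)
  (fun x => `|((f \_ D) x)%:E|%E).
- move=> n; apply/measurable_EFinP; apply/measurable_restrict => //.
  exact: measurable_funTS.
- exact/measurable_EFinP.
- apply: aeW => x _; apply: cvg_near_cst.
  have [Dx|Dx] := pselect (D x).
    by have := Duv x Dx; apply: filterS => n xn; rewrite [in LHS]patchE mem_setE xn.
  apply: nearW => n; congr EFin; rewrite [LHS]patchE; case: ifPn => // _.
  by rewrite patchE memNset.
- exact: integrable_abse.
- apply: aeW => x n _; rewrite lee_fin [in X in X <= _]patchE.
  by case: ifPn => // _; rewrite normr0.
move=> _ _ cvg.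
have : (fun n => (F (v n) - F (u n))%:E) @ \oo --> (\int[mu]_x ((f \_ D) x)%:E)%E.
  by under eq_fun do rewrite -fin.
have : (fun n => (F (v n) - F (u n))%:E) @ \oo --> l%:E.
  by apply: cvg_EFin => //; exact: nearW.
move=> /cvg_unique H1 /H1 E; by rewrite /Rintegral -E.
Qed.

Lemma cint_FTC_exhaust (D : set R) (f F : R -> R[i]) (u v : nat -> R) (l : R[i]) :
  measurable D ->
  cintegrable mu (fun x => if x \in D then f x else 0) ->
  (forall n, u n < v n) -> (forall n x, x \in `[u n, v n] -> D x) ->
  (forall x, D x -> \forall n \near \oo, x \in `[u n, v n]) ->
  (forall x, D x -> is_cderive F x (f x)) ->
  (forall x, D x -> exists m, is_cderive f x m) ->
  (fun n => complex.Re (F (v n) - F (u n))) @ \oo --> complex.Re l ->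
  (fun n => complex.Im (F (v n) - F (u n))) @ \oo --> complex.Im l ->
  cint mu (fun x => if x \in D then f x else 0) = l.
Proof.
move=> mD [If1 If2] uv uvD Duv dF df cre cim.
have ReE : (fun x => complex.Re (if x \in D then f x else 0)) = (fun x => complex.Re (f x)) \_ D.
  by apply/funext => x; rewrite patchE; case: ifPn.
have ImE : (fun x => complex.Im (if x \in D then f x else 0)) = (fun x => complex.Im (f x)) \_ D.
  by apply/funext => x; rewrite patchE; case: ifPn.
rewrite /cint ReE ImE [RHS](_ : l = complex.Re l +i* complex.Im l); last by case: (l).
congr (_ +i* _).
- apply: (@Rintegral_FTC_exhaust D _ (fun x => complex.Re (F x)) u v) => //.
  + by rewrite -ReE.
  + by move=> x /dF[].
  + by move=> x /df[m /is_cderive_continuous[]].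
  + by move: cre; apply: cvg_trans; apply: near_eq_cvg; near=> n; case: (F (v n)) => ? ?; case: (F (u n)).
- apply: (@Rintegral_FTC_exhaust D _ (fun x => complex.Im (F x)) u v) => //.
  + by rewrite -ImE.
  + by move=> x /dF[].
  + by move=> x /df[m /is_cderive_continuous[]].
  + by move: cim; apply: cvg_trans; apply: near_eq_cvg; near=> n; case: (F (v n)) => ? ?; case: (F (u n)).
Unshelve. all: by end_near. Qed.

End FundamentalTheorem.

(** * Explicit integrals over the line, the half-line and the half-plane *)

Section LineIntegrals.
Variable R : realType.
Local Notation mu := (@lebesgue_measure R).
Local Notation T1 := (measurableTypeR R).
Local Notation normc := Normc.normc.
Implicit Types (a b : R[i]) (x : R).

Lemma integrable_oneDsqrV : mu.-integrable setT (fun x : T1 => ((1 + x ^+ 2)^-1)%:E).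
Proof.
have mf : measurable_fun setT (fun x : T1 => (1 + x ^+ 2)^-1 : R).
  by apply: measurable_funV; apply: measurable_funD => //; exact: measurable_funX.
have f0 (x : T1) : 0 <= (1 + x ^+ 2)^-1 :> R by rewrite invr_ge0 addr_ge0 ?sqr_ge0.
apply/integrableP; split; first exact/measurable_EFinP.
under eq_integral do rewrite /= ger0_norm//.
have -> : [set: T1] = `[0, +oo[%classic `|` `]-oo, 0[%classic.
  apply/seteqP; split=> // x _ /=; rewrite !in_itv/= andbT.
  by have [|] := leP 0 x; [left|right].
rewrite ge0_integral_setU//=.
- rewrite lte_add_pinfty//.
    by have := @integral0y_oneDsqr R; rewrite /oneDsqr => ->; rewrite ltry.
  apply: (@le_lt_trans _ _ (\int[mu]_(x in `]-oo, 0%R]) ((1 + x ^+ 2)^-1)%:E)%E).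
    apply: ge0_subset_integral => //; first exact/measurable_EFinP/measurable_funTS.
      by move=> x _; rewrite lee_fin.
    by apply: subset_itvl; rewrite bnd_simp.
  rewrite (_ : (\int[mu]_(x in _) _)%E =
    (\int[mu]_(x in `]-oo, 0%R]) ((1 + (- x) ^+ 2)^-1)%:E)%E); last first.
    by apply: eq_integral => x _; rewrite sqrrN.
  rewrite -(@ge0_integration_by_substitution0 R (fun x => ((1 + x ^+ 2)^-1)%:E))//.
    by have := @integral0y_oneDsqr R; rewrite /oneDsqr => ->; rewrite ltry.
  exact/measurable_EFinP.
- exact/measurable_EFinP/measurable_funTS.
- by move=> x _; rewrite lee_fin.
- by apply/disj_setPS => x /=; rewrite !in_itv/= andbT leNgt => -[/negbTE ->].
Qed.

Lemma cvg0_ReIm (c : nat -> R[i]) (C : R) : (forall n, normc (c n) <= C / n.+1%:R) ->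
  (fun n => complex.Re (c n)) @ \oo --> (0 : R) /\
  (fun n => complex.Im (c n)) @ \oo --> (0 : R).
Proof.
move=> cC.
have C0 : (fun n => C / n.+1%:R) @ \oo --> (0 : R).
  by rewrite -(mulr0 C); apply: cvgMr; exact: cvg_harmonic.
split; apply/norm_cvg0P; apply: (squeeze_cvgr _ (cvg_cst 0) C0); apply: nearW => n.
  by rewrite normr_ge0 (le_trans (normc_ge_absRe _)).
by rewrite normr_ge0 (le_trans (normc_ge_absIm _)).
Qed.

Definition recip a x : R[i] := (x%:C + a)^-1.

Lemma shift_neq0 a x : complex.Im a != 0 -> x%:C + a != 0.
Proof.
case: a => u v /= v0; rewrite eq_complex /= add0r; apply/negP => /andP[_].
by rewrite (negbTE v0).
Qed.

Lemma is_cderive_recip a x : complex.Im a != 0 ->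
  is_cderive (recip a) x (- recip a x ^+ 2).
Proof.
move=> a0; have n0 := shift_neq0 x a0.
have H := is_cderive_affine 1 a x.
have H' : is_cderive (fun t : R => t%:C + a) x 1.
  by apply: eq_is_cderive H => t; rewrite mul1r.
by apply: is_cderive_eq (is_cderiveV n0 H') _; rewrite mulr1 -exprVn.
Qed.

Lemma recip_bound a : complex.Im a != 0 ->
  exists2 K : R, 1 <= K & forall x, normc (recip a x) ^+ 2 <= K / (1 + x ^+ 2).
Proof.
case: a => u v; rewrite [complex.Im _]/= => v0.
have v2 : 0 < v ^+ 2 by rewrite exprn_even_gt0.
have q0 : 0 <= (1 + 2 * u ^+ 2) / v ^+ 2.
  by rewrite divr_ge0 ?sqr_ge0// addr_ge0// mulr_ge0// sqr_ge0.
(* With this constant [K], the difference of [K * ((x + u) ^+ 2 + v ^+ 2)] and [1 + x ^+ 2] is a sum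
   of nonnegative terms, displayed below. *)
exists (2 + (1 + 2 * u ^+ 2) / v ^+ 2); first by lra.
move=> x; rewrite /recip Normc.normcV exprVn normc_sqr /= add0r.
have n0 : 0 < (x + u) ^+ 2 + v ^+ 2 by rewrite ltr_wpDl ?sqr_ge0.
have x0 : 0 < 1 + x ^+ 2 by rewrite ltr_wpDr ?sqr_ge0.
rewrite -[X in X <= _]mul1r ler_pdivrMr// mulrAC ler_pdivlMr// mul1r.
have -> : (2 + (1 + 2 * u ^+ 2) / v ^+ 2) * ((x + u) ^+ 2 + v ^+ 2) =
   (1 + x ^+ 2) + ((x + 2 * u) ^+ 2 + 2 * v ^+ 2 + (1 + 2 * u ^+ 2) / v ^+ 2 * (x + u) ^+ 2).
  by field.
have s1 := sqr_ge0 (x + 2 * u); have s2 := sqr_ge0 (x + u).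
by rewrite lerDl addr_ge0// ?addr_ge0// mulr_ge0// ltW.
Qed.

Definition recip2 a b m q x : R[i] := recip a x ^+ m * recip b x ^+ q.

Lemma cmeasurable_recip a : cmeasurable (fun x : T1 => recip a x).
Proof.
apply: cmeasurableV; apply: cmeasurableD; last exact: cmeasurable_cst.
exact: cmeasurable_real.
Qed.

Lemma cmeasurable_recip2 a b m q : cmeasurable (fun x : T1 => recip2 a b m q x).
Proof. by apply: cmeasurableM; apply: cmeasurableX; exact: cmeasurable_recip. Qed.

(** The first rate serves integrability, the second, weaker one the boundary terms at infinity. *)
Lemma recip2_bound a b m q : complex.Im a != 0 -> complex.Im b != 0 ->
  exists2 K : R, 0 <= K & forall x,
    ((2 <= m + q)%N -> normc (recip2 a b m q x) <= K / (1 + x ^+ 2)) /\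
    ((1 <= m + q)%N -> normc (recip2 a b m q x) <= K * Num.sqrt (1 + x ^+ 2)^-1).
Proof.
move=> /recip_bound[K K1 Ka] /recip_bound[L L1 Lb].
pose M := Num.max K L.
have M1 : 1 <= M by rewrite le_max K1.
have M0 : 0 <= M by exact: le_trans M1.
exists (M ^+ (m + q)); first by rewrite exprn_ge0.
move=> x; pose w := (1 + x ^+ 2)^-1.
have x1 : 1 <= 1 + x ^+ 2 by rewrite lerDl sqr_ge0.
have w0 : 0 <= w by rewrite invr_ge0 (le_trans _ x1).
have w1 : w <= 1 by rewrite invf_le1// (lt_le_trans _ x1).
pose rho := Num.sqrt w.
have rho0 : 0 <= rho by exact: sqrtr_ge0.
have rho1 : rho <= 1 by rewrite -sqrtr1; exact: ler_wsqrtr.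
have rb (c : R[i]) (N : R) : N <= M -> normc c ^+ 2 <= N * w -> normc c <= M * rho.
  move=> NM cN; rewrite -(ler_pXn2r (n := 2)) ?nnegrE ?normc_ge0 ?mulr_ge0//.
  rewrite exprMn sqr_sqrtr//; apply: le_trans cN _; rewrite ler_wpM2r//.
  by apply: le_trans NM _; rewrite expr2 ler_peMl.
have ar : normc (recip a x) <= M * rho by apply: (rb _ K) (Ka x); rewrite le_max lexx.
have br : normc (recip b x) <= M * rho by apply: (rb _ L) (Lb x); rewrite le_max lexx orbT.
have H : normc (recip2 a b m q x) <= M ^+ (m + q) * rho ^+ (m + q).
  rewrite /recip2 Normc.normcM !normcX -exprMn exprD.
  by apply: ler_pM; rewrite ?exprn_ge0 ?normc_ge0// lerXn2r// nnegrE ?normc_ge0 ?mulr_ge0.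
split=> mq; apply: le_trans H _; rewrite ler_wpM2l ?exprn_ge0//.
  rewrite -/w -[X in _ <= X](sqr_sqrtr w0) -/rho -(subnKC mq) exprD.
  by rewrite ler_piMr ?exprn_ge0// exprn_ile1.
by rewrite -(subnKC mq) exprD expr1 ler_piMr// exprn_ile1.
Qed.

Lemma cintegrable_recip2 a b m q : complex.Im a != 0 -> complex.Im b != 0 ->
  (2 <= m + q)%N -> cintegrable mu (fun x : T1 => recip2 a b m q x).
Proof.
move=> a0 b0 mq; have [K K0 KP] := recip2_bound m q a0 b0.
apply: (@le_cintegrable _ T1 R mu _ (fun x : T1 => K * (1 + x ^+ 2)^-1 : R)).
- exact: cmeasurable_recip2.
- by have := integrableZl measurableT K integrable_oneDsqrV.
- by move=> x; have [H _] := KP x; exact: H.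
Qed.

Lemma cint_line_FTC (f F : R -> R[i]) (l : R[i]) :
  cintegrable mu (f : T1 -> R[i]) -> (forall x, is_cderive F x (f x)) ->
  (forall x, exists m, is_cderive f x m) ->
  (fun n => complex.Re (F n.+1%:R - F (- n.+1%:R))) @ \oo --> complex.Re l ->
  (fun n => complex.Im (F n.+1%:R - F (- n.+1%:R))) @ \oo --> complex.Im l ->
  cint mu (f : T1 -> R[i]) = l.
Proof.
move=> If dF df c1 c2.
have fE : f = (fun x => if x \in [set: R] then f x else 0).
  by apply/funext => x; rewrite in_setT.
rewrite fE; apply: (@cint_FTC_exhaust R setT f F (fun n => - n.+1%:R) (fun n => n.+1%:R)) => //.
- by move: If; rewrite {1}fE.
- by move=> n; rewrite gtrN// ltr0n.
- move=> x _; exists (Num.truncn `|x|) => // n /= xn; rewrite in_itv/= -ler_norml.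
  apply/ltW/(lt_le_trans (truncnS_gt _)); first by rewrite ler_nat ltnS.
Qed.

Lemma is_cderive_recip2 a b m q x : complex.Im a != 0 -> complex.Im b != 0 ->
  is_cderive (recip2 a b m q) x
    (- (m%:R * recip2 a b m.+1 q x + q%:R * recip2 a b m q.+1 x)).
Proof.
move=> a0 b0; have Ha := is_cderiveX m (is_cderive_recip x a0).
have Hb := is_cderiveX q (is_cderive_recip x b0).
apply: is_cderive_eq (is_cderiveM Ha Hb) _; rewrite /recip2.
case: m {Ha} => [|m]; case: q {Hb} => [|q]; rewrite /= ?mul0r ?mulr0 ?expr0 ?addr0 ?add0r.
- by rewrite oppr0.
- by rewrite !exprS; ring.
- by rewrite !exprS; ring.
- by rewrite !exprS; ring.
Qed.

Lemma recip2_ends a b m q : complex.Im a != 0 -> complex.Im b != 0 -> (1 <= m + q)%N ->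
  (fun n => complex.Re (recip2 a b m q n.+1%:R - recip2 a b m q (- n.+1%:R))) @ \oo --> (0 : R) /\
  (fun n => complex.Im (recip2 a b m q n.+1%:R - recip2 a b m q (- n.+1%:R))) @ \oo --> (0 : R).
Proof.
move=> a0 b0 mq; have [K K0 KP] := recip2_bound m q a0 b0.
apply: (@cvg0_ReIm _ (2 * K)) => n.
have sq (x : R) : `|x| = n.+1%:R -> normc (recip2 a b m q x) <= K / n.+1%:R.
  move=> xn; have [_ H] := KP x; apply: le_trans (H mq) _.
  rewrite ler_wpM2l// -[X in _ <= X](ger0_norm (_ : 0 <= n.+1%:R^-1)) ?invr_ge0//.
  rewrite -sqrtr_sqr ler_wsqrtr// exprVn lef_pV2 ?posrE ?exprn_gt0//; last first.
    by rewrite ltr_wpDr ?sqr_ge0.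
  by rewrite -xn real_normK ?num_real// lerDr.
apply: le_trans (le_normcB _ _) _; rewrite [X in _ <= X](_ : _ = K / n.+1%:R + K / n.+1%:R); last by ring.
by apply: lerD; apply: sq; rewrite ?normrN ger0_norm.
Qed.

Definition line_int a b m q : R[i] := cint mu (fun x : T1 => recip2 a b m q x).

(** The left side is minus the integral of the derivative of [recip2 a b m q], which tends to 0 at
    both ends. *)
Lemma line_int_parts a b m q : complex.Im a != 0 -> complex.Im b != 0 ->
  (1 <= m + q)%N ->
  m%:R * line_int a b m.+1 q + q%:R * line_int a b m q.+1 = 0.
Proof.
move=> a0 b0 mq.
have I1 : cintegrable mu (fun x : T1 => recip2 a b m.+1 q x).
  by apply: cintegrable_recip2; rewrite ?addSn.
have I2 : cintegrable mu (fun x : T1 => recip2 a b m q.+1 x).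
  by apply: cintegrable_recip2; rewrite ?addnS.
have J1 := cintegrableZ m%:R I1; have J2 := cintegrableZ q%:R I2.
have J := cintegrableZ (-1) (cintegrableD J1 J2).
have dd (m' q' : nat) x : is_cderive (recip2 a b m' q') x _ := is_cderive_recip2 m' q' x a0 b0.
rewrite -!cintZ// -cintD//; apply/eqP; rewrite -oppr_eq0 -mulN1r -cintZ//; last exact: cintegrableD.
apply/eqP; apply: (@cint_line_FTC _ (recip2 a b m q)) => //.
- by move=> x; apply: is_cderive_eq (dd m q x) _; rewrite mulN1r.
- move=> x; eexists; apply: is_cderiveM (is_cderive_cst _ _) _.
  apply: is_cderiveD; apply: is_cderiveM (is_cderive_cst _ _) _; exact: dd.
- by have [] := recip2_ends a0 b0 mq.
- by have [] := recip2_ends a0 b0 mq.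
Qed.

Lemma recip_sub a b x : complex.Im a != 0 -> complex.Im b != 0 ->
  recip b x - recip a x = (a - b) * (recip a x * recip b x).
Proof.
move=> /(shift_neq0 x) a0 /(shift_neq0 x) b0; rewrite /recip.
by field; rewrite a0 b0.
Qed.

(** Partial fractions replace [(a - b) / ((x + a) (x + b))] by [1 / (x + b) - 1 / (x + a)]; the pure
    power of [1 / (x + b)] integrates to zero. *)
Lemma line_int_split a b q : complex.Im a != 0 -> complex.Im b != 0 -> (1 <= q)%N ->
  (a - b) * line_int a b 1 q.+1 = - line_int a b 1 q.
Proof.
move=> a0 b0 q1.
have z0 : line_int a b 0 q.+1 = 0.
  have := @line_int_parts a b 0 q a0 b0 q1; rewrite mul0r add0r => /eqP.
  by rewrite mulf_eq0 pnatr_eq0 -leqn0 leqNgt q1 => /eqP.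
case: q q1 z0 => // q _ z0.
have I1 : cintegrable mu (fun x : T1 => recip2 a b 1 q.+1 x) by apply: cintegrable_recip2.
have I2 : cintegrable mu (fun x : T1 => recip2 a b 1 q.+2 x) by apply: cintegrable_recip2.
have I0 : cintegrable mu (fun x : T1 => recip2 a b 0 q.+2 x) by apply: cintegrable_recip2.
rewrite -cintZ//; apply/eqP; rewrite -subr_eq0 opprK -z0; apply/eqP.
rewrite -cintD//; last exact: cintegrableZ.
apply: eq_cint => x; rewrite /recip2 expr0 mul1r expr1.
have := recip_sub x a0 b0; rewrite (exprS _ q.+1) => E.
rewrite [(a - b) * _](_ : _ = (a - b) * (recip a x * recip b x) * recip b x ^+ q.+1); last by ring.
by rewrite -E exprS; ring.
Qed.

End LineIntegrals.

(** * Values of the line integrals *)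

Section LineIntegralValues.
Variable R : realType.
Local Notation mu := (@lebesgue_measure R).
Local Notation T1 := (measurableTypeR R).
Local Notation normc := Normc.normc.
Implicit Types (a b s : R[i]) (x : R).

Lemma recip_le a : complex.Im a != 0 ->
  exists C : R, forall n, normc (recip a n.+1%:R) <= C / n.+1%:R /\
                          normc (recip a (- n.+1%:R)) <= C / n.+1%:R.
Proof.
move=> /recip_bound[K K1 KP]; exists K => n.
have K0 : 0 <= K by exact: le_trans K1.
suff H x : `|x| = n.+1%:R -> normc (recip a x) <= K / n.+1%:R.
  by split; apply: H; rewrite ?normrN ger0_norm.
move=> xn; rewrite -(ler_pXn2r (n := 2)) ?nnegrE ?normc_ge0 ?divr_ge0//.
apply: le_trans (KP x) _; rewrite expr_div_n ler_pM ?invr_ge0 ?addr_ge0 ?sqr_ge0//.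
  by rewrite expr2 ler_peMl.
rewrite lef_pV2 ?posrE ?exprn_gt0//; last by rewrite ltr_wpDr ?sqr_ge0.
by rewrite -xn real_normK ?num_real// lerDr.
Qed.

Lemma atan_ends (u v : R) : 0 < v ->
  (fun n => atan ((n.+1%:R + u) / v) - atan ((- n.+1%:R + u) / v)) @ \oo --> pi.
Proof.
move=> v0.
have lim (w : R) : (fun n => atan ((n.+1%:R + w) / v)) @ \oo --> pi / 2.
  apply: (@cvg_comp _ _ _ (fun n : nat => (n.+1%:R + w) / v) atan _ +oo); last exact: cvgy_atan.
  apply/cvgryPge => A; exists (Num.truncn `|A * v - w|) => // n /= An.
  rewrite ler_pdivlMr// -lerBlDr; apply: le_trans (ler_norm _) _.
  by apply/ltW/(lt_le_trans (truncnS_gt _)); rewrite ler_nat ltnS.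
rewrite [X in _ --> X](_ : pi = pi / 2 + pi / 2); last by field.
rewrite (_ : (fun n => _) = (fun n => atan ((n.+1%:R + u) / v) + atan ((n.+1%:R + - u) / v))).
  by apply: cvgD; exact: lim.
apply/funext => n; congr (_ + _); rewrite -atanN; congr atan.
by rewrite -mulNr opprD opprK.
Qed.

Lemma is_derive_atan_affine (u v x : R) : v != 0 ->
  is_derive x (1 : R) (fun t : R => atan ((t + u) / v)) (v / ((x + u) ^+ 2 + v ^+ 2)).
Proof.
move=> v0.
have d1 : is_derive x (1 : R) (fun t : R => (t + u) / v) v^-1.
  rewrite (_ : (fun t : R => _) = v^-1 *: (id + cst u)).
    by apply: is_derive_eq; rewrite /GRing.scale/= addr0 mulr1.
  by apply/funext => t; rewrite /GRing.scale/= mulrC.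
have n0 : (x + u) ^+ 2 + v ^+ 2 != 0.
  by rewrite gt_eqF// ltr_wpDl ?sqr_ge0// exprn_even_gt0.
have n1 : 1 + ((x + u) / v) ^+ 2 != 0 by rewrite gt_eqF// ltr_wpDr ?sqr_ge0.
have dc := @is_derive1_comp R (@atan R) (fun t : R => (t + u) / v) x _ _ (is_derive1_atan _) d1.
apply: (is_derive_eq dc).
have -> : 1 + ((x + u) / v) ^+ 2 = ((x + u) ^+ 2 + v ^+ 2) / v ^+ 2 by field.
by field; rewrite n0 v0.
Qed.

(** This is [ln |(x + b) / (x + a)|], written with an argument that visibly tends to 1 at both ends
    of the line. *)
Definition log_part a b x : R :=
  2^-1 * ln (normc (1 - (a - b) * recip a x) ^+ 2).

Lemma quot_recip a b x : complex.Im a != 0 ->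
  1 - (a - b) * recip a x = (x%:C + b) * recip a x.
Proof. by move=> /(shift_neq0 x) a0; rewrite /recip; field. Qed.

Lemma is_derive_log_part a b x : complex.Im a != 0 -> complex.Im b != 0 ->
  is_derive x (1 : R) (log_part a b) (complex.Re (recip b x - recip a x)).
Proof.
move=> a0 b0; have ax := shift_neq0 x a0; have bx := shift_neq0 x b0.
pose p t : R[i] := 1 + (- (a - b)) * recip a t.
have pE t : 1 - (a - b) * recip a t = p t by rewrite /p; ring.
have p0 : p x != 0.
  by rewrite -pE quot_recip// mulf_neq0// /recip invr_eq0.
have [P1 P2] : is_cderive p x ((a - b) * recip a x ^+ 2).
  apply: is_cderive_eq (is_cderiveD (is_cderive_cst 1 x)
    (is_cderiveM (is_cderive_cst (- (a - b)) x) (is_cderive_recip x a0))) _.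
  by ring.
pose N t := complex.Re (p t) ^+ 2 + complex.Im (p t) ^+ 2.
have NE : N = (fun t => complex.Re (p t)) * (fun t => complex.Re (p t)) +
    (fun t => complex.Im (p t)) * (fun t => complex.Im (p t)).
  by apply/funext => t; rewrite /N !expr2.
have Nx : 0 < N x by rewrite /N -normc_sqr exprn_gt0// normc_gt0.
set q := (a - b) * recip a x ^+ 2 in P1 P2.
have dN : is_derive x (1 : R) N (2 * (complex.Re (p x) * complex.Re q + complex.Im (p x) * complex.Im q)).
  rewrite NE; apply: (is_derive_eq (is_deriveD (is_deriveM P1 P1) (is_deriveM P2 P2))).
  by rewrite /GRing.scale/=; ring.
have -> : log_part a b = 2^-1 *: (@ln R \o N).
  by apply/funext => t; rewrite /log_part pE normc_sqr.
have dL := @is_derive1_comp R (@ln R) N x _ _ (is_derive1_ln Nx) dN.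
apply: (is_derive_eq (is_deriveZ 2^-1 dL)); rewrite /GRing.scale/=.
have -> : recip b x - recip a x = q / p x.
  rewrite /q -pE quot_recip// /recip; field; by rewrite ax bx.
clear P1 P2 dN dL; have := Nx; rewrite /N; move: (p x) q => [p1 p2] [q1 q2] /= /lt0r_neq0 n0.
by field.
Qed.

Lemma log_part_ends a b : complex.Im a != 0 ->
  (fun n => log_part a b n.+1%:R - log_part a b (- n.+1%:R)) @ \oo --> (0 : R).
Proof.
move=> /recip_le[C CP].
suff lim (e : nat -> R) : (forall n, normc (recip a (e n)) <= C / n.+1%:R) ->
    (fun n => log_part a b (e n)) @ \oo --> (0 : R).
  rewrite -[X in _ --> X](subrr 0); apply: cvgB; apply: lim => n; by have [] := CP n.
move=> eC.
have /cvg0_ReIm[c1 c2] n : normc ((a - b) * recip a (e n)) <= (normc (a - b) * C) / n.+1%:R.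
  by rewrite Normc.normcM -mulrA ler_wpM2l ?normc_ge0.
have nE n : normc (1 - (a - b) * recip a (e n)) ^+ 2 =
    (1 - complex.Re ((a - b) * recip a (e n))) * (1 - complex.Re ((a - b) * recip a (e n))) +
    complex.Im ((a - b) * recip a (e n)) * complex.Im ((a - b) * recip a (e n)).
  by rewrite normc_sqr; case: (_ * _) => p q /=; ring.
have lim1 : (fun n => normc (1 - (a - b) * recip a (e n)) ^+ 2) @ \oo --> (1 : R).
  rewrite (funext nE).
  have c3 : (fun n => 1 - complex.Re ((a - b) * recip a (e n))) @ \oo --> (1 : R).
    by rewrite -[X in _ --> X]subr0; apply: cvgB => //; exact: cvg_cst.
  rewrite [X in _ --> X](_ : 1 = 1 * 1 + 0 * 0); last by rewrite mulr0 addr0 mulr1.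
  by apply: cvgD; apply: cvgM.
rewrite /log_part -[X in _ --> X](mulr0 2^-1); apply: cvgMr.
rewrite -(@ln1 R); apply: continuous_cvg lim1; exact: continuous_ln.
Qed.

(** In place of residues: [1 / (x + b) - 1 / (x + a)] has as primitive [log_part] plus [i] times a
    sum of two arctangents. The logarithm contributes 0 and, the imaginary parts of [a] and [b]
    having opposite signs, each arctangent contributes [pi]. *)
Lemma line_int11 a b : 0 < complex.Im a -> complex.Im b < 0 ->
  (a - b) * line_int a b 1 1 = 2 * pi%:C * 'i.
Proof.
move=> a0 b0; have a1 : complex.Im a != 0 by rewrite gt_eqF.
have b1 : complex.Im b != 0 by rewrite lt_eqF.
have I : cintegrable mu (fun x : T1 => recip2 a b 1 1 x) by apply: cintegrable_recip2.
rewrite -cintZ//.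
pose F x : R[i] := log_part a b x +i* (atan ((x + complex.Re b) / - complex.Im b)
  + atan ((x + complex.Re a) / complex.Im a)).
apply: (@cint_line_FTC R _ F); first exact: cintegrableZ.
- move=> x.
  have -> : (a - b) * recip2 a b 1 1 x = recip b x - recip a x.
    by rewrite recip_sub// /recip2 !expr1.
  split; first exact: is_derive_log_part.
  have d1 := is_derive_atan_affine (complex.Re b) x (_ : - complex.Im b != 0).
  have d2 := is_derive_atan_affine (complex.Re a) x a1.
  rewrite (_ : (fun t => complex.Im (F t)) = (fun t => atan ((t + complex.Re b) / - complex.Im b)) +
      (fun t => atan ((t + complex.Re a) / complex.Im a)))//.
  apply: (is_derive_eq (is_deriveD (d1 _) d2)); first by rewrite oppr_eq0.
  rewrite /recip; case: (a) (b) => u v [u' v'] /=.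
  by rewrite !add0r sqrrN; ring.
- move=> x; eexists; apply: is_cderiveM (is_cderive_cst _ _) _; exact: is_cderive_recip2.
- rewrite [X in _ --> X](_ : _ = 0); last by rewrite /=; ring.
  rewrite (_ : (fun n => _) = (fun n => log_part a b n.+1%:R - log_part a b (- n.+1%:R)))//.
  exact: log_part_ends.
- rewrite [X in _ --> X](_ : _ = pi + pi); last by rewrite /=; ring.
  have nb : 0 < - complex.Im b by rewrite oppr_gt0.
  rewrite [X in X @ _](_ : _ = (fun n => atan ((n.+1%:R + complex.Re b) / - complex.Im b) -
      atan ((- n.+1%:R + complex.Re b) / - complex.Im b)) + (fun n =>
      atan ((n.+1%:R + complex.Re a) / complex.Im a) -
      atan ((- n.+1%:R + complex.Re a) / complex.Im a))); last first.
    by apply/funext => n /=; rewrite opprD addrACA.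
  by apply: cvgD; exact: atan_ends.
Qed.

Lemma line_int1 a b q : 0 < complex.Im a -> complex.Im b < 0 ->
  (a - b) ^+ q.+1 * line_int a b 1 q.+1 = (- 1) ^+ q * (2 * pi%:C * 'i).
Proof.
move=> a0 b0; have a1 : complex.Im a != 0 by rewrite gt_eqF.
have b1 : complex.Im b != 0 by rewrite lt_eqF.
elim: q => [|q IH]; first by rewrite expr1 expr0 mul1r line_int11.
rewrite exprSr -mulrA line_int_split// mulrN IH exprS; ring.
Qed.

(** Each use of [line_int_parts] moves one exponent from the first factor to the second; the
    quotients [- (q + 1) / (m + 1)] multiply up to a signed binomial coefficient. *)
Lemma line_int_shift a b m q : complex.Im a != 0 -> complex.Im b != 0 ->
  line_int a b m.+1 q.+1 = (- 1) ^+ m * 'C(q + m, m)%:R * line_int a b 1 (q + m).+1.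
Proof.
move=> a0 b0; elim: m q => [|m IH] q; first by rewrite addn0 bin0 expr0 !mul1r.
apply: (mulfI (_ : m.+1%:R != 0 :> R[i])); first by rewrite pnatr_eq0.
have := line_int_parts a0 b0 (isT : (0 < m.+1 + q.+1)%N) => /eqP; rewrite addr_eq0 => /eqP ->.
rewrite IH addSnnS -mulNr !mulrA; congr (_ * _).
have /(congr1 (fun k => k%:R : R[i])) : (m.+1 * 'C(q + m.+1, m.+1) = q.+1 * 'C(q + m.+1, m))%N.
  by rewrite mul_bin_left addnS -addSn addnK.
rewrite !natrM => binE.
rewrite [X in _ = X](_ : _ = (-1) ^+ m.+1 * (m.+1%:R * 'C(q + m.+1, m.+1)%:R)); last by ring.
by rewrite binE exprS; ring.
Qed.

Lemma line_int_diag a b m : 0 < complex.Im a -> complex.Im b < 0 ->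
  (a - b) ^+ (m + m).+1 * line_int a b m.+1 m.+1 =
  (- 1) ^+ m * 'C(m + m, m)%:R * (2 * pi%:C * 'i).
Proof.
move=> a0 b0; have a1 : complex.Im a != 0 by rewrite gt_eqF.
have b1 : complex.Im b != 0 by rewrite lt_eqF.
rewrite line_int_shift// mulrCA line_int1// [(-1) ^+ (m + m)]exprD -signr_odd.
by rewrite -expr2 sqrr_sign mul1r.
Qed.

End LineIntegralValues.

(** * Beta integrals along a ray *)

Section HalfLine.
Variables (R : realType) (s : R[i]).
Hypothesis s0 : 0 < complex.Im s.
Local Notation mu := (@lebesgue_measure R).
Local Notation T1 := (measurableTypeR R).
Local Notation normc := Normc.normc.
Implicit Types (x y : R) (p q r : nat).

(** The difference of the two shifts in the line integral at height [y]: after integration in [x],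
    only powers of [y] and of this quantity remain. *)
Definition ray y : R[i] := 2 * 'i * y%:C + s.
Definition ray_mono p q y : R[i] := y%:C ^+ p * (ray y)^-1 ^+ q.
Definition half_int p q : R[i] :=
  cint mu (fun y : T1 => if y \in [set y : R | 0 < y] then ray_mono p q y else 0).

Lemma in_pos y : (y \in [set y : R | 0 < y]) = (0 < y).
Proof. by apply/idP/idP; rewrite inE. Qed.

Lemma Im_ray y : complex.Im (ray y) = 2 * y + complex.Im s.
Proof. by rewrite /ray; case: s => s1 s2 /=; ring. Qed.

Lemma ray_neq0 y : 0 <= y -> ray y != 0.
Proof.
move=> y0; apply/eqP => /(congr1 (@complex.Im R)); rewrite Im_ray => /eqP.
by rewrite gt_eqF//= ltr_wpDl// mulr_ge0.
Qed.

Lemma ray_le y : 0 <= y -> normc (ray y)^-1 * (2 * y + complex.Im s) <= 1.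
Proof.
move=> y0; rewrite Normc.normcV mulrC ler_pdivrMr ?normc_gt0 ?ray_neq0// mul1r.
by apply: le_trans (normc_ge_absIm _); rewrite Im_ray ler_norm.
Qed.

Lemma ray_bounds : exists2 C : R, 0 < C & forall y, 0 <= y ->
  [/\ normc (ray y)^-1 <= C, y * normc (ray y)^-1 <= 1 &
      normc (ray y)^-1 ^+ 2 <= C / (1 + y ^+ 2)].
Proof.
pose c := complex.Im s; pose C := 1 + c^-1 + c ^- 2.
have c1 : 0 < c^-1 by rewrite invr_gt0.
have c2 : 0 < c ^- 2 by rewrite invr_gt0 exprn_gt0.
exists C; first by rewrite /C !addr_gt0.
move=> y y0; have := ray_le y0; have := normc_ge0 (ray y)^-1; rewrite -/c.
set t := normc _ => t0 tle.
have ct : t * c <= 1 by apply: le_trans tle; rewrite ler_wpM2l// lerDr mulr_ge0.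
have yt : y * t <= 1.
  apply: le_trans tle; rewrite mulrC ler_wpM2l//.
  by rewrite mulr_natl mulr2n -addrA lerDl addr_ge0// ltW.
have tc : t <= c^-1 by rewrite -[c^-1]mul1r ler_pdivlMr.
split => //; first by apply: le_trans tc _; rewrite /C addrAC lerDr addr_ge0// ltW.
rewrite ler_pdivlMr ?ltr_wpDr ?sqr_ge0// mulrDr mulr1 -exprMn.
have h1 : (t * y) ^+ 2 <= 1 by rewrite exprn_ile1// mulrC// mulr_ge0.
have h2 : t ^+ 2 <= c ^- 2 by rewrite -exprVn lerXn2r ?nnegrE// ltW.
by rewrite /C; move: c1 h1 h2; lra.
Qed.

Lemma ray_mono_bound p q : (p < q)%N -> exists2 C : R, 0 <= C & forall y, 0 <= y ->
  normc (ray_mono p q y) <= C * normc (ray y)^-1 /\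
  ((p.+1 < q)%N -> normc (ray_mono p q y) <= C / (1 + y ^+ 2)).
Proof.
move=> pq; have [C C0 H] := ray_bounds.
exists (C ^+ (q - p).-1 + C ^+ (q - p).-2 * C).
  by rewrite addr_ge0// ?mulr_ge0 ?exprn_ge0 ?ltW.
move=> y y0; have [h1 h2 h3] := H y y0; set t := normc _ in h1 h2 h3 *.
have t0 : 0 <= t by exact: normc_ge0.
have bd : normc (ray_mono p q y) <= t ^+ (q - p).
  rewrite /ray_mono Normc.normcM !normcX -/t normc_real ger0_norm//.
  by rewrite -{1}(subnKC (ltnW pq)) exprD mulrA -exprMn ler_piMl ?exprn_ge0// exprn_ile1// mulr_ge0.
have y1 : 0 < 1 + y ^+ 2 by rewrite ltr_wpDr ?sqr_ge0.
split=> [|pq2]; apply: le_trans bd _.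
  have -> : (q - p = (q - p).-1.+1)%N by rewrite prednK ?subn_gt0.
  rewrite exprSr /= ler_wpM2r//; apply: (@le_trans _ _ (C ^+ (q - p).-1)).
    by rewrite lerXn2r ?nnegrE// ltW.
  by rewrite lerDl mulr_ge0 ?exprn_ge0 ?ltW.
have [k kE] : exists k, (q - p = k.+2)%N.
  by exists (q - p.+2)%N; rewrite -{1}(subnKC pq2) !addSn -!addnS addKn.
rewrite kE /= -addn2 exprD.
apply: (@le_trans _ _ (C ^+ k * (C / (1 + y ^+ 2)))).
  by rewrite ler_pM ?exprn_ge0// lerXn2r ?nnegrE// ltW.
rewrite mulrA ler_wpM2r ?invr_ge0 ?(ltW y1)//.
by rewrite lerDr exprn_ge0// ltW.
Qed.

Lemma cintegrable_ray_mono p q : (p.+1 < q)%N ->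
  cintegrable mu (fun y : T1 => if y \in [set y : R | 0 < y] then ray_mono p q y else 0).
Proof.
move=> pq; have [C C0 H] := ray_mono_bound (ltnW pq).
apply: (@le_cintegrable _ T1 R mu _ (fun x : T1 => C * (1 + x ^+ 2)^-1 : R)).
- apply: cmeasurable_if; last exact: cmeasurable_cst.
    rewrite (_ : (fun y : T1 => _) = (fun y : T1 => 0 < y)); last by apply/funext => y; exact: in_pos.
    by apply: measurable_fun_ltr.
  have m1 : cmeasurable (fun y : T1 => y%:C : R[i]) by exact: cmeasurable_real.
  apply: cmeasurableM; first exact: cmeasurableX.
  apply: cmeasurableX; apply: cmeasurableV; apply: cmeasurableD; last exact: cmeasurable_cst.
  by apply: cmeasurableM => //; exact: cmeasurable_cst.
- by have := integrableZl measurableT C (@integrable_oneDsqrV R).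
- move=> y; rewrite in_pos; case: ifPn => y0; last first.
    by rewrite Normc.normc0 mulr_ge0// invr_ge0 addr_ge0// sqr_ge0.
  by have [_ h] := H y (ltW y0); exact: h.
Qed.

Lemma is_cderive_ray_mono p q y : 0 <= y ->
  is_cderive (ray_mono p q) y
    (p%:R * ray_mono p.-1 q y + (- (2 * 'i * q%:R)) * ray_mono p q.+1 y).
Proof.
move=> y0; have H1 : is_cderive ray y (2 * 'i) by exact: is_cderive_affine.
have H2 := is_cderiveX q (is_cderiveV (ray_neq0 y0) H1).
have H3 : is_cderive (fun t : R => t%:C : R[i]) y 1.
  by apply: eq_is_cderive (is_cderive_affine 1 0 y) => t; rewrite mul1r addr0.
apply: is_cderive_eq (is_cderiveM (is_cderiveX p H3) H2) _; rewrite /ray_mono.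
have -> : ray y ^- 2 = (ray y)^-1 * (ray y)^-1 by rewrite -expr2 exprVn.
by case: q {H2} => [|q] /=; rewrite ?mul0r ?exprS; ring.
Qed.

(** The primitive vanishes at infinity because [p < q], so only its value at 0 is left. *)
Lemma ray_mono_FTC p q f : (p < q)%N ->
  (forall y, 0 <= y -> is_cderive (ray_mono p q) y (f y)) ->
  (forall y, 0 < y -> exists m, is_cderive f y m) ->
  cintegrable mu (fun y : T1 => if y \in [set y : R | 0 < y] then f y else 0) ->
  cint mu (fun y : T1 => if y \in [set y : R | 0 < y] then f y else 0) = - ray_mono p q 0.
Proof.
move=> pq dF df If.
(* Starting at 2 keeps [u n < v n] already for [n = 0]. *)
pose u n : R := n.+2%:R^-1; pose v n : R := n.+2%:R.
have u0 n : 0 < u n by rewrite invr_gt0.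
have uv n : u n < v n.
  by apply: (@lt_trans _ _ 1); rewrite /u /v ?invf_lt1 ?ltr1n.
have [C C0 H] := ray_mono_bound pq.
have [c1 c2] : (fun n => complex.Re (ray_mono p q (v n))) @ \oo --> (0 : R) /\
    (fun n => complex.Im (ray_mono p q (v n))) @ \oo --> (0 : R).
  apply: (@cvg0_ReIm _ (fun n => ray_mono p q (v n)) C) => n; have v0 : 0 <= v n by exact: ler0n.
  have [h _] := H _ v0; apply: le_trans h _; rewrite ler_wpM2l//.
  have := ray_le v0; set t := normc _ => tle.
  rewrite -[X in _ <= X]mul1r ler_pdivlMr//; apply: le_trans tle.
  rewrite ler_wpM2l ?normc_ge0// /v.
  rewrite (_ : n.+2%:R = n.+1%:R + 1 :> R) ?natr1//.
  by have := ltW s0; have : 0 <= n.+1%:R :> R by []; lra.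
have cu : u n @[n --> \oo] --> (0 : R).
  by have := @cvg_harmonic R; rewrite -cvg_shiftS.
have [d1 d2] := is_cderive_continuous (dF 0 (lexx 0)).
have e1 : (fun n => complex.Re (ray_mono p q (u n))) @ \oo --> complex.Re (ray_mono p q 0).
  exact: (cvg_comp _ _ cu d1).
have e2 : (fun n => complex.Im (ray_mono p q (u n))) @ \oo --> complex.Im (ray_mono p q 0).
  exact: (cvg_comp _ _ cu d2).
apply: (@cint_FTC_exhaust R [set y | 0 < y] f (ray_mono p q) u v) => //.
- rewrite (_ : [set y | 0 < y] = `]0, +oo[%classic); first exact: measurable_itv.
  by apply/seteqP; split => y /=; rewrite in_itv/= andbT.
- by move=> n x; rewrite in_itv/= => /andP[ux _]; exact: lt_le_trans ux.
- move=> x /= x0; exists (maxn (Num.truncn x) (Num.truncn x^-1)) => // n /=.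
  rewrite geq_max => /andP[n1 n2]; rewrite in_itv/= /u /v; apply/andP; split.
    rewrite -[x]invrK lef_pV2 ?posrE ?invr_gt0//.
    apply/ltW/(lt_le_trans (truncnS_gt _)); by rewrite ler_nat ltnW.
  by apply/ltW/(lt_le_trans (truncnS_gt _)); rewrite ler_nat ltnW.
- by move=> x /= /ltW; exact: dF.
- have -> : complex.Re (- ray_mono p q 0) = 0 - complex.Re (ray_mono p q 0).
    by case: (ray_mono p q 0) => ? ?; rewrite sub0r.
  rewrite (_ : (fun n => _) = (fun n => complex.Re (ray_mono p q (v n))) -
      (fun n => complex.Re (ray_mono p q (u n)))); first exact: cvgB.
  by apply/funext => n; rewrite -[RHS]/(_ - _); case: (ray_mono _ _ _) => ? ?; case: (ray_mono _ _ _).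
- have -> : complex.Im (- ray_mono p q 0) = 0 - complex.Im (ray_mono p q 0).
    by case: (ray_mono p q 0) => ? ?; rewrite sub0r.
  rewrite (_ : (fun n => _) = (fun n => complex.Im (ray_mono p q (v n))) -
      (fun n => complex.Im (ray_mono p q (u n)))); first exact: cvgB.
  by apply/funext => n; rewrite -[RHS]/(_ - _); case: (ray_mono _ _ _) => ? ?; case: (ray_mono _ _ _).
Qed.

Lemma half_int0 q : (0 < q)%N -> 2 * 'i * q%:R * half_int 0 q.+1 = s^-1 ^+ q.
Proof.
move=> q0; have I : cintegrable mu (fun y : T1 =>
    if y \in [set y : R | 0 < y] then ray_mono 0 q.+1 y else 0).
  exact: cintegrable_ray_mono.
apply: oppr_inj; rewrite -mulNr /half_int -cintZ//.
have -> : - s^-1 ^+ q = - ray_mono 0 q 0 by rewrite /ray_mono expr0 mul1r /ray mulr0 add0r.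
pose f y := (- (2 * 'i * q%:R)) * ray_mono 0 q.+1 y.
have E : (fun y : T1 => - (2 * 'i * q%:R) * (if y \in [set y : R | 0 < y] then ray_mono 0 q.+1 y else 0))
    = (fun y : T1 => if y \in [set y : R | 0 < y] then f y else 0).
  by apply/funext => y; case: ifP => // _; rewrite mulr0.
rewrite E; apply: ray_mono_FTC => //.
- by move=> y /(is_cderive_ray_mono 0 q) H; apply: is_cderive_eq H _; rewrite mul0r add0r.
- move=> y /ltW y0; eexists; exact: is_cderiveM (is_cderive_cst _ _) (is_cderive_ray_mono 0 q.+1 y0).
- by rewrite -E; exact: cintegrableZ.
Qed.

(** Integration by parts; the boundary term at 0 vanishes because of the factor [y ^+ p.+1]. *)
Lemma half_intS p q : (p.+1 < q)%N ->
  2 * 'i * q%:R * half_int p.+1 q.+1 = p.+1%:R * half_int p q.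
Proof.
move=> pq; pose D := [set y : R | 0 < y].
have I1 : cintegrable mu (fun y : T1 => if y \in D then ray_mono p q y else 0).
  exact: cintegrable_ray_mono.
have I2 : cintegrable mu (fun y : T1 => if y \in D then ray_mono p.+1 q.+1 y else 0).
  exact: cintegrable_ray_mono.
apply/eqP; rewrite eq_sym -subr_eq0 -mulNr /half_int -!cintZ// -cintD//; try exact: cintegrableZ.
pose f y := p.+1%:R * ray_mono p q y + (- (2 * 'i * q%:R)) * ray_mono p.+1 q.+1 y.
have E : (fun y : T1 => p.+1%:R * (if y \in D then ray_mono p q y else 0) +
    - (2 * 'i * q%:R) * (if y \in D then ray_mono p.+1 q.+1 y else 0))
    = (fun y : T1 => if y \in D then f y else 0).
  by apply/funext => y; case: ifP => // _; rewrite !mulr0 addr0.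
apply/eqP; rewrite [RHS](_ : _ = - ray_mono p.+1 q 0); last by rewrite /ray_mono expr0n mul0r oppr0.
rewrite E; apply: ray_mono_FTC => //.
- by move=> y; exact: is_cderive_ray_mono.
- move=> y /ltW y0; eexists; apply: is_cderiveD;
    apply: is_cderiveM (is_cderive_cst _ _) (is_cderive_ray_mono _ _ y0).
- by rewrite -E; apply: cintegrableD; exact: cintegrableZ.
Qed.

(** Euler's beta integral with denominators cleared, by induction on [p]. *)
Lemma half_int_fact p r :
  (2 * 'i) ^+ p.+1 * s ^+ r.+1 * (p + r).+1`!%:R * half_int p (p + r).+2 = (p`! * r`!)%:R.
Proof.
have sn0 : s != 0 by apply: contraTneq s0 => ->; rewrite ltxx.
elim: p => [|p IH].
  have := @half_int0 r.+1 isT; rewrite add0n factS natrM mul1n expr1 => H.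
  transitivity (s ^+ r.+1 * (2 * 'i * r.+1%:R * half_int 0 r.+2) * r`!%:R); first by ring.
  by rewrite H -exprMn mulfV// expr1n mul1r.
have := @half_intS p (p + r).+2 (leq_addr r p.+1) => H.
have fE n : (n.+1)`!%:R = n.+1%:R * n`!%:R :> R[i] by rewrite factS natrM.
rewrite addSn (fE (p + r).+1) natrM (fE p).
move: (((p + r).+1)`!%:R) IH => N IH.
transitivity ((2 * 'i) ^+ p.+1 * s ^+ r.+1 * N * (2 * 'i * (p + r).+2%:R * half_int p.+1 (p + r).+3)).
  by rewrite [(2 * 'i) ^+ p.+2]exprS; ring.
rewrite H; transitivity (p.+1%:R * ((2 * 'i) ^+ p.+1 * s ^+ r.+1 * N * half_int p (p + r).+2)).
  by ring.
by rewrite IH natrM; ring.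
Qed.

End HalfLine.

Section ComplexProdIntegral.
Context d1 d2 (T1 : measurableType d1) (T2 : measurableType d2) (R : realType).
Variables (m1 : {sigma_finite_measure set T1 -> \bar R}).
Variables (m2 : {sigma_finite_measure set T2 -> \bar R}).

Lemma Rintegral_prod (f : T1 * T2 -> R) :
  (m1 \x m2)%E.-integrable setT (fun p => (f p)%:E) ->
  \int[(m1 \x m2)%E]_p f p = \int[m2]_y \int[m1]_x f (x, y).
Proof.
move=> If; rewrite /Rintegral -(integral21_prod_meas1 If); congr fine.
apply: ae_eq_integral => //.
- exact: measurable_fubini_G If.
- apply/measurable_EFinP; apply: (measurableT_comp (f := fine)) => //.
  exact: measurable_fubini_G If.
- have := ae_integrable2 If; apply: filterS => y /= Iy _.
  by rewrite fineK//; exact: integrable_fin_num.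
Qed.

Lemma cint_prod (f : T1 * T2 -> R[i]) : cintegrable (m1 \x m2)%E f ->
  cint (m1 \x m2)%E f = cint m2 (fun y => cint m1 (fun x => f (x, y))).
Proof.
by move=> [f1 f2]; rewrite /cint/= (Rintegral_prod f1) (Rintegral_prod f2).
Qed.

Lemma integrable_prodM (g : T1 -> R) (h : T2 -> R) :
  m1.-integrable setT (fun x => (g x)%:E) -> m2.-integrable setT (fun y => (h y)%:E) ->
  (m1 \x m2)%E.-integrable setT (fun p => (g p.1 * h p.2)%:E).
Proof.
move=> /integrableP[/measurable_EFinP mg Ig] /integrableP[/measurable_EFinP mh Ih].
apply: integrable_prod_lty.
  by apply: measurable_funM; apply: measurableT_comp.
have J0 : (0 <= \int[m2]_y `|(h y)%:E|)%E by exact: integral_ge0.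
have Jf : (\int[m2]_y `|(h y)%:E|)%E \is a fin_num by rewrite ge0_fin_numE.
under eq_integral => x _.
  rewrite (_ : (\int[m2]_y _)%E = `|g x|%:E * \int[m2]_y `|(h y)%:E|)%E; last first.
    rewrite -ge0_integralZl//; last by apply: measurableT_comp => //; exact/measurable_EFinP.
    by apply: eq_integral => y _; rewrite normrM EFinM.
  over.
rewrite ge0_integralZr//; last by apply/measurable_EFinP; exact: measurableT_comp.
by rewrite lte_mul_pinfty//; [exact: integral_ge0|rewrite ge0_fin_numE// integral_ge0].
Qed.

End ComplexProdIntegral.

(** * Pairing of two kernels over the half-plane *)

Section KernelPairing.
Variable R : realType.
Local Notation mu := (@lebesgue_measure R).
Local Notation T1 := (measurableTypeR R).
Local Notation T2 := (T1 * T1)%type.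
Local Notation normc := Normc.normc.
Implicit Types (A : SL2 R) (z w : uhp R) (n m : nat) (p : T2).

(** [ker] in real coordinates; being affine in the point, it extends to the whole plane, where
    measurability is stated. *)
Definition kerp A w p : R[i] := ker_slope A w * (p.1 +i* p.2 : R[i]) +
  ((val A ord0 ord_max)%:C - conjc (val w) * (val A ord_max ord_max)%:C).

Lemma kerp_val A z w p : val z = p.1 +i* p.2 -> kerp A w p = ker A z w.
Proof. by move=> zE; rewrite /kerp -zE /ker_slope /ker /moebius_num /moebius_den; ring. Qed.

Lemma cmeasurable_kerp A w : cmeasurable (kerp A w).
Proof.
apply: cmeasurableD; last exact: cmeasurable_cst.
apply: cmeasurableM; first exact: cmeasurable_cst.
exact: cmeasurable_pair.
Qed.

Lemma uhp_pair p : 0 < p.2 -> exists z, val z = p.1 +i* p.2.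
Proof. by move=> p0; exists (exist _ (p.1 +i* p.2) p0 : uhp R). Qed.

Definition ker4 w p : R := if 0 < p.2 then normc (kerp 1%g w p)^-1 ^+ 4 else 0.

Lemma measurable_pos2 : measurable_fun setT (fun p : T2 => 0 < p.2).
Proof. by apply: measurable_fun_ltr => //; exact: measurable_snd. Qed.

Lemma measurable_ker4 w : measurable_fun setT (ker4 w).
Proof.
apply: measurable_fun_ifT => //; first exact: measurable_pos2.
by apply: measurable_funX; apply: measurable_normc; apply: cmeasurableV; exact: cmeasurable_kerp.
Qed.

Lemma kerp1 w p : kerp 1%g w p = (p.1 - complex.Re (val w)) +i* (p.2 + imz w).
Proof.
rewrite /kerp /ker_slope !mxE/= /imz; case: w => -[u v] /= _.
by apply/eqP; rewrite eq_complex /=; apply/andP; split; apply/eqP; ring.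
Qed.

(** For [w = u + i v], the square of [|z - conj w|] is at least [(x - u)^2 + v^2] and at least
    [y^2 + v^2]; the product of the two bounds is integrable variable by variable. *)
Lemma integrable_ker4 w : (mu \x mu)%E.-integrable setT (fun p : T2 => (ker4 w p)%:E).
Proof.
set u := complex.Re (val w); set v := imz w.
have v0 : 0 < v by exact: imz_gt0.
have yv (y : R) : 0 < y -> y ^+ 2 + v ^+ 2 <= (y + v) ^+ 2.
  by move=> y0; have := mulr_gt0 y0 v0; rewrite !expr2; lra.
have [K K1 KP] := @recip_bound R (- u +i* v) (lt0r_neq0 v0).
have [L L1 LP] := @recip_bound R (0 +i* v) (lt0r_neq0 v0).
have := @integrable_prodM _ _ _ _ _ mu mu _ _ (@integrable_oneDsqrV R) (@integrable_oneDsqrV R).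
move=> /(integrableZl measurableT (K * L)) I.
apply: le_integrable I => //; first by apply/measurable_EFinP; exact: measurable_ker4.
move=> [x y] _; rewrite /= lee_fin /ker4 /=; case: ifPn => y0; last by rewrite normr0.
rewrite ger0_norm ?exprn_ge0 ?normc_ge0//; apply: le_trans (ler_norm _).
rewrite kerp1 -/u -/v -[4%N]/(2 * 2)%N exprM Normc.normcV exprVn normc_sqr /=.
have KL : K / (1 + x ^+ 2) * (L / (1 + y ^+ 2)) = K * L * ((1 + x ^+ 2)^-1 * (1 + y ^+ 2)^-1) by ring.
rewrite -KL expr2; have hx := KP x; have hy := LP y.
rewrite /recip Normc.normcV exprVn normc_sqr /= add0r in hx.
rewrite /recip Normc.normcV exprVn normc_sqr /= add0r addr0 in hy.
have v2 : 0 < v ^+ 2 by rewrite exprn_gt0.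
apply: ler_pM; rewrite ?invr_ge0 ?addr_ge0 ?sqr_ge0//.
  apply: le_trans hx; rewrite lef_pV2 ?posrE ?ltr_wpDl ?sqr_ge0 ?exprn_gt0 ?addr_gt0//.
  by rewrite lerD2l; apply: le_trans (yv _ y0); rewrite lerDr sqr_ge0.
apply: le_trans hy; rewrite lef_pV2 ?posrE ?ltr_wpDl ?sqr_ge0 ?exprn_gt0 ?addr_gt0//.
by apply: le_trans (yv _ y0) _; rewrite lerDr sqr_ge0.
Qed.

(* [ker_harnackl] bounds [n - 4] of the factors, [ker_ge] the remaining four. *)
Lemma kernel_pair_le A z w n : (4 <= n)%N ->
  imz z ^+ (n - 2) * (normc (ker A z w)^-1 ^+ n * normc (ker 1%g z w)^-1 ^+ n) <=
  (2 * normc (ker A w w)^-1) ^+ (n - 4) * (4 * imz w) ^- 2 * normc (ker 1%g z w)^-1 ^+ 4.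
Proof.
move=> n4; set y := imz z; set v := imz w.
have y0 : 0 < y by exact: imz_gt0.
have v0 : 0 < v by exact: imz_gt0.
have a0 : 0 < normc (ker A z w) by rewrite normc_gt0 ker_neq0.
have b0 : 0 < normc (ker 1%g z w) by rewrite normc_gt0 ker_neq0.
have c0 : 0 < normc (ker A w w) by rewrite normc_gt0 ker_neq0.
have h1 := ker_harnackl A z w w; have h2 := ker_ge A z w.
have h3 : y + normc (val w - val z) <= 2 * normc (ker 1%g z w).
  rewrite ker1; have := normc_val_sub_conj z w; rewrite -/y -/v.
  have : normc (val w - val z) <= normc (val z - conjc (val w)).
    rewrite -(ler_pXn2r (n := 2)) ?nnegrE ?normc_ge0// !normc_sqr.
    move: y0 v0; rewrite /y /v /imz; case: (z) (w) => -[p1 q1] /= _ [[p2 q2] /= _] q10 q20.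
    have := mulr_gt0 q10 q20.
    have -> : (p2 - p1) ^+ 2 = (p1 - p2) ^+ 2 by ring.
    by rewrite lerD2l !expr2; lra.
  by move: v0; lra.
move: h1 h2 h3; rewrite -/y -/v !Normc.normcV.
move: (normc _) a0 => a a0; move: (normc _) c0 => c c0; move: (normc (ker 1%g z w)) b0 => b b0.
move: (normc _) => t h1 h2 h3.
have hc : y * (a^-1 * b^-1) <= 2 * c^-1.
  rewrite -invfM ler_pdivrMr ?mulr_gt0// mulrAC ler_pdivlMr//.
  rewrite [y * c]mulrC; apply: le_trans h1 _; rewrite [2 * _]mulrCA.
  exact: ler_wpM2l (ltW a0) _ _ h3.
have ha : y ^+ 2 * a^-1 ^+ 4 <= (4 * v) ^- 2.
  rewrite exprVn ler_pdivrMr ?exprn_gt0// mulrC ler_pdivlMr ?exprn_gt0 ?mulr_gt0//.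
  rewrite -exprMn -[4%N]/(2 * 2)%N exprM mulrCA.
  have yv0 : 0 <= 4 * (y * v) by rewrite !mulr_ge0// ltW.
  by rewrite lerXn2r// nnegrE sqr_ge0.
have -> : y ^+ (n - 2) * (a^-1 ^+ n * b^-1 ^+ n) =
    (y * (a^-1 * b^-1)) ^+ (n - 4) * (y ^+ 2 * a^-1 ^+ 4) * b^-1 ^+ 4.
  have -> : (n - 2 = (n - 4) + 2)%N by rewrite -subnA.
  rewrite -{2 3}(subnK n4) !exprD !exprMn; ring.
rewrite ler_wpM2r ?exprn_ge0 ?invr_ge0 ?(ltW b0)//.
have [ai bi ci] : [/\ 0 <= a^-1, 0 <= b^-1 & 0 <= c^-1].
  by split; apply: ltW; rewrite invr_gt0.
have yi := ltW y0; have abi := mulr_ge0 yi (mulr_ge0 ai bi).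
apply: ler_pM ha; first exact: exprn_ge0.
  by rewrite mulr_ge0 ?exprn_ge0.
by rewrite lerXn2r// nnegrE// mulr_ge0.
Qed.

(** The term of [A] times the conjugate of the term of the identity; the exponent [n - 2] combines
    [y ^+ n] with the density. *)
Definition kernel_pair A w n p : R[i] := if 0 < p.2 then
  (p.2 ^+ (n - 2))%:C * ((kerp A w p)^-1 ^+ n * conjc ((kerp 1%g w p)^-1 ^+ n)) else 0.

Lemma cmeasurable_kernel_pair A w n : cmeasurable (kernel_pair A w n).
Proof.
apply: cmeasurable_if; [exact: measurable_pos2| |exact: cmeasurable_cst].
apply: cmeasurableM.
  by apply: cmeasurable_real; apply: measurable_funX; exact: measurable_snd.
apply: cmeasurableM; last apply: cmeasurable_conj; apply: cmeasurableX;
  by apply: cmeasurableV; exact: cmeasurable_kerp.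
Qed.

Lemma normc_kernel_pair_le A w n p : (4 <= n)%N -> normc (kernel_pair A w n p) <=
  (2 * normc (ker A w w)^-1) ^+ (n - 4) * (4 * imz w) ^- 2 * ker4 w p.
Proof.
move=> n4; rewrite /kernel_pair /ker4; case: ifPn => p0; last by rewrite Normc.normc0 mulr0.
have [z zE] := uhp_pair p0.
have -> : p.2 = imz z by rewrite /imz zE.
rewrite !(kerp_val _ _ zE) !Normc.normcM normc_conj !normcX normc_real.
by rewrite ger0_norm ?exprn_ge0 ?(ltW (imz_gt0 z))//; exact: kernel_pair_le.
Qed.

Lemma cintegrable_kernel_pair A w n : (4 <= n)%N ->
  cintegrable (mu \x mu)%E (kernel_pair A w n).
Proof.
move=> n4; apply: le_cintegrable (fun p => normc_kernel_pair_le A w p n4).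
  exact: cmeasurable_kernel_pair.
by have := integrableZl measurableT _ (integrable_ker4 w); apply.
Qed.

(** The factor [2 pi i] comes from the line integral, the power of [2 i] from the half-line;
    binomial coefficient and factorials cancel down to [n - 1]. *)
Definition pairing_const n : R[i] :=
  (- 1) ^+ n.-1 * (2 * pi%:C * 'i) / (n.-1%:R * (2 * 'i) ^+ n.-1).

Lemma normc_nat n : normc (n%:R : R[i]) = n%:R.
Proof. by rewrite -(rmorph_nat (real_complex R)) normc_real ger0_norm. Qed.

Lemma normc_i : normc ('i : R[i]) = 1.
Proof. by rewrite /= expr0n expr1n add0r sqrtr1. Qed.

Lemma normc_pairing_const n : (2 <= n)%N ->
  normc (pairing_const n) = 4 * pi / ((n%:R - 1) * 2 ^+ n).
Proof.
case: n => // -[//|n] _; rewrite /pairing_const /=.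
rewrite !Normc.normcM Normc.normcV !Normc.normcM !normcX Normc.normcM normc_i !normc_nat.
rewrite normcN Normc.normc1 expr1n normc_real ger0_norm ?pi_ge0//.
have -> : n.+2%:R - 1 = n.+1%:R :> R by rewrite -[n.+2]addn1 natrD addrK.
have h : n.+1%:R != 0 :> R by rewrite pnatr_eq0.
have h2 : 2 ^+ n.+1 != 0 :> R by rewrite expf_neq0.
rewrite !mulr1 mul1r [2 ^+ n.+2]exprS; move: (n.+1%:R) (2 ^+ n.+1) h h2 => x y h h2.
by field; rewrite h h2.
Qed.

Lemma ker_slope_neq0 A w : ker_slope A w != 0.
Proof.
apply/eqP => s0; have := Im_ker_mul_conj_slope A w w; rewrite s0 rmorph0 mulr0 Normc.normc0.
by rewrite expr0n mulr0 add0r => /eqP; rewrite lt_eqF//= imz_gt0.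
Qed.

(** On a horizontal line the first kernel and the conjugate of the second are affine in [x] with
    zeros on opposite sides of the real axis, the setting of [line_int_diag]; the remaining integral
    in [y] is [half_int_fact]. *)
Theorem cint_kernel_pair A w n : (4 <= n)%N ->
  cint (mu \x mu)%E (kernel_pair A w n) = pairing_const n * (ker A w w)^-1 ^+ n.
Proof.
move=> n4; rewrite cint_prod; last exact: cintegrable_kernel_pair.
have [p nE] : exists p : nat, n = p.+2 by exists (n - 2)%N; rewrite -addn2 subnK// ltnW// ltnW.
pose a := ker_slope A w; have a0 : a != 0 by exact: ker_slope_neq0.
pose b : R[i] := (val A ord0 ord_max)%:C - conjc (val w) * (val A ord_max ord_max)%:C.
(* The first kernel vanishes at [- b / a], so [s * a] is its value at [w]; powers of [s] thus become
   powers of [ker A w w]. *)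
pose s := b / a + val w.
have saE : s * a = ker A w w.
  rewrite /s mulrDl divfK// /b /a /ker_slope /ker /moebius_num /moebius_den; ring.
have na : 0 < normc a ^+ 2 by rewrite exprn_gt0// normc_gt0.
have ba0 : 0 < complex.Im (b / a).
  have := Im_ker_mul_conj_slope A w w; rewrite -/a -saE -mulrA mul_conjc /s [normc a ^+ 2]lock.
  rewrite ImM /= mulr0 add0r ImD -lock mulrDl addrC mulrDl => /addrI H.
  by rewrite -(pmulr_lgt0 _ na) H imz_gt0.
have bI (y : R) : 0 < y -> 0 < complex.Im (b / a) + y by move=> y0; rewrite addr_gt0.
have s0 : 0 < complex.Im s by rewrite /s ImD addr_gt0//; exact: imz_gt0.
pose c : R[i] := a^-1 ^+ p.+2 * ((- 1) ^+ p.+1 * 'C(p.+1 + p.+1, p.+1)%:R * (2 * pi%:C * 'i)).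
have inner (y : T1) : cint mu (fun x : T1 => kernel_pair A w n (x, y)) =
    c * (if y \in [set y : R | 0 < y] then ray_mono s p (p + p.+1).+2 y else 0).
  rewrite in_pos; case: ifPn => y0; last first.
    rewrite mulr0 (@eq_cint _ _ _ _ _ (fun=> 0 * 0)).
      by rewrite cintZ ?mul0r//; split; exact: integrable0.
    by move=> x; rewrite /kernel_pair /= (negbTE y0) mulr0.
  (* At height [y] the first kernel is [a * (x + a')] and the conjugate of the second is
     [x + b']. *)
  pose a' := 'i * y%:C + b / a; pose b' := - ('i * y%:C + val w).
  have a'0 : 0 < complex.Im a'.
    by rewrite /a' ImD /= !mul0r add0r mul1r addrC bI.
  have b'0 : complex.Im b' < 0.
    rewrite /b'; have := imz_gt0 w; rewrite /imz; case: (val w) => w1 w2 /= w20.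
    by rewrite oppr_lt0 mul0r add0r mul1r addr_gt0.
  have rayE : a' - b' = ray s y by rewrite /a' /b' /ray /s; ring.
  transitivity (y%:C ^+ p * a^-1 ^+ p.+2 * line_int a' b' p.+2 p.+2).
    rewrite /line_int -cintZ; last first.
      by apply: cintegrable_recip2 => //; [exact: lt0r_neq0|exact: ltr0_neq0].
    apply: eq_cint => x; rewrite /kernel_pair /= y0 nE subn2 /= rmorphXn -mulrA.
    have -> : kerp A w (x, y) = a * (x%:C + a').
      have xyE : x +i* y = x%:C + 'i * y%:C :> R[i].
        by apply/eqP; rewrite eq_complex /=; apply/andP; split; apply/eqP; ring.
      by rewrite /kerp -/a -/b /= xyE /a'; field.
    have -> : conjc ((kerp 1%g w (x, y))^-1 ^+ p.+2) = (x%:C + b')^-1 ^+ p.+2.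
      rewrite rmorphXn fmorphV kerp1 /b' /imz; congr (_^-1 ^+ _).
      by case: (val w) => w1 w2; apply/eqP; rewrite eq_complex /=; apply/andP; split; apply/eqP; ring.
    by rewrite /recip2 /recip invfM exprMn -!mulrA.
  have D := line_int_diag p.+1 a'0 b'0; rewrite rayE in D.
  have r0 : ray s y != 0 by exact: ray_neq0 (ltW y0).
  have -> : line_int a' b' p.+2 p.+2 = (ray s y)^-1 ^+ (p + p.+1).+2 *
      ((- 1) ^+ p.+1 * 'C(p.+1 + p.+1, p.+1)%:R * (2 * pi%:C * 'i)).
    by rewrite -D addSn mulrA -exprMn mulVf// expr1n mul1r.
  by rewrite /ray_mono /c; ring.
rewrite (eq_cint _ inner) cintZ; last by apply: cintegrable_ray_mono; rewrite // !ltnS leq_addr.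
rewrite -/(half_int s p (p + p.+1).+2).
have sn0 : s != 0 by apply: contraTneq s0 => ->; rewrite ltxx.
have H := half_int_fact s0 p p.+1.
have binE := bin_fact (leq_addr p.+1 p.+1); rewrite addKn in binE.
have gE : (p.+1)`!%:R = p.+1%:R * p`!%:R :> R[i] by rewrite factS natrM.
have f0 : p`!%:R != 0 :> R[i] by rewrite pnatr_eq0 -lt0n fact_gt0.
have p0 : p.+1%:R != 0 :> R[i] by rewrite pnatr_eq0.
have i0 : (2 * 'i) ^+ p.+1 != 0 :> R[i].
  by rewrite expf_neq0// mulf_neq0// neq0Ci.
have S0 : s ^+ p.+2 != 0 by rewrite expf_neq0.
have A0 : a ^+ p.+2 != 0 by rewrite expf_neq0.
have bR : ((p + p.+1).+1)`!%:R = 'C(p.+1 + p.+1, p.+1)%:R * ((p.+1)`!%:R * (p.+1)`!%:R) :> R[i].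
  by rewrite -addSn -binE natrM [X in _ * X = _]natrM.
move: H; rewrite bR [RHS]natrM gE => H.
have B0 : 'C(p.+1 + p.+1, p.+1)%:R != 0 :> R[i].
  by rewrite pnatr_eq0 -lt0n bin_gt0 leq_addr.
have -> : (ker A w w)^-1 ^+ n = (s ^+ p.+2)^-1 * (a ^+ p.+2)^-1.
  by rewrite -saE nE exprVn exprMn invfM.
rewrite nE /pairing_const /c /= [a^-1 ^+ _]exprVn.
apply: (mulfI (mulf_neq0 (mulf_neq0 i0 S0) (mulf_neq0 (mulf_neq0 B0 (mulf_neq0 p0 f0)) (mulf_neq0 p0 f0)))).
move: H B0 p0 f0 i0 S0 A0.
move: ('C(_, _)%:R : R[i]) (p.+1%:R : R[i]) (p`!%:R : R[i]) ((2 * 'i) ^+ p.+1 : R[i]) (s ^+ p.+2)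
  (a ^+ p.+2) (half_int _ _ _) ((- 1) ^+ p.+1 : R[i]) (2 * pi%:C * 'i : R[i])
  => B q g I S A0 h e t H B0 q0 g0 I0 S0 A00.
transitivity (A0^-1 * (e * B * t) * (I * S * (B * (q * g * (q * g))) * h)); first by ring.
rewrite H; field; by rewrite q0 I0 S0 A00.
Qed.

End KernelPairing.

(** * Sums over a countable group and unfolding *)

(** Fubini for a sum and an integral needs counting measure as a sigma-finite factor. *)
HB.instance Definition _ (R : realType) := Measure_isSigmaFinite.Build _ nat R
  (@counting nat R) (sigma_finite_counting R).

Section NatProduct.
Context d (T : measurableType d) (R : realType).

Lemma measurable_nat_prod d' (U : measurableType d') (f : nat * T -> U) :
  (forall n, measurable_fun setT (fun x => f (n, x))) -> measurable_fun setT f.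
Proof.
move=> mf _ B mB; rewrite setTI.
have -> : f @^-1` B = \bigcup_n ([set n] `*` ((fun x => f (n, x)) @^-1` B)).
  apply/seteqP; split=> [[n x] Bnx|[n x] [m _ [/= -> ]]//]; by exists n.
apply: bigcupT_measurable => n; apply: measurableX => //.
by rewrite -[_ @^-1` _]setTI; exact: mf.
Qed.

Lemma cmeasurable_nat_prod (f : nat * T -> R[i]) :
  (forall n, cmeasurable (fun x => f (n, x))) -> cmeasurable f.
Proof. by move=> mf; split; apply: measurable_nat_prod => n; have [] := mf n. Qed.

Lemma cmeasurable_nat (f : nat -> R[i]) : cmeasurable f.
Proof. by []. Qed.

End NatProduct.

(** * Sums over an enumerated set *)

Section DiscreteSum.
Context (R : realType) (T : choiceType) (S : set T) (D : set nat) (e : nat -> T).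
Hypothesis e_bij : set_bij D S e.
Local Notation cnt := (@counting nat R).
Local Notation normc := Normc.normc.
Implicit Types (f h : T -> R[i]) (r : T -> R).

(** Terms off the index set are zero, so finite and infinite groups are treated alike. *)
Definition gterm (V : nmodType) (f : T -> V) n : V := if n \in D then f (e n) else 0.

Lemma e_in n : n \in D -> S (e n).
Proof. by rewrite inE => nD; have [fS _ _] := e_bij; exact: fS. Qed.

Lemma ge0_integral_gterm (a : T -> \bar R) : (forall g, S g -> 0 <= a g)%E ->
  (\int[cnt]_n (if n \in D then a (e n) else 0) = \esum_(g in S) a g)%E.
Proof.
move=> a0; rewrite ge0_integral_count; last first.
  by move=> n; case: ifPn => // /e_in; exact: a0.
rewrite nneseries_esumT; last by move=> n; case: ifPn => // /e_in; exact: a0.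
by rewrite -esum_mkcond (@reindex_esum R _ _ _ _ _ a e_bij).
Qed.

(** The right side does not refer to the enumeration; this is what makes [gsum] invariant under
    bijections of [S]. *)
Lemma Rintegral_gterm r : \int[cnt]_n gterm r n =
  fine (\esum_(g in S) (Num.max (r g) 0)%:E - \esum_(g in S) (Num.max (- r g) 0)%:E)%E.
Proof.
rewrite /Rintegral integralE; congr fine; congr (_ - _)%E.
  rewrite -ge0_integral_gterm; last by move=> g _; rewrite lee_fin le_max lexx orbT.
  apply: eq_integral => n _; rewrite funeposE /gterm; case: ifP => // _.
    by rewrite EFin_max.
  by rewrite maxxx.
rewrite -ge0_integral_gterm; last by move=> g _; rewrite lee_fin le_max lexx orbT.
apply: eq_integral => n _; rewrite funenegE /gterm; case: ifP => // _.
  by rewrite EFin_max.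
by rewrite oppe0 maxxx.
Qed.

Definition gsum f : R[i] := cint cnt (gterm f).
Definition gsummable f := cintegrable cnt (gterm f).

Lemma gsummableP f : gsummable f <-> (\esum_(g in S) (normc (f g))%:E < +oo)%E.
Proof.
have E : (\int[cnt]_n `|(normc (gterm f n))%:E| = \esum_(g in S) (normc (f g))%:E)%E.
  rewrite -ge0_integral_gterm; last by move=> g _; rewrite lee_fin normc_ge0.
  apply: eq_integral => n _; rewrite /gterm; case: ifP => _; last by rewrite Normc.normc0 abse0.
  by rewrite gee0_abs// lee_fin normc_ge0.
rewrite -E; split=> [/integrable_normc/integrableP[]//|lty].
apply: cintegrable_normcP; first exact: cmeasurable_nat.
by apply/integrableP; split.
Qed.

Lemma le_gsummable (C : R) f h : (forall g, S g -> normc (f g) <= C * normc (h g)) ->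
  gsummable h -> gsummable f.
Proof.
move=> fh Ih; apply: (@le_cintegrable _ _ _ _ _ (fun n => C * normc (gterm h n))).
- exact: cmeasurable_nat.
- by have := integrable_normc Ih => /(integrableZl measurableT C).
- move=> n; rewrite /gterm; case: ifPn => [/e_in|_]; first exact: fh.
  by rewrite Normc.normc0 mulr0.
Qed.

Lemma eq_gsum f h : (forall g, S g -> f g = h g) -> gsum f = gsum h.
Proof.
move=> fh; apply: eq_cint => n; rewrite /gterm; case: ifPn => // /e_in; exact: fh.
Qed.

Lemma gsumD f h : gsummable f -> gsummable h ->
  gsum (fun g => f g + h g) = gsum f + gsum h.
Proof.
move=> If Ih; rewrite -cintD//; apply: eq_cint => n.
by rewrite /gterm; case: ifP => // _; rewrite addr0.
Qed.

Lemma gsumZ c f : gsummable f -> gsum (fun g => c * f g) = c * gsum f.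
Proof.
move=> If; rewrite -cintZ//; apply: eq_cint => n.
by rewrite /gterm; case: ifP => // _; rewrite mulr0.
Qed.

Lemma gsum_reindex (s : T -> T) f : set_bij S S s -> gsum (fun g => f (s g)) = gsum f.
Proof.
move=> s_bij; rewrite /gsum /cint.
have re (r : T -> R) : \int[cnt]_n gterm (fun g => r (s g)) n = \int[cnt]_n gterm r n.
  rewrite !Rintegral_gterm; congr (fine (_ - _)%E); apply/esym.
    exact: (@reindex_esum R _ _ _ _ _ (fun g => (Num.max (r g) 0)%:E) s_bij).
  exact: (@reindex_esum R _ _ _ _ _ (fun g => (Num.max (- r g) 0)%:E) s_bij).
have part (p : R[i] -> R) k n : p 0 = 0 -> p (gterm k n) = gterm (fun g => p (k g)) n.
  by move=> p0; rewrite /gterm; case: ifP.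
have re' (p : R[i] -> R) : p 0 = 0 ->
    \int[cnt]_n p (gterm (fun g => f (s g)) n) = \int[cnt]_n p (gterm f n).
  move=> p0; transitivity (\int[cnt]_n gterm (fun g => p (f (s g))) n).
    by apply: eq_Rintegral => n _; exact: part.
  rewrite (re (fun g => p (f g))).
  by apply: eq_Rintegral => n _; rewrite part.
by congr (_ +i* _); exact: re'.
Qed.

Lemma Re_gsum f : complex.Re (gsum f) = \int[cnt]_n gterm (fun g => complex.Re (f g)) n.
Proof. by apply: eq_Rintegral => n _; rewrite /gterm; case: ifP. Qed.

Lemma gterm_delta r g0 : S g0 -> \int[cnt]_n gterm (fun g => if g == g0 then r g else 0) n = r g0.
Proof.
move=> Sg0.
have d0 (q : R) : 0 <= q -> (\esum_(g in S) (if g == g0 then q else 0)%:E = q%:E)%E.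
  move=> q0; rewrite -[RHS](@esum_set1 _ _ g0 (fun=> q%:E))//.
  have -> : [set g0] = S `&` [set g0].
    by apply/seteqP; split=> [x /= ->|x [_]].
  rewrite esum_mkcondr; apply: eq_esum => g _.
  by rewrite (_ : (g \in [set g0]) = (g == g0)) ?if_arg; [case: ifP|apply/idP/eqP; rewrite inE].
rewrite Rintegral_gterm.
have E (q : R) g : Num.max (if g == g0 then q else 0) 0 = if g == g0 then Num.max q 0 else 0.
  by case: ifP => // _; rewrite maxxx.
have -> : (\esum_(g in S) (Num.max (if g == g0 then r g else 0) 0)%:E = (Num.max (r g0) 0)%:E)%E.
  rewrite -d0 ?le_max ?lexx ?orbT//; apply: eq_esum => g _.
  by case: eqVneq => [->//|_]; rewrite maxxx.
have -> : (\esum_(g in S) (Num.max (- (if g == g0 then r g else 0)) 0)%:E = (Num.max (- r g0) 0)%:E)%E.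
  rewrite -d0 ?le_max ?lexx ?orbT//; apply: eq_esum => g _.
  by case: eqVneq => [->//|_]; rewrite oppr0 maxxx.
rewrite -EFinB /=; have [r0|r0] := leP 0 (r g0).
  by rewrite (max_idPr _) ?oppr_le0// subr0.
by rewrite (max_idPl _) ?oppr_ge0 ?(ltW r0)// sub0r opprK.
Qed.

End DiscreteSum.

Section PlaneMeasure.
Variable R : realType.
Local Notation mu := (@lebesgue_measure R).
Local Notation T1 := (measurableTypeR R).
Local Notation T2 := (T1 * T1)%type.

(* an alias of the product measure that carries a sigma-finite structure *)
Definition plane_measure : set T2 -> \bar R := (mu \x mu)%E.

HB.instance Definition _ := isMeasure.Build _ T2 R plane_measure
  (measure0 (mu \x mu)%E) (measure_ge0 (mu \x mu)%E)
  (@measure_semi_sigma_additive _ _ _ (mu \x mu)%E).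

Lemma sigma_finite_plane_measure : sigma_finite setT plane_measure.
Proof.
have /sigma_finiteP[F [TF ndF Foo]] := sigma_finiteT mu.
exists (fun n => F n `*` F n).
 rewrite -setXTT TF predeqE => -[x y]; split.
    move=> [/= [n _ Fnx] [k _ Gky]]; exists (maxn n k) => //; split.
    - by move: x Fnx; exact/subsetPset/ndF/leq_maxl.
    - by move: y Gky; exact/subsetPset/ndF/leq_maxr.
  by move=> [n _ []/= ? ?]; split; exists n.
move=> k; have [? ?] := Foo k.
split; first exact: measurableX.
by rewrite /plane_measure product_measure1E// lte_mul_pinfty// ge0_fin_numE.
Qed.

HB.instance Definition _ := Measure_isSigmaFinite.Build _ T2 R plane_measure
  sigma_finite_plane_measure.

End PlaneMeasure.

Lemma esum_delta (R : realType) (T : choiceType) (S : set T) (g0 : T) (a : T -> \bar R) :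
  S g0 -> (0 <= a g0)%E -> (forall g, S g -> g != g0 -> a g = 0%E) ->
  (\esum_(g in S) a g = a g0)%E.
Proof.
move=> Sg0 a0 az; rewrite -[RHS]esum_set1//.
have -> : [set g0] = S `&` [set g0] by apply/seteqP; split=> [x /= ->|x [_]].
rewrite esum_mkcondr; apply: eq_esum => g Sg.
by case: ifPn => // /negP; rewrite inE => /eqP gg0; rewrite az.
Qed.

Lemma moebius_coords (R : realType) (a b c d x y : R) : a * d - b * c = 1 -> 0 < y ->
  (a%:C * (x +i* y) + b%:C) / (c%:C * (x +i* y) + d%:C) =
  (moebius_pair a b c d (x, y)).1 +i* (moebius_pair a b c d (x, y)).2.
Proof.
move=> adbc y0; have n0 : (c * x + d) ^+ 2 + (c * y) ^+ 2 != 0.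
  apply/negP; rewrite paddr_eq0 ?sqr_ge0// !sqrf_eq0 mulf_eq0 (gt_eqF y0) orbF.
  move=> /andP[+ /eqP c0]; rewrite c0 mul0r add0r => /eqP d0.
  by move: adbc; rewrite c0 d0 !mulr0 subrr => /esym/eqP; rewrite oner_eq0.
apply/eqP; rewrite eq_complex /moebius_pair /= !mul0r !subr0 !addr0.
apply/andP; split; apply/eqP; first by field.
transitivity ((a * d - b * c) * y / ((c * x + d) ^+ 2 + (c * y) ^+ 2)); first by field.
by rewrite adbc mul1r.
Qed.

Lemma pair_complex_inj (R : realType) (p q : measurableTypeR R * measurableTypeR R) :
  p.1 +i* p.2 = q.1 +i* q.2 :> R[i] -> p = q.
Proof. by case: p q => a b [c d] /= [-> ->]. Qed.

(** * Unfolding over a fundamental domain *)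

Section Unfolding.
Variables (R : realType) (G : groupClosed (PSL2 R)) (F : set (uhp R)).
Variables (D : set nat) (e : nat -> PSL2 R).
Hypothesis e_bij : set_bij D [set g | g \in G] e.
Hypothesis no_ellipticG : forall g : PSL2 R, g \in G -> ~ elliptic g.
Hypothesis fundF : fundamental_domain G F.
Local Notation mu := (@lebesgue_measure R).
Local Notation T1 := (measurableTypeR R).
Local Notation T2 := (T1 * T1)%type.
Local Notation cnt := (@counting nat R).
Local Notation mu2 := (@plane_measure R).
Implicit Types (g : PSL2 R) (p : T2) (z : uhp R).

Definition act_pair g p : T2 := let A := val (repr g) in
  moebius_pair (A ord0 ord0) (A ord0 ord_max) (A ord_max ord0) (A ord_max ord_max) p.

Lemma measurable_act_pair g : measurable_fun setT (act_pair g).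
Proof. exact: measurable_moebius_pair. Qed.

Lemma act_pair_val g z p : val z = p.1 +i* p.2 ->
  val (act g z) = (act_pair g p).1 +i* (act_pair g p).2.
Proof.
move=> zE; have y0 : 0 < p.2 by have := imz_gt0 z; rewrite /imz zE.
rewrite /act_pair [in RHS](surjective_pairing p) -(moebius_coords _ (SL2_adbc (repr g)) y0).
by rewrite -zE.
Qed.

Lemma act_pairM g h p : 0 < p.2 -> act_pair (g * h)%g p = act_pair g (act_pair h p).
Proof.
move=> /uhp_pair[z zE].
have E1 := act_pair_val (g * h)%g zE.
have E2 := act_pair_val g (act_pair_val h zE).
by apply: pair_complex_inj; rewrite -E1 -E2 actM.
Qed.

Lemma act_pair1 p : 0 < p.2 -> act_pair 1%g p = p.
Proof.
by move=> /uhp_pair[z zE]; apply: pair_complex_inj; rewrite -(act_pair_val 1%g zE) act1.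
Qed.

Lemma coords_val z p : val z = p.1 +i* p.2 -> coords F p <-> F z.
Proof.
move=> zE; split=> [[z' Fz' z'E]|Fz]; last by exists z.
by have <- : z' = z by apply: val_inj; rewrite z'E zE.
Qed.

Lemma coords_pos p : coords F p -> 0 < p.2.
Proof. by move=> [z _ zE]; have := imz_gt0 z; rewrite /imz zE. Qed.

(** Existence comes from the surjectivity of [F] onto the quotient, uniqueness from its injectivity
    together with [act_free]. *)
Lemma coords_cover p : 0 < p.2 -> exists g, [/\ g \in G, coords F (act_pair g^-1%g p) &
  forall h, h \in G -> coords F (act_pair h^-1%g p) -> h = g].
Proof.
move=> /uhp_pair[z zE]; have [_ [_ Finj Fsurj]] := fundF.
have [z' Fz' zz'] : exists2 z', F z' & \pi_(quot_uhp G) z' = \pi_(quot_uhp G) z.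
  by have [z' Fz' <-] := Fsurj (\pi_(quot_uhp G) z) I; exists z'.
have /eqmodP/asboolP[g gG zE'] := zz'.
have Fact h : coords F (act_pair h^-1%g p) <-> F (act h^-1%g z).
  by apply: coords_val; exact: act_pair_val.
exists g; split=> //; first by apply/Fact; rewrite zE' -actM mulVg act1.
move=> h hG /Fact Fh.
have hz : act h^-1%g z = z'.
  apply: Finj => //; rewrite ?inE// zz'; apply/eqmodP/asboolP.
  by exists h => //; rewrite -actM mulgV act1.
have hgG : (h^-1 * g)%g \in G by apply: gpredM => //; exact: gpredVr.
have : act (h^-1 * g)%g z' = z' by rewrite actM -zE' hz.
move=> /(act_free no_ellipticG hgG) /(congr1 (fun x => h * x)%g).
by rewrite mulgA mulgV mul1g mulg1.
Qed.

Lemma mcoords : measurable (coords F). Proof. by have [] := fundF. Qed.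

Definition indF p : R := \1_(coords F) p.

Lemma measurable_indF : measurable_fun setT indF.
Proof. exact: measurable_indic mcoords. Qed.

Lemma indF_ge0 p : 0 <= indF p. Proof. by rewrite /indF indicE. Qed.

Lemma hyp_int_act g (f : T2 -> \bar R) : measurable_fun setT f ->
  (forall p, 0 <= f p)%E -> hyp_int (fun p => f (act_pair g p)) = hyp_int f.
Proof. by move=> mf f0; exact: hyp_int_moebius (SL2_adbc _) mf f0. Qed.

(** The indicators of the translates of [F] sum to 1 on the half-plane. Inserting this sum,
    exchanging it with the integral and moving each slice back to [F] by invariance gives the right
    side. *)
Lemma hyp_int_unfold (f : T2 -> \bar R) : measurable_fun setT f ->
  (forall p, 0 <= f p)%E ->
  (hyp_int f = \int[cnt]_n (if n \in D then
     hyp_int (fun p => f (act_pair (e n) p) * (indF p)%:E) else 0))%E.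
Proof.
move=> mf f0.
pose k (q : nat * T2) : \bar R := (if q.1 \in D then
  f q.2 * (indF (act_pair (e q.1)^-1%g q.2))%:E * (hyp_weight q.2.2)%:E else 0)%E.
have mk1 g : measurable_fun setT (fun p => f p * (indF (act_pair g p))%:E)%E.
  apply: emeasurable_funM => //; apply/measurable_EFinP.
  by apply: measurableT_comp; [exact: measurable_indF|exact: measurable_act_pair].
have mk : measurable_fun setT k.
  apply: measurable_nat_prod => n; rewrite /k /=; case: (n \in D); last exact: measurable_cst.
  exact: measurable_mul_hyp_weight.
have k0 q : (0 <= k q)%E.
  rewrite /k; case: ifP => // _; apply: mule_ge0; last by rewrite lee_fin hyp_weight_ge0.
  by rewrite mule_ge0// lee_fin indF_ge0.
transitivity (\int[mu2]_p \int[cnt]_n k (n, p))%E.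
  apply: eq_integral => p _; rewrite /k /=.
  have [p0|p0] := ltP 0 p.2; last first.
    rewrite /hyp_weight ltNge p0 mule0 integral0_eq// => n _.
    by case: ifP => // _; rewrite mule0.
  have [g [gG Fg gu]] := coords_cover p0.
  pose a (h : PSL2 R) : \bar R := (f p * (indF (act_pair h^-1%g p))%:E * (hyp_weight p.2)%:E)%E.
  have a0 h : (0 <= a h)%E.
    by rewrite !mule_ge0// lee_fin ?indF_ge0 ?hyp_weight_ge0.
  rewrite (ge0_integral_gterm e_bij (a := a))// (@esum_delta _ _ _ g)//.
    by rewrite /a /indF indicE mem_set// mule1.
  move=> h hG hg; rewrite /a /indF indicE memNset ?mule0 ?mul0e// => /(gu _ hG) hE.
  by rewrite hE eqxx in hg.
rewrite -(@fubini_tonelli _ _ _ _ R cnt mu2 k mk k0); apply: eq_integral => n _.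
rewrite /k /=; case: (n \in D); last by rewrite integral0.
rewrite -(hyp_int_act (e n)^-1%g); last 2 first.
- apply: emeasurable_funM; last by apply/measurable_EFinP; exact: measurable_indF.
  exact: measurableT_comp (measurable_act_pair _).
- by move=> p; rewrite mule_ge0// lee_fin indF_ge0.
by apply: eq_hyp_int => p p0; rewrite -act_pairM// mulgV act_pair1.
Qed.

Lemma Rhyp_int_act g (v : T2 -> R) : measurable_fun setT v ->
  \int[mu2]_p (v (act_pair g p) * hyp_weight p.2) =
  \int[mu2]_p (v p * hyp_weight p.2).
Proof.
move=> mv; rewrite /Rintegral integralE [in RHS]integralE; congr (fine (_ - _)%E).
  transitivity (hyp_int (fun p => (Num.max (v (act_pair g p)) 0)%:E)).
    apply: eq_integral => p _; rewrite funeposE -EFinM -EFin_max maxr_pMl ?hyp_weight_ge0//.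
    by rewrite mul0r.
  rewrite (hyp_int_act g (f := fun p => (Num.max (v p) 0)%:E)).
  - apply: eq_integral => p _; rewrite funeposE -EFinM -EFin_max maxr_pMl ?hyp_weight_ge0//.
    by rewrite mul0r.
  - by apply/measurable_EFinP; exact: measurable_maxr.
  - by move=> p; rewrite lee_fin le_max lexx orbT.
transitivity (hyp_int (fun p => (Num.max (- v (act_pair g p)) 0)%:E)).
  apply: eq_integral => p _; rewrite funenegE -EFinN -mulNr -EFin_max -EFinM maxr_pMl ?hyp_weight_ge0//.
  by rewrite mul0r.
rewrite (hyp_int_act g (f := fun p => (Num.max (- v p) 0)%:E)).
- apply: eq_integral => p _; rewrite funenegE -EFinN -mulNr -EFin_max -EFinM maxr_pMl ?hyp_weight_ge0//.
  by rewrite mul0r.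
- by apply/measurable_EFinP; apply: measurable_maxr => //; exact: measurable_funN.
- by move=> p; rewrite lee_fin le_max lexx orbT.
Qed.

Section Signed.
Variable u : T2 -> R.
Hypothesis measurable_u : measurable_fun setT u.
Hypothesis u_int : (hyp_int (fun p => `|u p|%:E) < +oo)%E.

Definition unfolded (q : nat * T2) : R := if q.1 \in D then
  u (act_pair (e q.1) q.2) * (indF q.2 * hyp_weight q.2.2) else 0.

(** The slices before the change of variable: the group element acts in the indicator instead of in
    [u]. *)
Let k (q : nat * T2) : R := if q.1 \in D then
  u q.2 * indF (act_pair (e q.1)^-1%g q.2) * hyp_weight q.2.2 else 0.

Let measurable_weight : measurable_fun setT (fun p : T2 => hyp_weight p.2).
Proof. by apply: measurableT_comp; [exact: measurable_hyp_weight|exact: measurable_snd]. Qed.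

Let measurable_slice g : measurable_fun setT (fun p => u p * indF (act_pair g p)).
Proof.
apply: measurable_funM => //.
by apply: measurableT_comp; [exact: measurable_indF|exact: measurable_act_pair].
Qed.

Lemma measurable_unfolded : measurable_fun setT unfolded.
Proof.
apply: measurable_nat_prod => n; rewrite /unfolded /=.
case: (n \in D); last exact: measurable_cst.
apply: measurable_funM; first by apply: measurableT_comp => //; exact: measurable_act_pair.
by apply: measurable_funM; [exact: measurable_indF|exact: measurable_weight].
Qed.

Let measurable_k : measurable_fun setT k.
Proof.
apply: measurable_nat_prod => n; rewrite /k /=; case: (n \in D); last exact: measurable_cst.
by apply: measurable_funM; [exact: measurable_slice|exact: measurable_weight].
Qed.

Let abs_weight (x : R) p : (`|x * hyp_weight p.2|%:E = `|x|%:E * (hyp_weight p.2)%:E)%E.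
Proof. by rewrite normrM [`|hyp_weight _|]ger0_norm ?hyp_weight_ge0. Qed.

Lemma integrable_unfolded : (cnt \x mu2)%E.-integrable setT (fun q => (unfolded q)%:E).
Proof.
apply: integrable_prod_lty; first exact: measurable_unfolded.
rewrite [X in (X < _)%E](_ : _ = hyp_int (fun p => `|u p|%:E))//.
rewrite hyp_int_unfold//; last by apply/measurable_EFinP; exact: measurableT_comp.
apply: eq_integral => n _; rewrite /unfolded /=; case: (n \in D).
  apply: eq_integral => p _; rewrite mulrA abs_weight normrM EFinM.
  by rewrite [`|indF p|]ger0_norm ?indF_ge0.
by rewrite integral0_eq// => p _; rewrite normr0.
Qed.

Let integrable_k : (cnt \x mu2)%E.-integrable setT (fun q => (k q)%:E).
Proof.
apply: integrable_prod_lty; first exact: measurable_k.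
rewrite [X in (X < _)%E](_ : _ = hyp_int (fun p => `|u p|%:E))//.
rewrite hyp_int_unfold//; last by apply/measurable_EFinP; exact: measurableT_comp.
apply: eq_integral => n _; rewrite /k /=; case: (n \in D); last first.
  by rewrite integral0_eq// => p _; rewrite normr0.
transitivity (hyp_int (fun p => `|u p * indF (act_pair (e n)^-1%g p)|%:E)).
  by apply: eq_integral => p _; rewrite abs_weight.
rewrite -(hyp_int_act (e n)) => [||p]; last by rewrite lee_fin.
  apply: eq_hyp_int => p p0; rewrite -act_pairM// mulVg act_pair1//.
  by rewrite normrM EFinM [`|indF p|]ger0_norm ?indF_ge0.
by apply/measurable_EFinP; apply: measurableT_comp => //; exact: measurable_slice.
Qed.

(** For signed [u] both exchanges are Fubini; the integrability of the two families of slices is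
    [hyp_int_unfold] for [|u|]. *)
Theorem unfolding : \int[mu2]_p (u p * hyp_weight p.2) =
  \int[mu2]_p \int[cnt]_n unfolded (n, p).
Proof.
rewrite -Rintegral_fubini; last exact: integrable_unfolded.
have kE n : \int[mu2]_p unfolded (n, p) = \int[mu2]_p k (n, p).
  rewrite /k /unfolded /=; case: (n \in D) => //.
  rewrite -(Rhyp_int_act (e n) (measurable_slice _)); apply: eq_Rintegral => p _.
  have [p0|p0] := ltP 0 p.2; last by rewrite /hyp_weight ltNge p0 !mulr0.
  by rewrite -act_pairM// mulVg act_pair1// mulrA.
transitivity (\int[cnt]_n \int[mu2]_p k (n, p)); last first.
  by apply: eq_Rintegral => n _; exact/esym/kE.
rewrite Rintegral_fubini; last exact: integrable_k.
apply: eq_Rintegral => p _; rewrite /k /=.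
have [p0|p0] := ltP 0 p.2; last first.
  rewrite /hyp_weight ltNge p0 mulr0 /Rintegral integral0_eq// => n _.
  by case: (n \in D); rewrite ?mulr0.
have [g [gG Fg gu]] := coords_cover p0.
rewrite -(gterm_delta e_bij (fun=> u p * hyp_weight p.2) gG).
apply: eq_Rintegral => n _; rewrite /gterm; case: ifPn => // nD; have eG := e_in e_bij nD.
rewrite /indF indicE; case: eqP => [->|ng]; first by rewrite mem_set// mulr1.
by rewrite memNset ?mulr0 ?mul0r// => /(gu _ eG).
Qed.

End Signed.
End Unfolding.

(** * Convergence of the kernel series *)

Section KernelSummable.
Variables (R : realType) (G : groupClosed (PSL2 R)) (F : set (uhp R)).
Variables (D : set nat) (e : nat -> PSL2 R).
Hypothesis e_bij : set_bij D [set g | g \in G] e.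
Hypothesis no_ellipticG : forall g : PSL2 R, g \in G -> ~ elliptic g.
Hypothesis fundF : fundamental_domain G F.
Local Notation mu := (@lebesgue_measure R).
Local Notation T1 := (measurableTypeR R).
Local Notation T2 := (T1 * T1)%type.
Local Notation cnt := (@counting nat R).
Local Notation mu2 := (@plane_measure R).
Local Notation normc := Normc.normc.
Implicit Types (g : PSL2 R) (p : T2) (z w : uhp R).

(** Extended-real valued, since its finiteness is what has to be shown. *)
Definition ker_sum4 z w : \bar R :=
  (\esum_(g in [set g | g \in G]) (normc (ker (repr g) z w)^-1 ^+ 4)%:E)%E.

Lemma ker_sum4_harnack z z' w : (ker_sum4 z w <=
  (((imz z + normc (val z' - val z)) / imz z) ^+ 4)%:E * ker_sum4 z' w)%E.
Proof.
have y0 := imz_gt0 z; set C := _ / _.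
have C0 : 0 <= C by rewrite divr_ge0 ?addr_ge0 ?normc_ge0 ?(ltW y0).
have a0 g z0 : (0 <= (normc (ker (repr g) z0 w)^-1 ^+ 4)%:E)%E.
  by rewrite lee_fin exprn_ge0// normc_ge0.
rewrite /ker_sum4 -!(ge0_integral_gterm e_bij)// -ge0_integralZl ?lee_fin ?exprn_ge0//; last first.
  by move=> n _; case: ifP.
apply: ge0_le_integral => // n _; do ?case: ifP => // _; rewrite ?mule0 ?mule_ge0 ?lee_fin ?exprn_ge0 ?normc_ge0//.
move: (e n) => g; rewrite -exprMn; apply: lerXn2r; rewrite ?nnegrE; [exact: normc_ge0|exact: mulr_ge0 C0 (normc_ge0 _)|].
have k0 : 0 < normc (ker (repr g) z w) by rewrite normc_gt0 ker_neq0.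
have k1 : 0 < normc (ker (repr g) z' w) by rewrite normc_gt0 ker_neq0.
rewrite !Normc.normcV ler_pdivlMr// mulrC ler_pdivrMr// /C mulrAC ler_pdivlMr//.
by rewrite [X in _ <= X]mulrC; exact: ker_harnackl.
Qed.

Lemma integral_ker4_gt0 w : (0 < \int[mu2]_p (ker4 w p)%:E)%E.
Proof.
set u := complex.Re (val w); set v := imz w.
have v0 : 0 < v by exact: imz_gt0.
pose S : set T2 := `[0, 1]%classic `*` `[1, 2]%classic.
have mS : measurable S by apply: measurableX; exact: measurable_itv.
have muS : mu2 S = 1%E.
  rewrite /plane_measure product_measure1E; try exact: measurable_itv.
  have itv (a b : R) : a < b -> mu `[a, b]%classic = (b - a)%:E.
    by move=> ab; rewrite lebesgue_measure_itv/= lte_fin ab.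
  transitivity ((1 - 0 : R)%:E * (2 - 1 : R)%:E)%E.
    by rewrite -(itv 0 1) ?ltr01// -(itv 1 2) ?ltr1n.
  by rewrite -EFinM; congr (_%:E); ring.
(* An upper bound for the squared modulus of [z - conj w] on the unit square [S]. *)
pose B := (1 + `|u|) ^+ 2 + (2 + v) ^+ 2.
have B0 : 0 < B by rewrite ltr_wpDl ?sqr_ge0// exprn_gt0// addr_gt0.
apply: (@lt_le_trans _ _ (\int[mu2]_(p in S) (B ^- 2)%:E)%E).
  by rewrite integral_cst// [X in (_ * X)%E](_ : _ = 1%E)// mule1 lte_fin invr_gt0 exprn_gt0.
apply: (@le_trans _ _ (\int[mu2]_(p in S) (ker4 w p)%:E)%E); last first.
  apply: ge0_subset_integral => //; first by apply/measurable_EFinP; exact: measurable_ker4.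
  by move=> p _; rewrite lee_fin /ker4; case: ifP => // _; rewrite exprn_ge0 ?normc_ge0.
apply: ge0_le_integral => //.
- by move=> p _; rewrite lee_fin invr_ge0 sqr_ge0.
- by apply: measurable_funTS; apply/measurable_EFinP; exact: measurable_ker4.
move=> [x y] [/=]; rewrite !in_itv/= => /andP[x0 x1] /andP[y1 y2].
have y0 : 0 < y by rewrite (lt_le_trans ltr01).
rewrite lee_fin /ker4 /= y0 kerp1 -[4%N]/(2 * 2)%N exprM Normc.normcV exprVn normc_sqr /= -/u -/v.
rewrite exprVn lef_pV2 ?posrE ?exprn_gt0//; last by rewrite ltr_wpDl ?sqr_ge0// exprn_gt0// addr_gt0.
rewrite lerXn2r ?nnegrE ?addr_ge0 ?sqr_ge0//; apply: lerD.
  rewrite -[X in X <= _]real_normK ?num_real// lerXn2r ?nnegrE ?addr_ge0//.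
  by apply: le_trans (ler_normB _ _) _; rewrite lerD2r ger0_norm.
by rewrite lerXn2r ?nnegrE ?addr_ge0 ?(ltW y0) ?(ltW v0)// lerD2r.
Qed.

Lemma ker4_act g w p z : val z = p.1 +i* p.2 ->
  ker4 w (act_pair g p) * (act_pair g p).2 ^+ 2 =
  normc (ker (repr g) z w)^-1 ^+ 4 * imz z ^+ 2.
Proof.
move=> zE; have gE := act_pair_val g zE.
have -> : (act_pair g p).2 = imz (act g z) by rewrite /imz gE.
have -> : ker4 w (act_pair g p) = normc (ker 1%g (act g z) w)^-1 ^+ 4.
  by rewrite /ker4 -(kerp_val _ _ gE) (_ : (act_pair g p).2 = imz (act g z)) ?imz_gt0// /imz gE.
have := kerMr 1%g (repr g) z w; rewrite mul1g => ->; rewrite imz_moebius.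
have d0 : normc (moebius_den (repr g) z) != 0 by rewrite normc_eq0 moebius_den_neq0.
rewrite !Normc.normcV Normc.normcM -[moebius _ z]/(act g z).
have k0 : normc (ker 1%g (act g z) w) != 0 by rewrite normc_eq0 ker_neq0.
by field; rewrite d0 k0.
Qed.

(** By Harnack the sum is finite at every [z] or at none. In the latter case unfolding equates the
    integral of [ker4] with that of the function [h], infinite on [F] and zero elsewhere; this
    integral is its own double, so being finite it is 0, against [integral_ker4_gt0]. *)
Theorem ker_sum4_lty z w : (ker_sum4 z w < +oo)%E.
Proof.
rewrite ltey; apply/eqP => zoo.
have Soo z' : ker_sum4 z' w = +oo%E.
  apply/eqP; rewrite -leye_eq -zoo leNgt; apply/negP => lt.
  have fin : (ker_sum4 z' w < +oo)%E by rewrite (lt_le_trans lt)// leey.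
  have := ker_sum4_harnack z z' w; rewrite zoo leNgt => /negP; apply.
  by rewrite lte_mul_pinfty// lee_fin exprn_even_ge0.
(* The factor [p.2 ^+ 2] cancels the hyperbolic density. *)
pose f p : \bar R := (ker4 w p * p.2 ^+ 2)%:E.
have k4 p : 0 <= ker4 w p by rewrite /ker4; case: ifP => // _; rewrite exprn_ge0 ?normc_ge0.
have f0 p : (0 <= f p)%E by rewrite lee_fin mulr_ge0 ?sqr_ge0.
have mf : measurable_fun setT f.
  apply/measurable_EFinP; apply: measurable_funM; first exact: measurable_ker4.
  by apply: measurable_funX; exact: measurable_snd.
have hf : hyp_int f = (\int[mu2]_p (ker4 w p)%:E)%E.
  apply: eq_integral => p _; rewrite /f /hyp_weight /ker4; case: ifPn => p0; last by rewrite mule0.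
  by rewrite -EFinM mulfK// expf_neq0// gt_eqF.
have fin : (\int[mu2]_p (ker4 w p)%:E < +oo)%E.
  have := integrable_ker4 w => /integrableP[_]; rewrite (_ : (\int[_]_x _)%E = (\int[mu2]_p (ker4 w p)%:E)%E)//.
  by apply: eq_integral => p _; rewrite gee0_abs ?lee_fin.
pose h p : \bar R := if p \in coords F then +oo%E else 0%E.
have mh : measurable_fun setT h.
  apply: (eq_measurable_fun (fun p => +oo * (indF F p)%:E)%E).
    by move=> p _; rewrite /h /indF indicE; case: (p \in coords F); rewrite ?mule1 ?mule0.
  by apply: emeasurable_funM; [exact: measurable_cst|apply/measurable_EFinP; exact: (measurable_indF fundF)].
have h0 p : (0 <= h p)%E by rewrite /h; case: ifP.
have hh : hyp_int f = (\int[mu2]_p h p)%E.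
  rewrite (hyp_int_unfold e_bij no_ellipticG fundF mf f0).
  pose k (q : nat * T2) : \bar R := (if q.1 \in D then
    f (act_pair (e q.1) q.2) * (indF F q.2)%:E * (hyp_weight q.2.2)%:E else 0)%E.
  have k0 q : (0 <= k q)%E.
    by rewrite /k; case: ifP => // _; rewrite !mule_ge0// lee_fin ?indF_ge0 ?hyp_weight_ge0.
  have mk : measurable_fun setT k.
    apply: measurable_nat_prod => n; rewrite /k /=; case: (n \in D); last exact: measurable_cst.
    apply: measurable_mul_hyp_weight; apply: emeasurable_funM.
      by apply: measurableT_comp => //; exact: measurable_act_pair.
    by apply/measurable_EFinP; exact: (measurable_indF fundF).
  transitivity (\int[cnt]_n \int[mu2]_p k (n, p))%E.
    by apply: eq_integral => n _; rewrite /k /=; case: (n \in D); rewrite ?integral0.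
  rewrite (@fubini_tonelli _ _ _ _ R cnt mu2 k mk k0); apply: eq_integral => p _.
  rewrite /h; case: ifPn => pF; last first.
    rewrite integral0_eq// => n _; rewrite /k /= /indF indicE (negbTE pF) mule0 mul0e.
    by case: ifP.
  move: (pF); rewrite inE => -[z' Fz' zE]; rewrite -(Soo z') /ker_sum4.
  rewrite -(ge0_integral_gterm e_bij) => [|g _]; last by rewrite lee_fin exprn_ge0// normc_ge0.
  apply: eq_integral => n _; rewrite /k /= /indF indicE pF mule1; case: ifP => // _.
  rewrite /f -EFinM (ker4_act _ _ zE); congr (_%:E).
  have -> : p.2 = imz z' by rewrite /imz zE.
  by rewrite /hyp_weight imz_gt0 mulfK// expf_neq0// gt_eqF// imz_gt0.
have hD : (\int[mu2]_p h p = \int[mu2]_p h p + \int[mu2]_p h p)%E.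
  rewrite -ge0_integralD//; apply: eq_integral => p _.
  by rewrite /h; case: ifP; rewrite ?adde0.
have := integral_ker4_gt0 w; rewrite -hf hh => pos.
have finh : (\int[mu2]_p h p)%E \is a fin_num.
  by rewrite -hh hf ge0_fin_numE// ltW// integral_ker4_gt0.
move: hD pos; rewrite -(fineK finh) -EFinD lte_fin => -[hD] pos.
by move: hD pos; lra.
Qed.

(** [ker_ge] bounds every term, so the powers beyond the fourth cost only a constant factor. *)
Lemma gsummable_ker z w n : (4 <= n)%N ->
  gsummable D e (fun g => (ker (repr g) z w)^-1 ^+ n).
Proof.
move=> n4; pose m := (4 * (imz z * imz w))^-1.
have m0 : 0 < m by rewrite invr_gt0 !mulr_gt0// imz_gt0.
apply: (@le_gsummable _ _ _ _ _ e_bij ((m + 1) ^+ (n - 4)) _ (fun g => (ker (repr g) z w)^-1 ^+ 4)); last first.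
  by apply/(gsummableP e_bij); under eq_esum do rewrite normcX; exact: ker_sum4_lty.
move=> g _; rewrite !normcX -{1}(subnK n4) exprD ler_wpM2r ?exprn_ge0 ?normc_ge0//.
apply: lerXn2r; rewrite ?nnegrE ?normc_ge0 ?addr_ge0 ?(ltW m0)//.
have : normc (ker (repr g) z w)^-1 ^+ 2 <= m.
  rewrite Normc.normcV exprVn lef_pV2 ?posrE ?exprn_gt0 ?normc_gt0 ?ker_neq0//; last by rewrite !mulr_gt0// imz_gt0.
  exact: ker_ge.
have := normc_ge0 (ker (repr g) z w)^-1; move: (normc _) => t t0 tm.
have [t1|t1] := leP t 1; first by move: m0; lra.
by apply: le_trans (_ : t ^+ 2 <= _); [rewrite expr2 ler_peMr// ltW|move: tm; lra].
Qed.

End KernelSummable.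

(** * Poincare series *)

Section PoincareSeries.
Variables (R : realType) (G : groupClosed (PSL2 R)) (F : set (uhp R)).
Variables (D : set nat) (e : nat -> PSL2 R).
Hypothesis e_bij : set_bij D [set g | g \in G] e.
Hypothesis no_ellipticG : forall g : PSL2 R, g \in G -> ~ elliptic g.
Hypothesis fundF : fundamental_domain G F.
Local Notation mu := (@lebesgue_measure R).
Local Notation T1 := (measurableTypeR R).
Local Notation T2 := (T1 * T1)%type.
Local Notation cnt := (@counting nat R).
Local Notation mu2 := (@plane_measure R).
Local Notation normc := Normc.normc.
Implicit Types (g : PSL2 R) (p : T2) (z w : uhp R) (k : nat).

Definition poincare n w z : R[i] := gsum D e (fun g => (ker (repr g) z w)^-1 ^+ n).

Lemma exprN_double (x : R[i]) k : (- x) ^+ (2 * k) = x ^+ (2 * k).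
Proof. by rewrite !exprM sqrrN. Qed.

(** Two representatives differ by a sign, which the even exponent absorbs. *)
Lemma ker_repr_pi A z w k :
  (ker (repr (\pi_(PSL2 R) A)) z w)^-1 ^+ (2 * k) = (ker A z w)^-1 ^+ (2 * k).
Proof.
have [E|E] := repr_PSL2 A; last by rewrite (ker_sign _ _ E) invrN exprN_double.
by rewrite /ker /moebius_num /moebius_den E.
Qed.

(** Right translation of the summation variable by the class of [A]; [kerMr] produces the factor of
    automorphy. *)
Lemma poincare_automorphic k w : (2 <= k)%N -> automorphic G k (poincare (2 * k) w).
Proof.
move=> k2 A z AG; set h := \pi_(PSL2 R) A in AG.
have k4 : (4 <= 2 * k)%N by rewrite -[4%N]/(2 * 2)%N leq_mul2l.
have h_bij : set_bij [set g | g \in G] [set g | g \in G] (fun g => g * h)%g.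
  split=> [g /= gG|g g' _ _ /(congr1 (fun x => x * h^-1)%g)|g /= gG].
  - exact: gpredM.
  - by rewrite -!mulgA mulgV !mulg1.
  - exists (g * h^-1)%g; last by rewrite -mulgA mulVg mulg1.
    by apply: gpredM => //; exact: gpredVr.
set c := moebius_den A z ^+ (2 * k).
transitivity (gsum D e (fun g => c * (ker (repr g) z w)^-1 ^+ (2 * k))); last first.
  by rewrite gsumZ//; exact: (gsummable_ker e_bij no_ellipticG fundF).
rewrite -(gsum_reindex e_bij (fun g => c * (ker (repr g) z w)^-1 ^+ (2 * k)) h_bij).
apply: (eq_gsum e_bij) => g gG.
have -> : (g * h)%g = \pi_(PSL2 R) (repr g * A)%g by rewrite PSL2_piM reprK.
rewrite ker_repr_pi kerMr invfM exprMn mulrCA -exprMn mulfV ?moebius_den_neq0//.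
by rewrite expr1n mulr1.
Qed.

(** * The Petersson norm of a Poincare series *)

Section Pairing.
Variables (k : nat) (w : uhp R).
Hypothesis k4 : (4 <= k)%N.
Local Notation n := (2 * k)%N.
Local Notation P := (poincare n w).

Let n8 : (8 <= n)%N. Proof. by rewrite -[8%N]/(2 * 4)%N leq_mul2l. Qed.
Let n4 : (4 <= n)%N. Proof. exact: leq_trans n8. Qed.
Let k2 : (2 <= k)%N. Proof. exact: leq_trans k4. Qed.

Definition pair_term (q : nat * T2) : R[i] :=
  if q.1 \in D then kernel_pair (repr (e q.1)) w n q.2 else 0.

Lemma cmeasurable_pair_term : cmeasurable pair_term.
Proof.
apply: cmeasurable_nat_prod => m; rewrite /pair_term /=; case: (m \in D).
  exact: cmeasurable_kernel_pair.
exact: cmeasurable_cst.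
Qed.

(** The bound [normc_kernel_pair_le] separates the variables: a power [n - 4] of a kernel at
    [(w, w)], times [ker4]. Its first factor is summable once [n - 4] is at least 4, which is the
    origin of [4 <= k]. *)
Lemma cintegrable_pair_term : cintegrable (cnt \x mu2)%E pair_term.
Proof.
pose c (m : nat) : R := normc (gterm D e (fun g => 2 ^+ (n - 4) * (((4 * imz w) ^- 2)%:C * (ker (repr g) w w)^-1 ^+ (n - 4))) m).
have c_int : cnt.-integrable setT (fun m => (c m)%:E).
  apply: integrable_normc; apply: (@le_gsummable _ _ _ _ _ e_bij (normc (2 ^+ (n - 4) * ((4 * imz w) ^- 2)%:C)) _ (fun g => (ker (repr g) w w)^-1 ^+ (n - 4))).
    by move=> g _; rewrite mulrA Normc.normcM.
  by apply: (gsummable_ker e_bij no_ellipticG fundF); rewrite leq_subRL.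
have k4_int : mu2.-integrable setT (fun p => (ker4 w p)%:E) := integrable_ker4 w.
apply: (le_cintegrable cmeasurable_pair_term (integrable_prodM c_int k4_int)).
move=> [m p] /=; rewrite /pair_term /c /gterm /=; case: ifP => _; last by rewrite !Normc.normc0 mul0r.
apply: le_trans (normc_kernel_pair_le _ _ _ n4) _.
rewrite !Normc.normcM !normcX normc_nat normc_real ger0_norm ?invr_ge0 ?sqr_ge0//.
by rewrite exprMn -!mulrA ler_wpM2l ?exprn_ge0// [X in X <= _]mulrCA.
Qed.

Lemma pair_term_sum z p : val z = p.1 +i* p.2 ->
  cint cnt (fun m => pair_term (m, p)) =
  (imz z ^+ (n - 2))%:C * (conjc ((ker 1%g z w)^-1 ^+ n) * P z).
Proof.
move=> zE; have y0 := imz_gt0 z.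
rewrite mulrA /poincare -gsumZ; last exact: (gsummable_ker e_bij no_ellipticG fundF).
apply: eq_cint => m; rewrite /pair_term /gterm /=; case: ifP => // _.
have pE : p.2 = imz z by rewrite /imz zE.
by rewrite /kernel_pair !(kerp_val _ _ zE) pE y0; ring.
Qed.

Lemma cint_pair_term : cint mu2 (fun p => cint cnt (fun m => pair_term (m, p))) =
  pairing_const R n * P w.
Proof.
rewrite -cint_fubini; last exact: cintegrable_pair_term.
rewrite /poincare -gsumZ; last exact: (gsummable_ker e_bij no_ellipticG fundF).
apply: eq_cint => m; rewrite /pair_term /gterm /=; case: (m \in D).
  exact: cint_kernel_pair.
by rewrite /cint /= /Rintegral !integral0_eq.
Qed.

(** The factor [p.2 ^+ 2] compensates [hyp_weight], which gives [unfolding] its form. *)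
Let u p : R := p.2 ^+ 2 * complex.Re (cint cnt (fun m => pair_term (m, p))).

Let u_weight p : u p * hyp_weight p.2 = complex.Re (cint cnt (fun m => pair_term (m, p))).
Proof.
rewrite /u /hyp_weight; case: ifPn => p0.
  by rewrite mulrAC mulfV ?mul1r// expf_neq0// gt_eqF.
rewrite mulr0 /= /Rintegral integral0_eq// => m _.
by rewrite /pair_term /kernel_pair /= (negbTE p0) if_same.
Qed.

Let measurable_u : measurable_fun setT u.
Proof.
apply: measurable_funM; first by apply: measurable_funX; exact: measurable_snd.
have [I1 _] := cintegrable_pair_term.
apply: (measurableT_comp (f := fine)) => //; exact: (measurable_fubini_G I1).
Qed.

Let u_int : (hyp_int (fun p => `|u p|%:E) < +oo)%E.
Proof.
have [I1 _] := cintegrable_pair_term.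
have [m1 _] := integrableP _ _ _ I1.
have H : (\int[mu2]_p \int[cnt]_m `|(complex.Re (pair_term (m, p)))%:E| < +oo)%E.
  by have [H1 _] := @integrable21ltyP _ _ _ _ R cnt mu2 _ m1; exact: H1 I1.
apply: le_lt_trans H; apply: ge0_le_integral => //.
- by move=> p _; rewrite mule_ge0// lee_fin hyp_weight_ge0.
- by apply: measurable_mul_hyp_weight; apply/measurable_EFinP; exact: measurableT_comp.
- have H2 : measurable_fun setT (fun q => `|(complex.Re (pair_term q))%:E|%E) by exact: measurableT_comp.
  exact: (@measurable_fun_fubini_tonelli_G _ _ _ _ R cnt _ H2 (fun q => abse_ge0 _)).
move=> p _; rewrite -[hyp_weight _]ger0_norm ?hyp_weight_ge0// -EFinM -normrM u_weight.
rewrite Re_cint; apply: (@le_trans _ _ `|\int[cnt]_m (complex.Re (pair_term (m, p)))%:E|%E).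
  by rewrite /Rintegral; case: (integral _ _ _) => [r| |] /=; rewrite ?leey// lexx.
by apply: le_abse_integral => //; exact: measurableT_comp.
Qed.

(** The plane integral of [P] against the conjugated term of the identity is known from
    [cint_pair_term]; folded onto [F], the translates of that term add up to the conjugate of
    [P]. *)
Theorem poincare_norm :
  hyp_integral F (fun z => normc (P z) ^+ 2 * imz z ^+ n) =
  complex.Re (pairing_const R n * P w).
Proof.
rewrite -cint_pair_term Re_cint.
transitivity (\int[mu2]_p (u p * hyp_weight p.2)); last first.
  by apply: eq_Rintegral => p _; exact: u_weight.
rewrite (unfolding e_bij no_ellipticG fundF measurable_u u_int).
rewrite /hyp_integral Rintegral_mkcond; apply: eq_Rintegral => p _.
rewrite patchE; case: ifPn => pF; last first.
  rewrite /Rintegral integral0_eq// => m _.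
  by rewrite /unfolded /= /indF indicE (negbTE pF) mul0r mulr0 if_same.
move: (pF); rewrite inE => -[z Fz zE].
have pE : p.2 = imz z by rewrite /imz zE.
have y0 := imz_gt0 z.
(* Both [P] and the term of the identity acquire a factor [j ^+ n], one of them conjugated; their
   product cancels against the denominator of [Y ^+ n]. *)
have uE g : g \in G -> u (act_pair g p) = complex.Re ((imz z ^+ n)%:C * conjc (P z) * (ker (repr g) z w)^-1 ^+ n).
  move=> gG; have gE := act_pair_val g zE.
  have pgE : (act_pair g p).2 = imz (act g z) by rewrite /imz gE.
  rewrite /u pgE (pair_term_sum gE); set Y := imz (act g z).
  pose j := moebius_den (repr g) z; have j0 : j != 0 by exact: moebius_den_neq0.
  have -> : P (act g z) = j ^+ n * P z.
    by apply: (poincare_automorphic w k2); rewrite reprK.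
  have -> : (ker 1%g (act g z) w)^-1 ^+ n = j ^+ n * (ker (repr g) z w)^-1 ^+ n.
    have := kerMr 1%g (repr g) z w; rewrite mul1g => ->.
    by rewrite -exprMn invfM mulrCA mulfV// mulr1.
  have YE : Y ^+ n = imz z ^+ n * (normc (j ^+ n) ^+ 2)^-1.
    by rewrite /Y imz_moebius expr_div_n normcX; congr (_ / _); rewrite exprAC.
  have Nj : normc (j ^+ n) ^+ 2 != 0 by rewrite expf_neq0// normc_eq0 expf_neq0.
  have ReZ (t : R) (x : R[i]) : t * complex.Re x = complex.Re (t%:C * x).
    by case: x => ? ?; rewrite /= mul0r subr0.
  have Rec (x : R[i]) : complex.Re (x^*%C) = complex.Re x by case: x.
  rewrite ReZ -[RHS]Rec; congr (complex.Re _).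
  rewrite mulrA -rmorphM -exprD subnKC; last exact: leq_trans n8.
  have cM (x y : R[i]) : (x * y)^*%C = x^*%C * y^*%C by exact: rmorphM.
  have cK (x : R[i]) : (x^*%C)^*%C = x by case: x => ? ?; rewrite /= opprK.
  have cR (t : R) : (t%:C)^*%C = t%:C by rewrite /= oppr0.
  rewrite YE ![in RHS]cM cK cR cM rmorphM /=.
  transitivity ((imz z ^+ n)%:C * ((normc (j ^+ n) ^+ 2)^-1)%:C * (j ^+ n * conjc (j ^+ n)) *
    (P z * conjc ((ker (repr g) z w)^-1 ^+ n))); first by ring.
  rewrite mul_conjc -[X in X * (P z * _)]mulrA -rmorphM mulVf// rmorph1 mulr1; ring.
rewrite /extend -zE valK /=.
transitivity (complex.Re (gsum D e (fun g => (hyp_weight p.2 * imz z ^+ n)%:C * conjc (P z) * (ker (repr g) z w)^-1 ^+ n))).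
  rewrite gsumZ; last exact: (gsummable_ker e_bij no_ellipticG fundF).
  rewrite -/(poincare n w z) -mulrA [conjc _ * _]mulrC mul_conjc -rmorphM /=.
  by rewrite pE /hyp_weight y0; ring.
rewrite Re_gsum; apply: eq_Rintegral => m _; rewrite /gterm /unfolded /=.
case: ifPn => // mD; have eG := e_in e_bij mD.
rewrite uE// /indF indicE pF mul1r.
rewrite [(hyp_weight _ * _)%:C]rmorphM -!mulrA; case: ((imz z ^+ n)%:C * _) => a b /=.
by rewrite mul0r subr0 mulrC.
Qed.

End Pairing.
End PoincareSeries.

Section DiscreteSummable.
Context (R : realType) (T : choiceType) (D : set nat) (e : nat -> T).
Implicit Types f h : T -> R[i].

Lemma gsummableD f h : gsummable D e f -> gsummable D e h ->
  gsummable D e (fun g => f g + h g).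
Proof.
move=> If Ih; rewrite /gsummable (_ : gterm _ _ _ = (fun n => gterm D e f n + gterm D e h n)).
  exact: cintegrableD.
by apply/funext => n; rewrite /gterm; case: ifP => // _; rewrite addr0.
Qed.

Lemma gsummableZ c f : gsummable D e f -> gsummable D e (fun g => c * f g).
Proof.
move=> If; rewrite /gsummable (_ : gterm _ _ _ = (fun n => c * gterm D e f n)).
  exact: cintegrableZ.
by apply/funext => n; rewrite /gterm; case: ifP => // _; rewrite mulr0.
Qed.

End DiscreteSummable.

(** * Second-order estimates for inverse powers *)

Section TaylorInverse.
Variable R : realType.
Local Notation normc := Normc.normc.

(** Induction on the exponent; the bound on [t] keeps [|1 + t|] at least 1/2, so the constant is
    uniform. *)
Lemma inv_pow_taylor n : exists2 C : R, 0 <= C & forall t : R[i], normc t <= 2^-1 ->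
  normc ((1 + t)^-1 ^+ n - 1 + n%:R * t) <= C * normc t ^+ 2.
Proof.
elim: n => [|n [C C0 IH]].
  by exists 0 => // t _; rewrite expr0 subrr mul0r addr0 Normc.normc0 mul0r.
exists (2 * C + 2 * n.+1%:R); first by rewrite addr_ge0 ?mulr_ge0.
move=> t t2; set v := (1 + t)^-1.
have h : 2^-1 <= normc (1 + t).
  have := le_normcB (1 + t) t; rewrite addrK Normc.normc1.
  by move: t2; lra.
have h0 : 0 < normc (1 + t) by apply: lt_le_trans h; rewrite invr_gt0.
have v2 : normc v <= 2 by rewrite Normc.normcV -[2]invrK lef_pV2 ?posrE// invr_gt0.
have vt : v * (1 + t) = 1 by rewrite mulVf// -normc_gt0.
have -> : v ^+ n.+1 - 1 + n.+1%:R * t =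
    v * (v ^+ n - 1 + n%:R * t) + n.+1%:R * (t ^+ 2 * v).
  have tE : t = v^-1 - 1 by rewrite /v invrK addrC addKr.
  have v0 : v != 0 by rewrite invr_eq0 -normc_gt0.
  by rewrite -[n.+1]addn1 natrD exprD expr1 tE; field.
have tt : 0 <= normc t ^+ 2 by rewrite exprn_ge0 ?normc_ge0.
apply: le_trans (le_normcD _ _) _; rewrite !Normc.normcM -expr2 normc_nat mulrDl.
apply: lerD.
  by rewrite -mulrA; apply: ler_pM; rewrite ?normc_ge0// IH.
rewrite mulrA -[X in _ <= X]mulrA [X in _ <= X]mulrC; exact: ler_wpM2l (mulr_ge0 (ler0n _ _) tt) _ _ v2.
Qed.

Lemma inv_pow_taylor_at n : exists2 C : R, 0 <= C & forall s d : R[i], s != 0 ->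
  normc d <= normc s / 2 ->
  normc ((s + d)^-1 ^+ n - s^-1 ^+ n + n%:R * d * s^-1 ^+ n.+1) <=
  C * normc (d / s) ^+ 2 * normc s^-1 ^+ n.
Proof.
have [C C0 H] := inv_pow_taylor n; exists C => // s d s0 ds.
have ns : 0 < normc s by rewrite normc_gt0.
have t2 : normc (d / s) <= 2^-1.
  by rewrite Normc.normcM Normc.normcV ler_pdivrMr// mulrC.
have -> : (s + d)^-1 ^+ n - s^-1 ^+ n + n%:R * d * s^-1 ^+ n.+1 =
    ((1 + d / s)^-1 ^+ n - 1 + n%:R * (d / s)) * s^-1 ^+ n.
  have -> : (s + d)^-1 = (1 + d / s)^-1 * s^-1 by rewrite -invfM mulrDl mul1r divfK.
  by rewrite exprMn exprS; ring.
by rewrite Normc.normcM normcX ler_wpM2r ?exprn_ge0 ?normc_ge0// H.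
Qed.

Lemma derivable_extend (f : uhp R -> R[i]) z (L : R[i]) (C d : R) : 0 < d ->
  (forall z', normc (val z' - val z) < d ->
    normc (f z' - f z - (val z' - val z) * L) <= C * normc (val z' - val z) ^+ 2) ->
  derivable (extend f : R[i]^o -> R[i]^o) (val z) 1.
Proof.
move=> d0 H; apply/cvg_ex; exists (L : R[i]^o).
apply/cvgrPdist_le => eps eps0.
have eE : eps = (complex.Re eps)%:C.
  by move: eps0; case: eps => a b; rewrite ltcE /= => /andP[/eqP -> _].
have e0 : 0 < complex.Re eps by move: eps0; rewrite eE ltcR.
(* Three constraints: the estimate [H] applies, [h + val z] stays in the half-plane, and [C * |h|]
   is at most [eps]. *)
pose del := Num.min (Num.min d (imz z)) (complex.Re eps / (`|C| + 1)).
have c0 : 0 < `|C| + 1 by rewrite ltr_wpDl.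
have del0 : 0 < del by rewrite /del !lt_min d0 imz_gt0 divr_gt0.
have del0' : (0 : R[i]) < del%:C by rewrite ltcR.
near=> h.
have h0 : h != 0 by near: h; exact: nbhs_dnbhs_neq.
have hd : normc h < del.
  have : `|h| < del%:C by near: h; exact: dnbhs0_lt.
  by rewrite normcE ltcR.
move: hd; rewrite /del !lt_min => /andP[/andP[hd hy] he].
have z'P : 0 < complex.Im (h + val z).
  rewrite ImD; have := normc_ge_absIm h; rewrite -/(imz z) ler_norml => /andP[h1 _].
  by move: h1 hy; lra.
pose z' : uhp R := exist _ (h + val z) z'P.
have z'E : val z' = h + val z by [].
have ext (x : uhp R) : extend f (val x) = f x by rewrite /extend valK.
have -> : (extend f \o shift (val z)) (h *: (1 : R[i]^o)) = f z'.
  by rewrite -ext z'E /= /GRing.scale /= mulr1.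
rewrite ext normcE eE lecR.
have hE : val z' - val z = h by rewrite z'E addrK.
have -> : L - h^-1 *: (f z' - f z : R[i]^o) = - (h^-1 * (f z' - f z - h * L)).
  by rewrite /GRing.scale /=; field.
rewrite normcN Normc.normcM Normc.normcV ler_pdivrMl ?normc_gt0//.
have := H z'; rewrite hE => /(_ hd) H'; apply: le_trans H' _.
rewrite expr2 mulrCA ler_wpM2l ?normc_ge0//.
move: he; rewrite ltr_pdivlMr// => he; apply: le_trans (ltW he).
rewrite mulrC ler_wpM2l ?normc_ge0//; apply: le_trans (ler_norm _) _.
by rewrite lerDl.
Unshelve. all: by end_near.
Qed.

End TaylorInverse.

(** * Poincare series are cusp forms *)

Section PoincareCuspForm.
Variables (R : realType) (G : groupClosed (PSL2 R)) (F : set (uhp R)).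
Variables (D : set nat) (e : nat -> PSL2 R).
Hypothesis e_bij : set_bij D [set g | g \in G] e.
Hypothesis fuchsianG : fuchsian G.
Hypothesis cocompactG : cocompact G.
Hypothesis no_ellipticG : forall g : PSL2 R, g \in G -> ~ elliptic g.
Hypothesis fundF : fundamental_domain G F.
Local Notation cnt := (@counting nat R).
Local Notation normc := Normc.normc.
Implicit Types (g : PSL2 R) (z w : uhp R) (k n : nat).

(** Termwise differentiation: the slope of each kernel is at most its modulus over [imz z], so every
    second-order remainder is at most a fixed multiple of [|h|^2] times the modulus of the term
    itself, and these are summable. *)
Lemma poincare_holomorphic n w : (4 <= n)%N -> holomorphic (poincare D e n w).
Proof.
move=> n4 z; have [K K0 KP] := @inv_pow_taylor_at R n.
have y0 := imz_gt0 z.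
pose L := gsum D e (fun g => - (n%:R * ker_slope (repr g) w * (ker (repr g) z w)^-1 ^+ n.+1)).
have slope g : normc (ker_slope (repr g) w) <= normc (ker (repr g) z w) / imz z.
  by rewrite ler_pdivlMr// mulrC; exact: slope_le_ker.
have S1 := gsummable_ker e_bij no_ellipticG fundF z w n4.
have SL : gsummable D e (fun g => - (n%:R * ker_slope (repr g) w * (ker (repr g) z w)^-1 ^+ n.+1)).
  apply: (@le_gsummable _ _ _ _ _ e_bij (n%:R / imz z) _ (fun g => (ker (repr g) z w)^-1 ^+ n)) => // g _.
  have k0 : normc (ker (repr g) z w) != 0 by rewrite normc_eq0 ker_neq0.
  rewrite normcN !Normc.normcM normc_nat exprS Normc.normcM -!mulrA ler_wpM2l//.
  rewrite [X in X <= _]mulrA ler_wpM2r ?normc_ge0// Normc.normcV.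
  by rewrite ler_pdivrMr ?normc_gt0 ?ker_neq0// mulrC.
pose M := \int[cnt]_m normc (gterm D e (fun g => (ker (repr g) z w)^-1 ^+ n) m).
(* The radius [imz z / 2] ensures [|slope * h| <= |ker| / 2], as the Taylor estimate requires; the
   factor 2 is that of [normc_cint_le]. *)
apply: (@derivable_extend _ _ _ L (2 * (K / imz z ^+ 2 * M)) (imz z / 2)) => [|z' zz'].
  by rewrite divr_gt0.
set h := val z' - val z.
have S2 := gsummable_ker e_bij no_ellipticG fundF z' w n4.
pose E g := (ker (repr g) z' w)^-1 ^+ n - (ker (repr g) z w)^-1 ^+ n
  + n%:R * (ker_slope (repr g) w * h) * (ker (repr g) z w)^-1 ^+ n.+1.
have Eb g : normc (E g) <= K / imz z ^+ 2 * normc h ^+ 2 * normc ((ker (repr g) z w)^-1 ^+ n).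
  have k0 : ker (repr g) z w != 0 by exact: ker_neq0.
  have nk0 : 0 < normc (ker (repr g) z w) by rewrite normc_gt0.
  have dk : normc (ker_slope (repr g) w * h) <= normc (ker (repr g) z w) * (normc h / imz z).
    by rewrite Normc.normcM mulrA mulrAC ler_wpM2r ?normc_ge0.
  have := KP (ker (repr g) z w) (ker_slope (repr g) w * h) k0.
  have -> : ker (repr g) z w + ker_slope (repr g) w * h = ker (repr g) z' w.
    by rewrite /h -ker_subl; ring.
  move=> /(_ _)/le_trans; apply.
    apply: le_trans dk _; rewrite ler_wpM2l ?(ltW nk0)// ler_pdivrMr// mulrC.
    exact: ltW.
  rewrite [normc (_^-1 ^+ n)]normcX ler_wpM2r ?exprn_ge0 ?normc_ge0//.
  rewrite [X in _ <= X](_ : _ = K * (imz z ^- 2 * normc h ^+ 2)); last by ring.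
  apply: ler_wpM2l => //; rewrite [X in _ <= X]mulrC -expr_div_n; apply: lerXn2r; rewrite ?nnegrE ?normc_ge0 ?divr_ge0 ?normc_ge0 ?(ltW y0)//.
  by rewrite [normc (_ / _)]Normc.normcM Normc.normcV ler_pdivrMr// [X in _ <= X]mulrC.
have SE : gsummable D e E.
  apply: (le_gsummable e_bij _ S1) => g _; exact: Eb.
have -> : poincare D e n w z' - poincare D e n w z - h * L = gsum D e E.
  transitivity (gsum D e (fun g => ((ker (repr g) z' w)^-1 ^+ n + (-1) * (ker (repr g) z w)^-1 ^+ n) +
     (- h) * - (n%:R * ker_slope (repr g) w * (ker (repr g) z w)^-1 ^+ n.+1))).
    have S3 := gsummableZ (-1) S1; have S4 := gsummableZ (- h) SL.
    rewrite gsumD// ?gsumD//; last exact: gsummableD.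
    by rewrite !gsumZ// mulN1r mulNr.
  by apply: (eq_gsum e_bij) => g _; rewrite /E; ring.
apply: le_trans (normc_cint_le SE) _; rewrite -!mulrA ler_wpM2l//.
have -> : K * (imz z ^- 2 * (M * normc h ^+ 2)) = (K / imz z ^+ 2 * normc h ^+ 2) * M by ring.
have NS := integrable_normc S1; have NE := integrable_normc SE.
set c := K / imz z ^+ 2 * normc h ^+ 2.
have <- : \int[cnt]_m (c * normc (gterm D e (fun g => (ker (repr g) z w)^-1 ^+ n) m)) = c * M.
  by rewrite RintegralZl.
apply: le_Rintegral => //; first by have := integrableZl measurableT c NS.
move=> m _; rewrite /gterm; case: ifP => _; first exact: Eb.
by rewrite !Normc.normc0 mulr0.
Qed.

Lemma poincare_cusp_form k w : (2 <= k)%N -> cusp_form G k (poincare D e (2 * k) w).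
Proof.
move=> k2; have k4 : (4 <= 2 * k)%N by rewrite -[4%N]/(2 * 2)%N leq_mul2l.
split; first exact: poincare_holomorphic.
  exact: (poincare_automorphic e_bij no_ellipticG fundF).
by move=> S /(no_cusp fuchsianG cocompactG no_ellipticG).
Qed.

End PoincareCuspForm.

(** * The Petersson product and orthonormal bases *)

Section PlaneMeasurable.
Variable R : realType.
Local Notation T1 := (measurableTypeR R).
Local Notation T2 := (T1 * T1)%type.
Local Notation normc := Normc.normc.
Implicit Types (p q : T2).

(** The countably many rational boxes contained in [U] cover it. *)
Lemma measurable_box_open (U : set T2) :
  (forall p, U p -> exists2 d : R, 0 < d &
    forall q, `|q.1 - p.1 : R| < d -> `|q.2 - p.2 : R| < d -> U q) ->
  measurable U.
Proof.
move=> openU.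
pose box (a b c d : rat) : set T2 := `]ratr a, ratr b[%classic `*` `]ratr c, ratr d[%classic.
have -> : U = \bigcup_a \bigcup_b \bigcup_c \bigcup_d
    (if `[< box a b c d `<=` U >] then box a b c d else set0).
  apply/seteqP; split=> [p /[dup] Up /openU[d d0 dU]|p [a _ [b _ [c _ [d _]]]]]; last first.
    by case: asboolP => // + bp; apply.
  have lo (x : R) : x - d < x by rewrite ltrBlDr ltrDl.
  have hi (x : R) : x < x + d by rewrite ltrDl.
  have [a /itvP aP] := rat_in_itvoo (lo p.1); have [b /itvP bP] := rat_in_itvoo (hi p.1).
  have [a' /itvP aP'] := rat_in_itvoo (lo p.2); have [b' /itvP bP'] := rat_in_itvoo (hi p.2).
  exists a => //; exists b => //; exists a' => //; exists b' => //.
  rewrite asboolT; first by rewrite /box /= !in_itv/= aP bP aP' bP'.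
  move=> q []; rewrite /= !in_itv/= => /andP[q1 q2] /andP[q3 q4].
  have l1 : p.1 - d < ratr a :> R by rewrite aP.
  have l2 : ratr b < p.1 + d :> R by rewrite bP.
  have l3 : p.2 - d < ratr a' :> R by rewrite aP'.
  have l4 : ratr b' < p.2 + d :> R by rewrite bP'.
  by apply: dU; rewrite ltr_norml; apply/andP; split; lra.
do 4! (apply: bigcupT_measurable_rat => ?).
by case: ifP => // _; apply: measurableX; exact: measurable_itv.
Qed.

Lemma measurable_fun_plane (D : set T2) (h : T2 -> R) :
  (forall p, D p -> forall eps : R, 0 < eps -> exists2 d : R, 0 < d &
    forall q, `|q.1 - p.1 : R| < d -> `|q.2 - p.2 : R| < d -> D q /\ `|h q - h p| < eps) ->
  measurable_fun D h.
Proof.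
move=> ch mD; apply: (measurability _ (RGenOpens.measurableE R)) => //.
move=> _ [_ [a [b ->] <-]]; apply: measurable_box_open => p [Dp /=]; rewrite in_itv/= => /andP[ap pb].
have eps0 : 0 < Num.min (h p - a) (b - h p) by rewrite lt_min !subr_gt0 ap.
have [d d0 dH] := ch p Dp _ eps0; exists d => // q q1 q2; have [Dq] := dH q q1 q2.
rewrite lt_min => /andP[h1 h2]; split=> //=; rewrite in_itv/=.
move: h1 h2; rewrite !ltr_norml => /andP[h1 _] /andP[_ h2].
by apply/andP; split; lra.
Qed.

Definition extend_pair (f : uhp R -> R[i]) p : R[i] := extend f (p.1 +i* p.2).

Lemma extend_pair_val f z p : val z = p.1 +i* p.2 -> extend_pair f p = f z.
Proof. by rewrite /extend_pair => <-; rewrite /extend valK. Qed.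

Lemma holomorphic_continuous (f : uhp R -> R[i]) z (eps : R) : holomorphic f -> 0 < eps ->
  exists2 d : R, 0 < d & forall z', normc (val z' - val z) < d -> normc (f z' - f z) < eps.
Proof.
move=> /(_ z)/derivable1_diffP/differentiable_continuous/cvgrPdist_lt H e0.
have e0' : (0 : R[i]) < eps%:C by rewrite ltcR.
have /nbhs_normP[d /= d0 dH] := H _ e0'.
have dE : d = (complex.Re d)%:C.
  by move: d0; case: d {dH} => a b; rewrite ltcE /= => /andP[/eqP -> _].
exists (complex.Re d); first by move: d0; rewrite dE ltcR.
move=> z' zz'; have ext (x : uhp R) : extend f (val x) = f x by rewrite /extend valK.
have := dH (val z'); rewrite /= !ext.
have dist (a b : R[i]) : `|a - b| = (normc (b - a))%:C by rewrite normcE -normcN opprB.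
by rewrite !dist dE !ltcR; apply.
Qed.

Lemma measurable_extend_pair (f : uhp R -> R[i]) : holomorphic f ->
  measurable_fun [set p : T2 | 0 < p.2] (fun p => complex.Re (extend_pair f p)) /\
  measurable_fun [set p : T2 | 0 < p.2] (fun p => complex.Im (extend_pair f p)).
Proof.
move=> hf.
suff H (c : R[i] -> R) : (forall x y, c (x - y) = c x - c y) -> (forall x, `|c x| <= normc x) ->
    measurable_fun [set p : T2 | 0 < p.2] (fun p => c (extend_pair f p)).
  split; apply: H => [x y|x]; rewrite ?normc_ge_absRe ?normc_ge_absIm//;
    by case: x => ? ?; case: y.
move=> cB cN; apply: measurable_fun_plane => p p0 eps e0.
have [z zE] := uhp_pair p0.
have [d d0 dH] := holomorphic_continuous z hf e0.
exists (Num.min (d / 2) p.2); first by rewrite lt_min p0 divr_gt0.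
move=> q; rewrite !lt_min => /andP[q1 _] /andP[q2 q2'].
have q0 : 0 < q.2 by move: q2'; rewrite ltr_norml => /andP[+ _]; lra.
split=> //; have [z' zE'] := uhp_pair q0.
rewrite (extend_pair_val f zE) (extend_pair_val f zE') -cB; apply: le_lt_trans (cN _) _.
apply: dH; rewrite zE zE'; apply: le_lt_trans (normc_le_absD _) _ => /=.
by move: q1 q2; lra.
Qed.

End PlaneMeasurable.

(** Lagrange's identity: the double sum of squares below equals [2 * (A * B - C ^+ 2)]. *)
Lemma sum_cauchy_schwarz (R : realType) d (a b : 'I_d -> R) :
  (\sum_(j < d) a j * b j) ^+ 2 <= (\sum_(j < d) a j ^+ 2) * (\sum_(j < d) b j ^+ 2).
Proof.
set A := \sum_(j < d) a j ^+ 2; set B := \sum_(j < d) b j ^+ 2; set C := \sum_(j < d) a j * b j.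
have : 0 <= \sum_(i < d) \sum_(j < d) (a i * b j - a j * b i) ^+ 2.
  by apply: sumr_ge0 => i _; apply: sumr_ge0 => j _; exact: sqr_ge0.
have -> : \sum_(i < d) \sum_(j < d) (a i * b j - a j * b i) ^+ 2 = A * B + A * B - 2 * C ^+ 2.
  transitivity (\sum_(i < d) \sum_(j < d) ((a i ^+ 2 * b j ^+ 2 + b i ^+ 2 * a j ^+ 2) + (- 2) * ((a i * b i) * (a j * b j)))).
    by apply: eq_bigr => i _; apply: eq_bigr => j _; ring.
  under eq_bigr do rewrite big_split /= -mulr_sumr big_split /=.
  rewrite big_split /= -mulr_sumr big_split /=.
  by rewrite -!big_distrlr /= -/A -/B -/C; ring.
by lra.
Qed.

(** * Lower bound for the Bergman sum from one cusp form *)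

Section Petersson.
Variables (R : realType) (G : groupClosed (PSL2 R)) (F : set (uhp R)) (k : nat).
Hypothesis fundF : fundamental_domain G F.
Local Notation T1 := (measurableTypeR R).
Local Notation T2 := (T1 * T1)%type.
Local Notation mu2 := (@plane_measure R).
Local Notation normc := Normc.normc.
Local Notation n := (2 * k)%N.
Implicit Types (f g : uhp R -> R[i]) (p : T2).

Definition petersson_term f g p : R[i] := if p \in coords F then
  extend_pair f p * conjc (extend_pair g p) * (p.2 ^+ n / p.2 ^+ 2)%:C else 0.

Lemma petersson_cint f g : petersson F k f g = cint mu2 (petersson_term f g).
Proof.
have H (c : R[i] -> R) : (forall (x : R[i]) (t : R), c (x * t%:C) = c x * t) -> c 0 = 0 ->
    hyp_integral F (fun z => c (f z * (g z)^* * (imz z ^+ n)%:C)) =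
    \int[mu2]_p c (petersson_term f g p).
  move=> cM c0; rewrite /hyp_integral Rintegral_mkcond; apply: eq_Rintegral => p _.
  rewrite patchE /petersson_term; case: ifPn => [|_]; last by rewrite c0.
  rewrite inE => -[z Fz zE]; rewrite !(extend_pair_val _ zE) -zE /extend valK /= !cM.
  by rewrite /imz zE mulrA.
by rewrite /petersson /cint; congr (_ +i* _); apply: H => // x t; case: x => a b /=;
  rewrite ?mulr0 ?subr0 ?add0r.
Qed.

Lemma cmeasurable_petersson_term f g : holomorphic f -> holomorphic g ->
  cmeasurable (petersson_term f g).
Proof.
move=> hf hg.
have ext h : holomorphic h -> cmeasurable (fun p : T2 => if 0 < p.2 then extend_pair h p else 0).
  move=> /measurable_extend_pair[h1 h2].
  have mp : measurable [set p : T2 | 0 < p.2].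
    by rewrite -[X in measurable X]setTI; exact: (@measurable_pos2 R measurableT [set true]).
  split.
    rewrite (_ : (fun _ => _) = (fun p => complex.Re (extend_pair h p)) \_ [set p : T2 | 0 < p.2]).
      exact/(measurable_restrictT _ mp).
    apply/funext => p; rewrite patchE.
    by case: ifPn => p0; [rewrite mem_set|rewrite memNset//; exact/negP].
  rewrite (_ : (fun _ => _) = (fun p => complex.Im (extend_pair h p)) \_ [set p : T2 | 0 < p.2]).
    exact/(measurable_restrictT _ mp).
  apply/funext => p; rewrite patchE.
  by case: ifPn => p0; [rewrite mem_set|rewrite memNset//; exact/negP].
have mf := ext _ hf; have mg := ext _ hg.
apply: (eq_cmeasurable (f := fun p => (indF F p)%:C * ((if 0 < p.2 then extend_pair f p else 0) *
    conjc (if 0 < p.2 then extend_pair g p else 0) * (p.2 ^+ n / p.2 ^+ 2)%:C))).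
  move=> p; rewrite /petersson_term /indF indicE; case: (boolP (p \in coords F)) => [pF|_]; last by rewrite mul0r.
  by rewrite mul1r (coords_pos (F := F)) //; rewrite inE in pF.
apply: cmeasurableM; first by apply: cmeasurable_real; exact: (measurable_indF fundF).
apply: cmeasurableM; first by apply: cmeasurableM => //; exact: cmeasurable_conj.
apply: cmeasurable_real; apply: measurable_funM.
  by apply: measurable_funX; exact: measurable_snd.
by apply: measurable_funV; apply: measurable_funX; exact: measurable_snd.
Qed.

Lemma petersson_term_diag f p :
  petersson_term f f p = (normc (petersson_term f f p))%:C.
Proof.
rewrite /petersson_term; case: ifPn => pF; last by rewrite Normc.normc0.
have p0 : 0 < p.2 by apply: (coords_pos (F := F)); rewrite inE in pF.
set c := p.2 ^+ n / p.2 ^+ 2; set x := extend_pair f p.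
have -> : x * conjc x * c%:C = (normc x ^+ 2 * c)%:C by rewrite mul_conjc [RHS]rmorphM.
rewrite normc_real ger0_norm// mulr_ge0 ?sqr_ge0//.
by rewrite divr_ge0 ?exprn_ge0 ?ltW.
Qed.

(** A divergent integral has real value 0 under [fine], so norm 1 forces convergence. *)
Lemma cintegrable_diag f : holomorphic f -> petersson F k f f = 1 ->
  cintegrable mu2 (petersson_term f f).
Proof.
move=> hf; rewrite petersson_cint => /(congr1 (@complex.Re R)); rewrite Re_cint => I1.
have mf := cmeasurable_petersson_term hf hf.
apply: cintegrable_normcP => //; apply/integrableP; split.
  by apply/measurable_EFinP; exact: measurable_normc.
move: I1; rewrite /Rintegral.
have -> : (\int[mu2]_p (complex.Re (petersson_term f f p))%:E =
    \int[mu2]_p `|(normc (petersson_term f f p))%:E|)%E.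
  apply: eq_integral => p _; rewrite {1}petersson_term_diag /=.
  by rewrite ger0_norm// normc_ge0.
by case: (integral _ _ _) => //= [r _|/eqP]; rewrite ?ltry// eq_sym oner_eq0.
Qed.

(** The majorant comes from [|a b| <= a^2 + b^2]. *)
Lemma cintegrable_petersson_term f g : holomorphic f -> holomorphic g ->
  cintegrable mu2 (petersson_term f f) -> cintegrable mu2 (petersson_term g g) ->
  cintegrable mu2 (petersson_term f g).
Proof.
move=> hf hg /integrable_normc If /integrable_normc Ig.
apply: (le_cintegrable (cmeasurable_petersson_term hf hg) (integrableD measurableT If Ig)) => p.
rewrite /petersson_term; case: ifPn => _; last by rewrite !Normc.normc0 addr0.
rewrite !Normc.normcM !normc_conj -mulrDl ler_wpM2r ?normc_ge0//.
have := normc_ge0 (extend_pair f p); have := normc_ge0 (extend_pair g p).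
move: (normc _) (normc _) => a b a0 b0.
have := sqr_ge0 (a - b); have := sqr_ge0 a; have := sqr_ge0 b; rewrite !expr2; lra.
Qed.

Lemma cint_sum (I : Type) (r : seq I) (h : I -> T2 -> R[i]) :
  (forall i, cintegrable mu2 (h i)) ->
  cintegrable mu2 (fun p => \sum_(i <- r) h i p) /\
  cint mu2 (fun p => \sum_(i <- r) h i p) = \sum_(i <- r) cint mu2 (h i).
Proof.
move=> Ih; elim: r => [|i r [IH1 IH2]].
  have -> : (fun p : T2 => \sum_(i <- [::]) h i p) = (fun=> 0).
    by apply/funext => p; rewrite big_nil.
  split; first by split; exact: integrable0.
  by rewrite big_nil /cint /Rintegral /= !integral0.
rewrite big_cons -IH2 -cintD//; split; last by apply: eq_cint => p; rewrite big_cons.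
have := cintegrableD (Ih i) IH1; congr (cintegrable _ _).
by apply/funext => p; rewrite big_cons.
Qed.

(** The integrand of the norm of [P] is expanded over the basis before integration, so its
    integrability follows from that of the pairs of basis elements, and orthonormality leaves the
    sum of the squared coefficients. *)
Theorem bergman_lower d (f : 'I_d -> uhp R -> R[i]) P w :
  orthonormal_basis G F k f -> cusp_form G k P ->
  normc (P w) ^+ 2 * imz w ^+ n <=
  hyp_integral F (fun z => normc (P z) ^+ 2 * imz z ^+ n) * bergman_sum k f w.
Proof.
move=> [fcusp forth fspan] Pcusp; have [c cP] := fspan _ Pcusp.
have fhol j : holomorphic (f j) by have [] := fcusp j.
have fint j : cintegrable mu2 (petersson_term (f j) (f j)).
  by apply: cintegrable_diag => //; rewrite forth eqxx.
have fint2 i j := cintegrable_petersson_term (fhol i) (fhol j) (fint i) (fint j).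
have normE : hyp_integral F (fun z => normc (P z) ^+ 2 * imz z ^+ n) =
    complex.Re (petersson F k P P).
  rewrite /petersson /=; congr (hyp_integral F _); apply/funext => z.
  have -> : P z * (P z)^* * (imz z ^+ n)%:C = (normc (P z) ^+ 2 * imz z ^+ n)%:C.
    by rewrite mul_conjc [RHS]rmorphM.
  by [].
have PE p : petersson_term P P p =
    \sum_(i < d) \sum_(j < d) c i * conjc (c j) * petersson_term (f i) (f j) p.
  rewrite /petersson_term; case: ifPn => [|_]; last first.
    by rewrite big1// => i _; rewrite big1// => j _; rewrite mulr0.
  rewrite inE => -[z Fz zE]; rewrite !(extend_pair_val _ zE) cP.
  rewrite (rmorph_sum (@conjc R)) /= big_distrlr /= mulr_suml; apply: eq_bigr => i _.
  rewrite mulr_suml; apply: eq_bigr => j _; rewrite !(extend_pair_val _ zE).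
  have cM (x y : R[i]) : (x * y)^*%C = x^*%C * y^*%C by exact: rmorphM.
  by rewrite cM; ring.
have normP : hyp_integral F (fun z => normc (P z) ^+ 2 * imz z ^+ n) = \sum_(j < d) normc (c j) ^+ 2.
  rewrite normE petersson_cint (eq_cint _ PE).
  have S1 i := cint_sum (index_enum 'I_d) (fun j => cintegrableZ (c i * conjc (c j)) (fint2 i j)).
  have [_ ->] := cint_sum (index_enum 'I_d) (fun i => (S1 i).1).
  have -> : \sum_(i < d) cint mu2 (fun p => \sum_(j < d) c i * conjc (c j) * petersson_term (f i) (f j) p) =
      (\sum_(i < d) normc (c i) ^+ 2)%:C.
    rewrite (rmorph_sum (real_complex R)) /=; apply: eq_bigr => i _.
    rewrite (S1 i).2 (bigD1 i)//= big1 => [|j ji].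
      by rewrite cintZ// -petersson_cint forth eqxx mulr1 addr0 mul_conjc.
    by rewrite cintZ// -petersson_cint forth eq_sym (negbTE ji) mulr0.
  by [].
rewrite normP /bergman_sum -mulr_suml mulrA ler_wpM2r ?exprn_ge0 ?(ltW (imz_gt0 w))//.
apply: le_trans (sum_cauchy_schwarz _ _).
rewrite lerXn2r ?nnegrE ?normc_ge0//; first by apply: sumr_ge0 => j _; rewrite mulr_ge0 ?normc_ge0.
by rewrite cP; apply: le_trans (normc_sum _ _) _; apply: ler_sum => j _; rewrite Normc.normcM.
Qed.

End Petersson.

(** * The lower bound *)

Section LowerBound.
Variables (R : realType) (G : groupClosed (PSL2 R)).
Hypothesis fuchsianG : fuchsian G.
Hypothesis cocompactG : cocompact G.
Hypothesis no_ellipticG : forall g : PSL2 R, g \in G -> ~ elliptic g.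
Local Notation cnt := (@counting nat R).
Local Notation normc := Normc.normc.
Implicit Types (g h : PSL2 R) (z w : uhp R) (k n : nat) (F : set (uhp R)).

(** [D] is the range of an injection of the group into the naturals, hence finite when the group
    is. *)
Lemma group_enumeration : exists (D : set nat) (e : nat -> PSL2 R),
  set_bij D [set g | g \in G] e.
Proof.
have /countable_injP[c cinj] := fuchsian_countable fuchsianG.
pose e n := xget 1%g [set g | g \in G /\ c g = n].
have eP g : g \in G -> e (c g) = g.
  move=> gG; have [eG ce] : [set h | h \in G /\ c h = c g] (e (c g)) by apply: xgetPex; exists g.
  by apply: cinj; rewrite ?inE.
exists (c @` [set g | g \in G]), e; split.
- by move=> _ [g gG <-] /=; rewrite eP.
- by move=> n m /[!inE] -[g gG <-] [h hG <-]; rewrite !eP// => ->.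
- by move=> g gG; exists (c g); [exists g|exact: eP].
Qed.

(** Four powers of [q] are missing because [S] will be a sum of fourth powers, kept for
    convergence. *)
Lemma eventually_small (S q c : R) : 0 <= q -> q < c -> exists N, forall n, (N <= n)%N ->
  q ^+ (n - 4) * S <= c ^+ n.
Proof.
move=> q0 qc; have c0 : 0 < c by exact: le_lt_trans qc.
have x1 : `|q / c| < 1 by rewrite ger0_norm ?divr_ge0 ?(ltW c0)// ltr_pdivrMr// mul1r.
have /cvgrPdist_lt H := cvg_expr x1.
have e0 : 0 < c ^+ 4 / (`|S| + 1) by rewrite divr_gt0 ?exprn_gt0// ltr_wpDl.
have [N _ NP] := H _ e0; exists (N + 4)%N => n Nn.
have n4 : (4 <= n)%N by apply: leq_trans Nn; rewrite leq_addl.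
have := NP (n - 4)%N; rewrite /= leq_subRL// addnC => /(_ Nn).
rewrite sub0r normrN ger0_norm ?exprn_ge0 ?divr_ge0 ?(ltW c0)// expr_div_n.
rewrite ltr_pdivrMr ?exprn_gt0// mulrAC ltr_pdivlMr ?ltr_wpDl// -exprD subnKC// => lt.
apply: le_trans (ltW lt); rewrite ler_wpM2l ?exprn_ge0//.
by apply: le_trans (ler_norm _) _; rewrite lerDl.
Qed.

(** * Terms of the series relative to that of the identity *)

Section FixedPoint.
Variables (D : set nat) (e : nat -> PSL2 R).
Hypothesis e_bij : set_bij D [set g | g \in G] e.
Variable w : uhp R.

Definition ratio g : R := normc (ker 1%g w w) / normc (ker (repr g) w w).

Lemma ratio_gdisp g : ratio g = (gdisp g w)^-1.
Proof.
have y0 := imz_gt0 w; rewrite /ratio /gdisp /disp invf_div; congr (_ / _).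
rewrite ker1 /imz; case: w => -[x y] /= yp.
rewrite (_ : (x - x) ^+ 2 + (y - - y) ^+ 2 = (2 * y) ^+ 2); last by ring.
by rewrite sqrtr_sqr gtr0_norm// mulr_gt0.
Qed.

Lemma ratio_ge0 g : 0 <= ratio g. Proof. by rewrite divr_ge0 ?normc_ge0. Qed.

(** Only finitely many elements have displacement at most [gdisp g0 w + 1]. Their ratios below
    [ratio g0], together with [(gdisp g0 w + 1)^-1] for all other elements, have a maximum [q]. *)
Lemma ratio_gap g0 : g0 \in G ->
  exists2 q, 0 <= q < ratio g0 & forall g, g \in G -> ratio g < ratio g0 -> ratio g <= q.
Proof.
move=> g0G.
have d0 g : 0 < gdisp g w by apply: lt_le_trans (disp_ge1 _ _).
have /finite_seqP[s sE] := ker_finite w w (2 * imz w * (gdisp g0 w + 1)) fuchsianG.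
have [q [q0 qlt qs]] : exists q, [/\ (gdisp g0 w + 1)^-1 <= q, q < ratio g0 &
    forall g, g \in s -> ratio g < ratio g0 -> ratio g <= q].
  elim: s {sE} => [|g s [q [q0 qlt qs]]].
    exists (gdisp g0 w + 1)^-1; split => //.
    by rewrite ratio_gdisp ltf_pV2 ?posrE ?addr_gt0// ltrDl.
  have [gg|gg] := ltP (ratio g) (ratio g0); last first.
    exists q; split=> // h; rewrite inE => /predU1P[->|]; last exact: qs.
    by rewrite ltNge gg.
  exists (Num.max q (ratio g)); split; first by rewrite le_max q0.
    by rewrite gt_max qlt gg.
  by move=> h; rewrite inE le_max => /predU1P[-> _|hs /(qs h hs) ->//]; rewrite lexx orbT.
exists q.
  by rewrite qlt andbT (le_trans _ q0)// invr_ge0 addr_ge0// ltW.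
move=> g gG gg0; have [gs|gs] := boolP (g \in s); first exact: qs.
apply: le_trans q0; rewrite ratio_gdisp lef_pV2 ?posrE ?addr_gt0//.
rewrite leNgt; apply/negP => lt; move/negP: gs; apply.
have : [set g | g \in G /\ normc (ker (repr g) w w) <= 2 * imz w * (gdisp g0 w + 1)] g.
  split=> //; rewrite mulrC -ler_pdivrMr ?mulr_gt0 ?imz_gt0//; exact: ltW.
by rewrite sE.
Qed.

Definition ratio_pow n g : R[i] := (ker 1%g w w / ker (repr g) w w) ^+ n.

Lemma normc_ratio_pow n g : normc (ratio_pow n g) = ratio g ^+ n.
Proof. by rewrite normcX Normc.normcM Normc.normcV. Qed.

Lemma ratio_pow1 k : ratio_pow (2 * k) 1%g = 1.
Proof.
rewrite /ratio_pow exprMn (ker_repr_pi (1%g : SL2 R)) -exprMn mulfV ?ker_neq0//.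
by rewrite expr1n.
Qed.

(** On the axis the diagonal kernel is purely imaginary, as it is for the identity; the quotient is
    real and its even power nonnegative. *)
Lemma ratio_pow_axis k g : axis_form (repr g) w = 0 ->
  ratio_pow (2 * k) g = (ratio g ^+ (2 * k))%:C.
Proof.
move=> a0.
have im (x : R[i]) : complex.Re x = 0 -> x = (complex.Im x)%:C * 'i /\ normc x = `|complex.Im x|.
  case: x => a b /= ->; rewrite expr0n add0r sqrtr_sqr; split=> //.
  by apply/eqP; rewrite eq_complex /=; apply/andP; split; apply/eqP; ring.
have [E1 N1] : ker 1%g w w = (complex.Im (ker 1%g w w))%:C * 'i /\ normc (ker 1%g w w) = `|complex.Im (ker 1%g w w)|.
  by apply: im; rewrite ker1; case: w => -[x y] /= yp; rewrite subrr.
have [E2 N2] := im _ (etrans (Re_ker_diag _ _) a0).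
rewrite /ratio_pow /ratio N1 N2; rewrite {1}E1 {1}E2; move: (complex.Im _) (complex.Im _) => b a.
have -> : a%:C * 'i / (b%:C * 'i) = (a / b)%:C :> R[i].
  rewrite rmorphM fmorphV /= invfM mulrACA mulfV ?mulr1//; exact: neq0Ci.
by rewrite -[LHS](rmorphXn (real_complex R)); congr (_%:C); rewrite -normf_div !exprM real_normK ?num_real.
Qed.

Lemma poincare_ratio n : (4 <= n)%N -> forall F, fundamental_domain G F ->
  poincare D e n w w = (ker 1%g w w)^-1 ^+ n * gsum D e (ratio_pow n).
Proof.
move=> n4 F fundF; have I := gsummable_ker e_bij no_ellipticG fundF w w n4.
rewrite (eq_gsum e_bij (h := fun g => (ker 1%g w w) ^+ n * (ker (repr g) w w)^-1 ^+ n)).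
  by rewrite gsumZ// mulrA -exprMn mulVf ?ker_neq0// expr1n mul1r.
by move=> g _; rewrite /ratio_pow exprMn.
Qed.

Lemma Re_gsum_ge0 (f : PSL2 R -> R[i]) : (forall g, g \in G -> 0 <= complex.Re (f g)) ->
  0 <= complex.Re (gsum D e f).
Proof.
move=> f0; rewrite Re_gsum; apply: Rintegral_ge0 => m _; rewrite /gterm.
by case: ifPn => // /(e_in e_bij); exact: f0.
Qed.

Lemma gsummable_delta g0 (c : R[i]) : g0 \in G ->
  gsummable D e (fun g => if g == g0 then c else 0) /\
  complex.Re (gsum D e (fun g => if g == g0 then c else 0)) = complex.Re c.
Proof.
move=> g0G; split.
  apply/(gsummableP e_bij); rewrite (@esum_delta _ _ _ g0)//= ?eqxx ?ltry ?lee_fin ?normc_ge0//.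
  by move=> g _ /negbTE ->; rewrite Normc.normc0.
rewrite Re_gsum -(gterm_delta e_bij (fun=> complex.Re c) g0G); apply: eq_Rintegral => m _.
by rewrite /gterm; case: ifP => // _; case: ifP.
Qed.

Lemma ratio_sum_trivial k : (forall g, g \in G -> g = 1%g) ->
  1 <= complex.Re (gsum D e (ratio_pow (2 * k))).
Proof.
move=> triv; have G1 : 1%g \in G by exact: gpred1.
have [_] := gsummable_delta 1 G1.
rewrite (_ : gsum _ _ _ = gsum D e (ratio_pow (2 * k))) => [->//|].
by apply: (eq_gsum e_bij) => g /triv ->; rewrite eqxx ratio_pow1.
Qed.

(** Elements of minimal displacement contribute positive terms. Any other term is at most
    [q ^+ (n - 4) * ratio g ^+ 4] in modulus with [q < ratio g0], so the single term of [g0]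
    eventually outweighs the sum of these bounds. *)
Lemma ratio_sum_systole F g0 : fundamental_domain G F -> g0 \in G -> g0 != 1%g ->
  (forall h z, h \in G -> h != 1%g -> gdisp g0 w <= gdisp h z) ->
  exists k0, forall k, (k0 <= k)%N -> 1 <= complex.Re (gsum D e (ratio_pow (2 * k))).
Proof.
move=> fundF g0G g01 gmin.
have [q /andP[q0 qlt] qP] := ratio_gap g0G.
pose t g : R[i] := (ratio g ^+ 4)%:C.
have t_sum : gsummable D e t.
  apply: (@le_gsummable _ _ _ _ _ e_bij (normc (ker 1%g w w) ^+ 4) _ (fun g => (ker (repr g) w w)^-1 ^+ 4)); last exact: (gsummable_ker e_bij no_ellipticG fundF).
  move=> g _; rewrite normc_real ger0_norm ?exprn_ge0 ?ratio_ge0// /ratio.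
  by rewrite exprMn normcX Normc.normcV.
have [N NP] := eventually_small (complex.Re (gsum D e t)) q0 qlt.
exists (maxn N 2) => k; rewrite geq_max => /andP[Nk k2].
have n4 : (4 <= 2 * k)%N by rewrite -[4%N]/(2 * 2)%N leq_mul2l.
set n := (2 * k)%N in n4 *.
have Nn : (N <= n)%N by apply: leq_trans Nk _; rewrite /n mul2n -addnn leq_addr.
have G1 : 1%g \in G by exact: gpred1.
have [I1 E1] := gsummable_delta 1 G1.
have [I2 E2] := gsummable_delta ((ratio g0 ^+ n)%:C) g0G.
have It := gsummableZ ((- q ^+ (n - 4))%:C) t_sum.
have Ir : gsummable D e (ratio_pow n).
  apply: (@le_gsummable _ _ _ _ _ e_bij (normc (ker 1%g w w) ^+ n) _ (fun g => (ker (repr g) w w)^-1 ^+ n)); last exact: (gsummable_ker e_bij no_ellipticG fundF).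
  by move=> g _; rewrite normc_ratio_pow /ratio exprMn normcX Normc.normcV.
(* A termwise minorant of the real parts: the identity and [g0] keep their values, other elements of
   minimal displacement are estimated by 0, and the error bound is subtracted everywhere. *)
pose low g := ((if g == 1%g then 1 else 0) + (if g == g0 then (ratio g0 ^+ n)%:C else 0))
  + (- q ^+ (n - 4))%:C * t g.
have I12 := gsummableD I1 I2; have Il : gsummable D e low by exact: gsummableD.
have Elow : complex.Re (gsum D e low) = 1 + ratio g0 ^+ n - q ^+ (n - 4) * complex.Re (gsum D e t).
  rewrite gsumD// gsumD// gsumZ// !ReD E1 E2 ReM /= mul0r subr0.
  by rewrite mulNr.
have : 0 <= complex.Re (gsum D e (fun g => ratio_pow n g + (- 1) * low g)).
  apply: Re_gsum_ge0 => g gG; rewrite ReD.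
  have axis h : h \in G -> h != 1%g -> gdisp h w = gdisp g0 w ->
      complex.Re (ratio_pow n h) = ratio h ^+ n.
    move=> hG h1 hE; rewrite ratio_pow_axis//; apply: (axis_at_systole no_ellipticG hG) => z.
    by rewrite hE; exact: gmin.
  have lowE : complex.Re (- 1 * low g) = - ((if g == 1%g then 1 else 0) +
      (if g == g0 then ratio g0 ^+ n else 0)) + q ^+ (n - 4) * ratio g ^+ 4.
    rewrite mulN1r /low /t; case: (g == _); case: (g == _); rewrite /= ?mul0r ?subr0; ring.
  rewrite lowE; have tq : 0 <= q ^+ (n - 4) * ratio g ^+ 4.
    by rewrite mulr_ge0 ?exprn_ge0// ratio_ge0.
  have [g1|g1] := eqVneq g 1%g.
    rewrite g1 eq_sym (negbTE g01) ratio_pow1 addr0 addrA subrr add0r.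
    by rewrite -g1.
  have [gg0|gg0] := eqVneq g g0.
    by rewrite gg0 axis// add0r addrA subrr add0r -gg0.
  rewrite addr0 oppr0 add0r.
  have := gmin g w gG g1; rewrite le_eqVlt => /predU1P[gE|glt].
    by rewrite axis// addr_ge0// exprn_ge0// ratio_ge0.
  have dpos h : 0 < gdisp h w by apply: lt_le_trans (disp_ge1 _ _).
  have gq : ratio g <= q by apply: qP => //; rewrite !ratio_gdisp ltf_pV2 ?posrE.
  have := normc_ge_absRe (ratio_pow n g); rewrite normc_ratio_pow ler_norml => /andP[lo _].
  have : ratio g ^+ n <= q ^+ (n - 4) * ratio g ^+ 4.
    rewrite -{1}(subnK n4) exprD ler_wpM2r ?exprn_ge0 ?ratio_ge0//.
    by apply: lerXn2r; rewrite ?nnegrE ?ratio_ge0.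
  by move: lo; lra.
rewrite gsumD// ?gsumZ//; last exact: gsummableZ.
rewrite ReD mulN1r [complex.Re (- _)](_ : _ = - complex.Re (gsum D e low)); last by case: (gsum D e low).
by rewrite Elow; have := NP n Nn; lra.
Qed.

(** With [y = imz w], the preceding results give [p^2 y^n <= c p B]. Dividing by [p] and inserting
    [p >= (2 y)^-n] leaves [2^-n <= c B], where the power of 2 cancels against that in [c]. *)
Lemma bergman_sum_ge k F d (f : 'I_d -> uhp R -> R[i]) :
  (4 <= k)%N -> fundamental_domain G F -> orthonormal_basis G F k f ->
  1 <= complex.Re (gsum D e (ratio_pow (2 * k))) ->
  ((2 * k)%:R - 1) / (4 * pi) <= bergman_sum k f w.
Proof.
move=> k4 fundF fbasis sum1; set B := bergman_sum k f w; set n := (2 * k)%N in sum1 *.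
have k2 : (2 <= k)%N by exact: leq_trans k4.
have n4 : (4 <= n)%N by rewrite -[4%N]/(2 * 2)%N leq_mul2l.
have y0 := imz_gt0 w.
pose p := normc (poincare D e n w w); pose c := normc (pairing_const R n).
have k1E : normc (ker 1%g w w) = 2 * imz w.
  rewrite ker1 /imz; case: (w) y0 => -[x y] /= yp _.
  rewrite (_ : (x - x) ^+ 2 + (y - - y) ^+ 2 = (2 * y) ^+ 2); last by ring.
  by rewrite sqrtr_sqr gtr0_norm// mulr_gt0.
have pge : (2 * imz w)^-1 ^+ n <= p.
  rewrite /p (poincare_ratio n4 fundF) Normc.normcM normcX Normc.normcV k1E.
  rewrite ler_peMr ?exprn_ge0 ?invr_ge0 ?mulr_ge0 ?(ltW y0)//.
  by apply: le_trans sum1 _; apply: le_trans (ler_norm _) _; exact: normc_ge_absRe.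
have p0 : 0 < p by apply: lt_le_trans pge; rewrite exprn_gt0// invr_gt0 mulr_gt0.
have B0 : 0 <= B.
  by apply: sumr_ge0 => j _; rewrite mulr_ge0 ?exprn_ge0 ?normc_ge0// ltW.
have Pcusp := poincare_cusp_form e_bij fuchsianG cocompactG no_ellipticG fundF w k2.
have := bergman_lower fundF w fbasis Pcusp.
rewrite (poincare_norm e_bij no_ellipticG fundF w k4) -/n -/p -/B => le1.
have le2 : p * imz w ^+ n <= c * B.
  rewrite -(ler_pM2l p0) mulrA -expr2; apply: le_trans le1 _.
  rewrite mulrA ler_wpM2r// mulrC -Normc.normcM.
  by apply: le_trans (ler_norm _) _; exact: normc_ge_absRe.
have le3 : (2 ^+ n)^-1 <= c * B.
  apply: le_trans le2; apply: le_trans (ler_wpM2r (exprn_ge0 n (ltW y0)) pge).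
  by rewrite invfM exprMn -mulrA -exprMn mulVf ?gt_eqF// expr1n mulr1 exprVn.
have n1 : 0 < n%:R - 1 :> R by rewrite subr_gt0 ltr1n (leq_trans _ n4).
move: le3; rewrite /c normc_pairing_const ?(leq_trans _ n4)//.
have t0 : 0 < 2 ^+ n :> R by rewrite exprn_gt0.
have pi4 : 0 < 4 * pi :> R by rewrite mulr_gt0 ?pi_gt0.
rewrite ler_pdivrMr// => le3; rewrite -(ler_pM2l (_ : 0 < (2 ^+ n)^-1 * (4 * pi / (n%:R - 1)))); last first.
  by rewrite mulr_gt0 ?invr_gt0 ?divr_gt0.
move: (2 ^+ n) t0 (n%:R - 1) n1 (4 * pi) pi4 le3 => T T0 N N0 Q Q0 le3.
have [T1 N1] : T != 0 /\ N != 0 by rewrite (gt_eqF T0) (gt_eqF N0).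
have -> : T^-1 * (Q / N) * N = T^-1 * Q by field; rewrite T1.
have -> : T^-1 * (Q / N) * (B * Q) = Q / (N * T) * B * Q by field; rewrite T1 N1.
exact: ler_wpM2r (ltW Q0) _ _ le3.
Qed.

End FixedPoint.

Lemma exists_bergman_ge F0 : fundamental_domain G F0 ->
  exists (k0 : nat) (m : quot_uhp G), forall k, (k0 <= k)%N -> forall F, fundamental_domain G F ->
  forall d (f : 'I_d -> uhp R -> R[i]), orthonormal_basis G F k f ->
  ((2 * k)%:R - 1) / (4 * pi) <= bergman_sum k f (repr m).
Proof.
move=> fundF0; have [D [e e_bij]] := group_enumeration.
have [nontriv|triv] := pselect (exists2 g, g \in G & g != 1%g); last first.
  pose z : uhp R := exist _ (0 +i* 1) ltr01.
  exists 4%N, (\pi_(quot_uhp G) z) => k k4 F fundF d f fb.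
  apply: (bergman_sum_ge e_bij k4 fundF fb); apply: (ratio_sum_trivial e_bij) => g gG.
  by apply/eqP/negPn/negP => g1; apply: triv; exists g.
have [g [z [gG g1 gmin]]] := systole fuchsianG cocompactG nontriv.
pose m := \pi_(quot_uhp G) z.
(* The chosen representative may be another point of the orbit of [z]; conjugating [g] moves its
   minimum there. *)
have /eqmodP/asboolP[h hG zE] : repr m = z %[mod quot_uhp G] by rewrite reprK.
have wE : repr m = act h^-1%g z by rewrite zE -actM mulVg act1.
pose g0 : PSL2 R := (h^-1 * g * (h^-1)^-1)%g.
have hV : h^-1%g \in G by exact: gpredVr.
have g0G : g0 \in G by rewrite /g0 invgK !gpredM.
have g01 : g0 != 1%g by rewrite conj_eq1.
have g0min h' w : h' \in G -> h' != 1%g -> gdisp g0 (repr m) <= gdisp h' w.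
  by rewrite wE gdisp_conj; exact: gmin.
have [k0 k0P] := ratio_sum_systole e_bij fundF0 g0G g01 g0min.
exists (maxn k0 4), m => k; rewrite geq_max => /andP[k0k k4] F fundF d f fb.
by apply: (bergman_sum_ge e_bij k4 fundF fb); exact: k0P.
Qed.

End LowerBound.

Theorem mainTheorem2 (R : realType) (G : groupClosed (PSL2 R))
    (fuchsianG : fuchsian G) (cocompactG : cocompact G)
    (no_ellipticG : forall g : PSL2 R, g \in G -> ~ elliptic g) :
  exists k0 : nat, forall k : nat, (k0 <= k)%N ->
  forall (F : set (uhp R)), fundamental_domain G F ->
  forall (d : nat) (f : 'I_d -> uhp R -> R[i]), orthonormal_basis G F k f ->
  ((((2 * k)%:R - 1) / (4 * pi) : R)%:E <=
    ereal_sup (range (fun m : quot_uhp G => (bergman_sum k f (repr m))%:E)))%E.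
Proof.
(* The threshold precedes [F] in the order of quantifiers, so it is obtained from an arbitrary [F0];
   if there is none, the claim about every [F] holds vacuously. *)
have [[F0 fundF0]|noF] := pselect (exists F, fundamental_domain G F); last first.
  by exists 0%N => k _ F fundF; case: noF; exists F.
have [k0 [m mP]] := exists_bergman_ge fuchsianG cocompactG no_ellipticG fundF0.
exists k0 => k kk F fundF d f fb.
apply: (@le_trans _ _ (bergman_sum k f (repr m))%:E); last by apply: ereal_sup_ubound; exists m.
by rewrite lee_fin; exact: (mP _ kk _ fundF).
Qed.
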